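(* Let $G=SL(3,\mathbf{R})$, $K=SO(3)$, let $\nu_0=(\nu_{0,1},\nu_{0,2})\in\mathbf{C}^2$, $\sigma_0=(\sigma_{0,1},\sigma_{0,2})\in\{0,1\}^2$, and let $\pi_{(\nu_0,\sigma_0)}$ be the corresponding principal series representation (all notation as in the context). Let $l\in\mathbf{Z}_{\ge0}$ and $-2\le m\le 2$ be such that $d(\sigma_0;l)>0$ and $d(\sigma_0;l+m)>0$, and such that $V_{2(l+m)}$ occurs in $V_{2l}\otimes_{\mathbf{C}}V_4$. Then $$\mathfrak{C}_{l,m}\mathbf{S}(\sigma_0;l)=\mathbf{S}(\sigma_0;l+m)\cdot R(\Gamma^0_{l,m}),$$ where $R(\Gamma^0_{l,m})$ is the $d(\sigma_0;l+m)\times d(\sigma_0;l)$ complex matrix representing $\Gamma^0_{l,m}$ with respect to the induced bases $\{S(l;p)\mid p\in Z(\sigma_0;l)\}$ and $\{S(l+m;p)\mid p\in Z(\sigma_0;l+m)\}$ (ordered by increasing $p$), and it is given explicitly as follows. Put $d=d(\sigma_0;l)$, let $\delta\in\{0,1\}$ with $\delta\equiv l-\sigma_{0,2}\bmod 2$, and $$n=\begin{cases}(2-m)/2&\text{if } m\in\{0,\pm2\},\\ (3-m)/2&\text{if } m=\pm1,\ l+\sigma_{0,2}\text{ even},\\ (1-m)/2&\text{if } m=\pm1,\ l+\sigma_{0,2}\text{ odd},\end{cases}$$ $$\gamma_{p,1}=(\nu_{0,2}+\rho_{0,2}-l+p)A_{[2l,2m;2l-p+m-2,0]},$$ $$\gamma_{p,0}=-\tfrac13\Big(2\nu_{0,1}-\nu_{0,2}+2\rho_{0,1}-\rho_{0,2}+lm-3+\tfrac{m(m+1)}2\Big)A_{[2l,2m;2l-p+m,2]},$$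 $$\gamma_{p,-1}=(\nu_{0,2}+\rho_{0,2}+l-p)A_{[2l,2m;2l-p+m+2,4]},$$ where $(\rho_{0,1},\rho_{0,2})=(2,1)$ and $A_{[2l,2m;k,i]}=0$ for $k<0$ or $k>2(l+m)$. Let $D_j(c)=\mathrm{diag}(\gamma_{\delta,j},\gamma_{2+\delta,j},\dots,\gamma_{2c+\delta,j})$ (diagonal of size $c+1$). Let $O_{a,b}$ be the $a\times b$ zero matrix. Let $\mathbf{e}^{(c)}_i$ be the column vector of length $c+1$ with $(i+1)$-th entry $1$ and the other entries $0$ if $0\le i\le c$, and the zero column vector of length $c+1$ if $i<0$ or $i>c$. In the formulas below the symbols $D_j(-1)$, $O_{0,b}$, $O_{a,0}$ and $\mathbf{e}^{(-1)}_i$ are to be erased. Put $\widetilde R=\begin{pmatrix} O_{n,d} \\ R(\Gamma^0_{l,m}) \end{pmatrix}$. (1) If $\sigma_{0,2}=0$, $m\in\{0,\pm2\}$ and $\sigma_{0,1}+l$ is even, then $$\widetilde R=\begin{pmatrix} D_{-1}(d-1) \\ O_{1,d} \end{pmatrix}+\begin{pmatrix} O_{1,d} \\ D_0(d-1) \end{pmatrix}+\begin{pmatrix} O_{2,d-1}&O_{2,1} \\ D_1(d-2)&\gamma_{l,1}\,\mathbf{e}^{(d-2)}_{d-3}\end{pmatrix}.$$ (2) If $\sigma_{0,2}=0$, $m\in\{0,\pm2\}$ and $\sigma_{0,1}+l$ is odd, then $$\widetilde R=\begin{pmatrix} D_{-1}(d-1) \\ O_{1,d} \end{pmatrix}+\begin{pmatrix}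 O_{1,d} \\ D_0(d-1) \end{pmatrix}+\begin{pmatrix} O_{2,d-1}&O_{2,1} \\ D_1(d-2)&O_{d-1,1}\end{pmatrix}.$$ (3) If $\sigma_{0,2}=0$, $m=\pm1$ and $\sigma_{0,1}+l$ is even: for $d=1$, $R(\Gamma^0_{l,m})=(\gamma_{\delta,-1})$; for $d>1$, $$\widetilde R=D_{-1}(d-1)+\begin{pmatrix} O_{1,d-1}&0 \\ D_0(d-2)&O_{d-1,1} \end{pmatrix}+\begin{pmatrix} O_{2,d-2}&O_{2,1}&O_{2,1} \\ D_1(d-3)&O_{d-2,1}&-\gamma_{l,1}\,\mathbf{e}^{(d-3)}_{d-3}\end{pmatrix}.$$ (4) If $\sigma_{0,2}=0$, $m=\pm1$ and $\sigma_{0,1}+l$ is odd, then $$\widetilde R=\begin{pmatrix} D_{-1}(d-1) \\ O_{2,d} \end{pmatrix}+\begin{pmatrix} O_{1,d} \\ D_0(d-1) \\ O_{1,d} \end{pmatrix}+\begin{pmatrix} O_{2,d} \\ D_1(d-1) \end{pmatrix}.$$ (5) If $\sigma_{0,2}=1$, then $$\widetilde R=\begin{pmatrix} D_{-1}(d-1) \\ O_{1,d} \end{pmatrix}+\begin{pmatrix} O_{1,d} \\ D_0(d-1) \end{pmatrix}+\begin{pmatrix} O_{2,d-1}&O_{2,1} \\ D_1(d-2)&(-1)^{\varepsilon(\sigma_0;l+m)}\gamma_{l-1,1}\,\mathbf{e}^{(d-2)}_{d-2}\end{pmatrix}.$$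
   Context: **Representations of $K$.** $V_l$ ($l\in\mathbf{Z}_{\ge0}$) is the space of homogeneous polynomials of degree $l$ in $\mathbf{C}[x,y]$; $g\in SU(2)$ with $g^{-1}=\begin{pmatrix} a&b \\ -\bar b&\bar a \end{pmatrix}$ acts by $\tau_l(g)f(x,y)=f(ax+by,-\bar bx+\bar ay)$. Standard basis: $v^{(l)}_k=x^ky^{l-k}$ ($0\le k\le l$); $v^{(l)}_k=0$ for other $k$. The double covering $\varphi:SU(2)\to SO(3)=K$ is $$\varphi\begin{pmatrix} p+\sqrt{-1}q&r+\sqrt{-1}s \\ -r+\sqrt{-1}s&p-\sqrt{-1}q \end{pmatrix}=\begin{pmatrix} p^2+q^2-r^2-s^2&-2(ps-qr)&2(pr+qs) \\ 2(ps+qr)&p^2-q^2+r^2-s^2&-2(pq-rs) \\ -2(pr-qs)&2(pq+rs)&p^2-q^2-r^2+s^2 \end{pmatrix},$$ and $\tau_{2l}$ descends via $\varphi$ to an irreducible representation of $K$, still denoted $(\tau_{2l},V_{2l})$. $v^{(2l)*}_k$ is the dual basis of $V_{2l}^*$, $\langle\,,\rangle$ the canonical pairing. **$\mathfrak p_{\mathbf C}$.** $\mathfrak p$ = symmetric matrices in $\mathfrak g=\mathfrak{sl}(3,\mathbf R)$, with $K$ acting by $\mathrm{Ad}$. Basis of $\mathfrak p_{\mathbf C}$: $X_0=\begin{pmatrix} 0&0&0 \\ 0&1&-\sqrt{-1} \\ 0&-\sqrt{-1}&-1 \end{pmatrix}$, $X_1=-\frac12\begin{pmatrix} 0&\sqrt{-1}&1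 \\ \sqrt{-1}&0&0 \\ 1&0&0 \end{pmatrix}$, $X_2=-\frac13\mathrm{diag}(2,-1,-1)$, $X_3=-\frac12\begin{pmatrix} 0&\sqrt{-1}&-1 \\ \sqrt{-1}&0&0 \\ -1&0&0 \end{pmatrix}$, $X_4=\begin{pmatrix} 0&0&0 \\ 0&1&\sqrt{-1} \\ 0&\sqrt{-1}&-1 \end{pmatrix}$. The map $v^{(4)}_j\mapsto X_j$ is a $K$-isomorphism $V_4\cong\mathfrak p_{\mathbf C}$, used to identify the two. **Coefficients.** $A_{[l,2m;k,i]}=a(l,2m;k,i)/d(l,2m)$ ($0\le i\le4$, $0\le k\le l+2m$), where the lists $a(\cdot;k,0),\dots,a(\cdot;k,4)$ are: - $m=2$: $(l+4-k)(l+3-k)(l+2-k)(l+1-k)$; $4(l+4-k)(l+3-k)(l+2-k)k$; $6(l+4-k)(l+3-k)k(k-1)$; $4(l+4-k)k(k-1)(k-2)$; $k(k-1)(k-2)(k-3)$; $d(l,4)=(l+4)(l+3)(l+2)(l+1)$. - $m=1$: $(l+2-k)(l+1-k)(l-k)$; $-(l+2-k)(l+1-k)(l-4k)$; $-3(l+2-k)(l-2k+2)k$; $-(3l-4k+8)k(k-1)$; $-k(k-1)(k-2)$; $d(l,2)=(l+2)(l+1)l$. - $m=0$: $(l-k)(l-1-k)$; $-2(l-k)(l-2k-1)$; $l^2-6kl+6k^2-l$; $2(l-2k+1)k$; $k(k-1)$; $d(l,0)=l(l-1)$. - $m=-1$: $l-k-2$; $-(3l-4k-6)$; $3(l-2k-2)$;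 $-(l-4k-2)$; $-k$; $d(l,-2)=l-2$. - $m=-2$: $1;-4;6;-4;1$; $d(l,-4)=1$. (In the claim these are used with $l$ replaced by $2l$.) The map $I^{2l}_{2m}:V_{2(l+m)}\to V_{2l}\otimes\mathfrak p_{\mathbf C}$, $I^{2l}_{2m}(v^{(2(l+m))}_k)=\sum_{i=0}^4A_{[2l,2m;k,i]}\,v^{(2l)}_{k+2-m-i}\otimes X_i$, is an injective $K$-homomorphism whenever $V_{2(l+m)}$ occurs in $V_{2l}\otimes V_4$. **Principal series.** $A_0$ = diagonal matrices in $G$ with positive entries, $N_0$ = upper triangular unipotent matrices, $M_0=\{\mathrm{diag}(\varepsilon_1,\varepsilon_2,\varepsilon_1\varepsilon_2)\mid\varepsilon_i=\pm1\}$, $G=N_0A_0K$. For $(\mu_1,\mu_2)\in\mathbf C^2$, $e^{\mu}(\mathrm{diag}(a_1,a_2,a_3))=a_1^{\mu_1}a_2^{\mu_2}$; $\rho_0=(\rho_{0,1},\rho_{0,2})=(2,1)$; $\sigma_0(\mathrm{diag}(\varepsilon_1,\varepsilon_2,\varepsilon_1\varepsilon_2))=\varepsilon_1^{\sigma_{0,1}}\varepsilon_2^{\sigma_{0,2}}$. $\pi_{(\nu_0,\sigma_0)}$ is the right regular representation of $G$ on $H_{(\nu_0,\sigma_0)}$, the completion, for the norm $\|f\|^2=\int_K|f(k)|^2dk$, of the space of smooth $f:G\to\mathbf C$ with $f(namx)=e^{\nu_0+\rho_0}(a)\sigma_0(m)f(x)$ for $n\in N_0,a\in A_0,m\in M_0,x\in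 G$. $H_{(\nu_0,\sigma_0),K}$ is its space of $K$-finite vectors; the differential of $\pi_{(\nu_0,\sigma_0)}$ is denoted by the same symbol. **Elementary functions.** $\varepsilon(\sigma_0;l)\in\{0,1\}$ with $\varepsilon(\sigma_0;l)\equiv l-\sigma_{0,1}-\sigma_{0,2}\bmod2$. $Z(\sigma_0;l)$ is the set of integers $p\equiv l-\sigma_{0,2}\bmod2$ with $0\le p\le l$ if $\varepsilon(\sigma_0;l)=0$, and with $0\le p\le l-1$ if $\varepsilon(\sigma_0;l)=1$; $d(\sigma_0;l)=\#Z(\sigma_0;l)$ ($=\dim\mathrm{Hom}_K(V_{2l},H_{(\nu_0,\sigma_0),K})$). For $p\in Z(\sigma_0;l)$, $0\le q\le2l$, $s(l;p,q)\in H_{(\nu_0,\sigma_0),K}$ is the element whose restriction to $K$ is $x\mapsto\langle v^{(2l)*}_{2l-p}+(-1)^{\varepsilon(\sigma_0;l)}v^{(2l)*}_p,\tau_{2l}(x)v^{(2l)}_q\rangle$. $S(l;p)$ is the column vector ${}^t(s(l;p,0),\dots,s(l;p,2l))$, identified with the $K$-homomorphism $V_{2l}\to H_{(\nu_0,\sigma_0),K}$, $v^{(2l)}_q\mapsto s(l;p,q)$; these form a basis (the induced basis) of $\mathrm{Hom}_K(V_{2l},H_{(\nu_0,\sigma_0),K})$. $\mathbf S(\sigma_0;l)$ is the $(2l+1)\times d(\sigma_0;l)$ matrix with columns $S(l;p)$, $p\in Z(\sigma_0;l)$ in increasing order. **The operators.** For $\eta\in\mathrm{Hom}_K(V_{2l},H_{(\nu_0,\sigma_0),K})$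 let $\tilde\eta(v\otimes X)=\pi_{(\nu_0,\sigma_0)}(X)\eta(v)$ and $\Gamma^0_{l,m}(\eta)=\tilde\eta\circ I^{2l}_{2m}\in\mathrm{Hom}_K(V_{2(l+m)},H_{(\nu_0,\sigma_0),K})$. For a column vector $\mathbf v={}^t(v_0,\dots,v_{2l})$ with entries in $H_{(\nu_0,\sigma_0),K}$, $\mathfrak C_{l,m}\mathbf v$ is the column vector of length $2(l+m)+1$ whose $(k+1)$-th entry ($0\le k\le2(l+m)$) is $\sum_{i=0}^4A_{[2l,2m;k,i]}\pi_{(\nu_0,\sigma_0)}(X_i)v_{k+2-m-i}$ (with $v_j=0$ for $j<0$ or $j>2l$); $\mathfrak C_{l,m}$ acts on a matrix column by column.
   Formalization: For small d ((1),(3): d≤2; (5): d=1) the printed formulas drop a term; the formal statement restores γ_{l,1} (1), −γ_{l,1} (3), or (−1)^ε γ_{l−1,1} (5) in the last column, row d ((1),(3)) or d+1 (5) of R̃; so (3) with d=1 reads R=(γ_{δ,−1}−γ_{l,1}). *)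

(* Defs.v *)
From HB Require Import structures.
From mathcomp Require Import all_boot all_order all_algebra complex.
From mathcomp Require mpoly.
From mathcomp Require Import all_classical all_reals all_analysis.

Set Implicit Arguments.
Unset Strict Implicit.
Unset Printing Implicit Defensive.

Import Order.TTheory GRing.Theory Num.Theory.
Import numFieldNormedType.Exports.
(* The notations of mpoly clash with those of all_analysis. *)
Import -(notations) mpoly.

Local Open Scope classical_set_scope.
Local Open Scope complex_scope.
Local Open Scope ring_scope.

Definition mx_of_seq (T : zmodType) n (s : seq (seq T)) : 'M[T]_n :=
  \matrix_(i, j) (nth [::] s i)`_j.

Section Groups.
Context (R : realType).

Definition SL3 : set 'M[R]_3 := [set x | \det x = 1].

Definition SO3 : set 'M[R]_3 := [set k | k *m k^T = 1%:M /\ \det k = 1].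

Definition diag3 (a b c : R) : 'M[R]_3 := diag_mx (\row_j [:: a; b; c]`_j).

Definition N0 : set 'M[R]_3 :=
  [set n | (forall i j : 'I_3, (j < i)%N -> n i j = 0) /\
           (forall i : 'I_3, n i i = 1)].

Definition A0 : set 'M[R]_3 :=
  [set a | exists a1 a2 a3 : R,
     [/\ 0 < a1, 0 < a2, 0 < a3, a1 * a2 * a3 = 1 & a = diag3 a1 a2 a3]].

Definition M0 : set 'M[R]_3 :=
  [set m | exists e1 e2 : R,
     [/\ e1 \in [:: 1; -1], e2 \in [:: 1; -1] & m = diag3 e1 e2 (e1 * e2)]].

Definition SU2 : set 'M[R[i]]_2 :=
  [set g | g *m (map_mx conjc g)^T = 1%:M /\ \det g = 1].

Definition phi (g : 'M[R[i]]_2) : 'M[R]_3 :=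
  let p := complex.Re (g 0 0) in let q := complex.Im (g 0 0) in
  let r := complex.Re (g 0 1) in let s := complex.Im (g 0 1) in
  mx_of_seq 3
    [:: [:: p^+2 + q^+2 - r^+2 - s^+2; - 2 * (p*s - q*r); 2 * (p*r + q*s)];
        [:: 2 * (p*s + q*r); p^+2 - q^+2 + r^+2 - s^+2; - 2 * (p*q - r*s)];
        [:: - 2 * (p*r - q*s); 2 * (p*q + r*s); p^+2 - q^+2 - r^+2 + s^+2]].

(* The exponential series; it is used on sl(3,R). *)
Definition expmx (X : 'M[R]_3) : 'M[R]_3 :=
  limn (series (fun k : nat => (k`!%:R)^-1 *: X ^+ k)).

End Groups.

(* V_l is represented by 'cV[R[i]]_l.+1: a column holds the coordinates of a
   homogeneous polynomial with respect to the basis x^k y^(l-k), 0 <= k <= l. *)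
Section Representations.
Context (R : realType).
Local Notation C := (R[i]).

Definition varx : mpoly.mpoly 2 C := mpoly.mpolyX C (mpoly.mnm1 (0 : 'I_2)).
Definition vary : mpoly.mpoly 2 C := mpoly.mpolyX C (mpoly.mnm1 (1 : 'I_2)).

Definition coef_xy (i j : nat) (f : mpoly.mpoly 2 C) : C :=
  mpoly.mcoeff (mpoly.Multinom [tuple i; j]) f.

(* The matrix of f |-> f(a x + b y, - b^* x + a^* y), where (a, b) is the
   first row of g^-1: its k-th column is the image of x^k y^(l-k). *)
Definition tau (l : nat) (g : 'M[C]_2) : 'M[C]_l.+1 :=
  let a := invmx g 0 0 in let b := invmx g 0 1 in
  let sub := [tuple a *: varx + b *: vary;
                    - conjc b *: varx + conjc a *: vary] in
  \matrix_(j, k)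
    coef_xy j (l - j) (mpoly.comp_mpoly sub (varx ^+ k * vary ^+ (l - k))).

(* The representation (tau_{2l}, V_{2l}) of SO(3): any preimage under the
   double covering phi may be chosen, since tau_{2l}(-1) = 1. *)
Definition tauK (l : nat) (x : 'M[R]_3) : 'M[C]_((2 * l).+1) :=
  tau (2 * l) (xget 1%:M [set u | SU2 u /\ phi u = x]).

(* v^{(l)}_j, which is 0 unless 0 <= j <= l *)
Definition vbas (l : nat) (j : int) : 'cV[C]_l.+1 :=
  \col_k ((k : nat)%:Z == j)%:R.

Definition Xp (i : 'I_5) : 'M[C]_3 :=
  let I : C := 0 +i* 1 in
  nth 0
   [:: mx_of_seq 3 [:: [:: 0; 0; 0]; [:: 0; 1; - I]; [:: 0; - I; - 1]];
       - 2^-1 *: mx_of_seq 3 [:: [:: 0; I; 1]; [:: I; 0; 0]; [:: 1; 0; 0]];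
       - 3^-1 *: mx_of_seq 3 [:: [:: 2; 0; 0]; [:: 0; -1; 0]; [:: 0; 0; -1]];
       - 2^-1 *: mx_of_seq 3 [:: [:: 0; I; -1]; [:: I; 0; 0]; [:: -1; 0; 0]];
       mx_of_seq 3 [:: [:: 0; 0; 0]; [:: 0; 1; I]; [:: 0; I; -1]]] i.

(* V_{2l} (x) p_C is represented by 'M_((2 * l).+1, 5): the entry (j, i) is the
   coordinate on v^{(2l)}_j (x) X_i.  As X_i corresponds to v^{(4)}_i under the
   identification of p_C with V_4, this is also V_{2l} (x) V_4. *)
Definition tensK (l : nat) (x : 'M[R]_3) (T : 'M[C]_((2 * l).+1, 5)) :
    'M[C]_((2 * l).+1, 5) :=
  tauK l x *m T *m (tauK 2 x)^T.

(* V_{2l'} occurs in V_{2l} (x) V_4; V_{2l'} is irreducible *)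
Definition occurs (l' l : nat) : Prop :=
  exists J : {linear 'cV[C]_(2 * l').+1 -> 'M[C]_((2 * l).+1, 5)},
    injective J /\
    (forall x w, SO3 x -> J (tauK l' x *m w) = tensK x (J w)).

Definition a_list (l m k : int) : seq int :=
  if m == 2 then
    [:: (l+4-k) * (l+3-k) * (l+2-k) * (l+1-k);
        4 * (l+4-k) * (l+3-k) * (l+2-k) * k;
        6 * (l+4-k) * (l+3-k) * k * (k-1);
        4 * (l+4-k) * k * (k-1) * (k-2);
        k * (k-1) * (k-2) * (k-3)]
  else if m == 1 then
    [:: (l+2-k) * (l+1-k) * (l-k);
        - (l+2-k) * (l+1-k) * (l-4*k);
        - 3 * (l+2-k) * (l-2*k+2) * k;
        - (3 * l - 4 * k+8) * k * (k-1);
        - k * (k-1) * (k-2)]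
  else if m == 0 then
    [:: (l-k) * (l-1-k);
        - 2 * (l-k) * (l-2*k-1);
        l^+2 - 6 * k * l + 6*k^+2 - l;
        2 * (l-2*k+1) * k;
        k * (k-1)]
  else if m == -1 then
    [:: l-k-2; - (3 * l - 4 * k-6); 3 * (l-2*k-2); - (l-4*k-2); - k]
  else if m == -2 then [:: 1; -4; 6; -4; 1]
  else [::].

Definition d_den (l m : int) : int :=
  if m == 2 then (l+4) * (l+3) * (l+2) * (l+1)
  else if m == 1 then (l+2) * (l+1) * l
  else if m == 0 then l * (l-1)
  else if m == -1 then l-2
  else 1.

(* A_{[l,2m;k,i]}, extended by 0 outside 0 <= k <= l + 2m *)
Definition Acoef (l : nat) (m k : int) (i : nat) : C :=
  if (0 <= k) && (k <= l%:Z + 2 * m)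
  then ((a_list l%:Z m k)`_i)%:~R / (d_den l%:Z m)%:~R else 0.

(* I^{2l}_{2m} : V_{2l'} -> V_{2l} (x) p_C, used with l' = l + m *)
Definition Imap (l l' : nat) (m : int) (w : 'cV[C]_(2 * l').+1) :
    'M[C]_((2 * l).+1, 5) :=
  \sum_(k < (2 * l').+1) w k 0 *:
    \sum_(i < 5) Acoef (2 * l) m (k : nat)%:Z i *:
      (vbas (2 * l) ((k : nat)%:Z + 2 - m - (i : nat)%:Z) *m delta_mx 0 i).

End Representations.

Section PrincipalSeries.
Context (R : realType).
Local Notation C := (R[i]).
Local Notation M3 := 'M[R]_3.

(* a ^ z = exp (z ln a) for a > 0 *)
Definition cpow (a : R) (z : C) : C :=
  (expR (complex.Re z * ln a))%:C *
  (cos (complex.Im z * ln a) +i* sin (complex.Im z * ln a)).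

Definition eA (mu : C * C) (a : M3) : C := cpow (a 0 0) mu.1 * cpow (a 1 1) mu.2.

Definition rho0 : C * C := (2, 1).

Definition chiM (sigma : 'I_2 * 'I_2) (m : M3) : C :=
  (m 0 0 ^+ sigma.1 * m 1 1 ^+ sigma.2)%:C.

Fixpoint Cdiff (n : nat) (U : set M3) (f : M3 -> R) : Prop :=
  (forall x, U x -> {for x, continuous f}) /\
  (if n is n'.+1 then
     forall v : M3, (forall x, U x -> derivable f x v) /\
                    Cdiff n' U (fun x => 'D_v f x)
   else True).

(* Functions on G are represented by functions on 'M_3 of which only the values
   on SL(3,R) matter.  A function on the submanifold SL(3,R) is smooth if it
   locally extends to a smooth function on an open subset of 'M_3. *)
Definition smooth_SL3 (f : M3 -> C) : Prop :=
  forall g, SL3 g -> exists (U : set M3) (F : M3 -> C),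
    [/\ open U, U g, (forall x, U x -> SL3 x -> F x = f x) &
        forall n, Cdiff n U (fun x => complex.Re (F x)) /\
                  Cdiff n U (fun x => complex.Im (F x))].

Definition smooth_sections (nu : C * C) (sigma : 'I_2 * 'I_2) :
    set (M3 -> C) :=
  [set f | smooth_SL3 f /\
     forall n a m x, N0 n -> A0 a -> M0 m -> SL3 x ->
       f (n *m a *m m *m x) =
       eA (nu.1 + rho0.1, nu.2 + rho0.2) a * chiM sigma m * f x].

(* dk is the Haar measure of total mass 1 on SO(3), viewed as a Borel measure
   on 'M_3 concentrated on SO(3). *)
Definition is_haar_SO3
    (dk : probability (g_sigma_algebraType (@open M3)) R) : Prop :=
  dk (@SO3 R) = 1%E /\
  forall (k : M3) (A : set (g_sigma_algebraType (@open M3))),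
    SO3 k -> measurable A -> dk [set x : M3 | A (k *m x)] = dk A.

Definition normK (dk : probability (g_sigma_algebraType (@open M3)) R)
    (f : M3 -> C) : R :=
  Num.sqrt (fine (\int[dk]_(k in @SO3 R)
    ((complex.Re (f k)) ^+ 2 + (complex.Im (f k)) ^+ 2)%:E)%E).

(* H, with the embedding emb, is the completion of the space of smooth
   sections for the norm normK, and act is the extension to H of right
   translation. *)
Record is_principal_series (nu : C * C) (sigma : 'I_2 * 'I_2)
    (dk : probability (g_sigma_algebraType (@open M3)) R)
    (H : completeNormedModType C) (emb : (M3 -> C) -> H)
    (act : M3 -> H -> H) : Prop := {
  emb_linear : forall (c : C) f g,
    smooth_sections nu sigma f -> smooth_sections nu sigma g ->
    emb (fun x => c * f x + g x) = c *: emb f + emb g;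
  emb_isometry : forall f,
    smooth_sections nu sigma f -> `|emb f| = (normK dk f)%:C;
  emb_dense : closure (emb @` smooth_sections nu sigma) = setT;
  act_linear : forall g, SL3 g -> linear (act g);
  act_continuous : forall g, SL3 g -> continuous (act g);
  act_emb : forall g f, SL3 g -> smooth_sections nu sigma f ->
    act g (emb f) = emb (fun x => f (x *m g)) }.

(* epsilon(sigma_0; l); subtraction and addition agree modulo 2 *)
Definition eps (sigma : 'I_2 * 'I_2) (l : nat) : nat :=
  ((l + sigma.1 + sigma.2) %% 2)%N.

Definition Zset (sigma : 'I_2 * 'I_2) (l : nat) : seq nat :=
  [seq p <- iota 0 (if eps sigma l == 0%N then l.+1 else l)
   | p == l + sigma.2 %[mod 2]].

Definition dZ (sigma : 'I_2 * 'I_2) (l : nat) : nat := size (Zset sigma l).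

(* x |-> < v*_{2l-p} + (-1)^eps v*_p , tau_{2l}(x) v_q > *)
Definition coefS (sigma : 'I_2 * 'I_2) (l p : nat) (q : 'I_(2 * l).+1)
    (x : M3) : C :=
  tauK l x (inord (2 * l - p)) q + (-1) ^+ eps sigma l * tauK l x (inord p) q.

(* The smooth section with restriction coefS to SO(3); it is unique on
   SL(3,R) because SL(3,R) = N_0 A_0 SO(3). *)
Definition s_fun (nu : C * C) (sigma : 'I_2 * 'I_2) (l p : nat)
    (q : 'I_(2 * l).+1) : M3 -> C :=
  xget (fun=> 0) [set f : M3 -> C | smooth_sections nu sigma f /\
                    forall x, SO3 x -> f x = coefS sigma p q x].

Section Operators.
Context (nu : C * C) (sigma : 'I_2 * 'I_2).
Context (H : completeNormedModType C) (emb : (M3 -> C) -> H).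
Context (act : M3 -> H -> H).

Definition Smx (l : nat) : 'M[H]_((2 * l).+1, dZ sigma l) :=
  \matrix_(q, j) emb (s_fun nu sigma (nth 0%N (Zset sigma l) j) q).

(* The differential of act on sl(3,R), and its complex-linear extension *)
Definition dpi (X : M3) (v : H) : H :=
  lim ((t^-1)%:C *: (act (expmx (t *: X)) v - v) @[t --> (0 : R)^']).

Definition dpiC (X : 'M[C]_3) (v : H) : H :=
  dpi (map_mx (@complex.Re R) X) v +
  (0 +i* 1) *: dpi (map_mx (@complex.Im R) X) v.

(* The linear map V -> H which a column of vectors of H defines on the
   standard basis *)
Definition hom_of n (v : 'cV[H]_n) (w : 'cV[C]_n) : H :=
  \sum_(q < n) w q 0 *: v q 0.

(* The linear map with v (x) X |-> pi(X) eta(v) *)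
Definition eta_tilde (l : nat) (eta : 'cV[C]_(2 * l).+1 -> H)
    (T : 'M[C]_((2 * l).+1, 5)) : H :=
  \sum_(j < (2 * l).+1) \sum_(i < 5)
    T j i *: dpiC (Xp R i) (eta (vbas R (2 * l) (j : nat)%:Z)).

Definition Gamma0 (l l' : nat) (m : int) (eta : 'cV[C]_(2 * l).+1 -> H)
    (w : 'cV[C]_(2 * l').+1) : H :=
  eta_tilde eta (Imap l m w).

Definition calC_col (l l' : nat) (m : int) (v : 'cV[H]_(2 * l).+1) :
    'cV[H]_(2 * l').+1 :=
  \col_(k < (2 * l').+1) \sum_(i < 5)
    Acoef R (2 * l) m (k : nat)%:Z i *:
      dpiC (Xp R i)
        (\sum_(q < (2 * l).+1
               | (q : nat)%:Z == (k : nat)%:Z + 2 - m - (i : nat)%:Z) v q 0).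

Definition calC (l l' : nat) (m : int) n (S : 'M[H]_((2 * l).+1, n)) :
    'M[H]_((2 * l').+1, n) :=
  \matrix_(k, j) calC_col l' m (col j S) k 0.

Definition mulHmx a b c (S : 'M[H]_(a, b)) (A : 'M[C]_(b, c)) : 'M[H]_(a, c) :=
  \matrix_(i, j) \sum_k A k j *: S i k.

(* A is a matrix of Gamma^0_{l,m} with respect to the families S(l;p) and
   S(l+m;p) *)
Definition represents_Gamma0 (l l' : nat) (m : int)
    (A : 'M[C]_(dZ sigma l', dZ sigma l)) : Prop :=
  forall (j : 'I_(dZ sigma l)) (w : 'cV[C]_(2 * l').+1),
    Gamma0 m (hom_of (col j (Smx l))) w =
    \sum_i A i j *: hom_of (col i (Smx l')) w.

End Operators.

Section ExplicitMatrix.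
Context (nu : C * C) (sigma : 'I_2 * 'I_2) (l : nat) (m : int).

Definition delta_l : nat := ((l + sigma.2) %% 2)%N.

Definition n_shift : nat :=
  if (m == 1) || (m == -1) then
    if odd (l + sigma.2) then `|((1 - m) %/ 2)%Z|%N else `|((3 - m) %/ 2)%Z|%N
  else `|((2 - m) %/ 2)%Z|%N.

Definition gamma (p j : int) : C :=
  let L := l%:Z in
  if j == 1 then
    (nu.2 + rho0.2 - L%:~R + p%:~R) * Acoef R (2 * l) m (2 * L - p + m - 2) 0
  else if j == 0 then
    - 3^-1 * (2 * nu.1 - nu.2 + 2 * rho0.1 - rho0.2 + (L * m)%:~R - 3
              + (m * (m + 1))%:~R / 2) * Acoef R (2 * l) m (2 * L - p + m) 2
  else if j == -1 then
    (nu.2 + rho0.2 + L%:~R - p%:~R) * Acoef R (2 * l) m (2 * L - p + m + 2) 4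
  else 0.

(* D_j(c), indexed by its size k = c + 1; D_j(-1) is the 0 x 0 matrix, so that
   mathcomp block matrices erase it. *)
Definition Dmx (j : int) (k : nat) : 'M[C]_k :=
  diag_mx (\row_(i < k) gamma (2 * (i : nat)%:Z + delta_l%:Z) j).

(* e^{(c)}_i, indexed by its length k = c + 1 *)
Definition evec (k : nat) (i : int) : 'cV[C]_k :=
  \col_(t < k) ((t : nat)%:Z == i)%:R.

End ExplicitMatrix.

Definition Omx (a b : nat) : 'M[C]_(a, b) := 0.

(* conform_mx B A is A when A and B have the same dimensions (otherwise it is
   B): fit A transports A along a propositional equality of dimensions. *)
Definition fit a b a' b' (A : 'M[C]_(a', b')) : 'M[C]_(a, b) :=
  conform_mx (0 : 'M[C]_(a, b)) A.

Definition single a b (i j : nat) (c : C) : 'M[C]_(a, b) :=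
  \matrix_(s, t) (if ((s : nat) == i) && ((t : nat) == j) then c else 0).

End PrincipalSeries.

(* Main.v *)
Require Import Defs.
From HB Require Import structures.
From mathcomp Require Import all_boot all_order all_algebra complex ring lra zify.
From mathcomp Require mpoly.
From mathcomp Require Import all_classical all_reals all_analysis measurable_realfun.

Set Implicit Arguments.
Unset Strict Implicit.
Unset Printing Implicit Defensive.

Import Order.TTheory GRing.Theory Num.Theory.
Import numFieldNormedType.Exports.
Import -(notations) mpoly.

Local Open Scope classical_set_scope.
Local Open Scope complex_scope.
Local Open Scope ring_scope.


(** An element of Hom_K(V_2l, H) is determined by a row vector [lam], the functional on V_2l
    obtained by evaluating its sections at 1. A functional with the right behaviour under M0 gives
    the sections [Phi nu lam q], equal on K to coordinate q of [lam *m tauK l k] and extended to G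
    by the Iwasawa decomposition. The induced basis comes from the functionals [lamS] ([lamS_M0],
    [emb_s_fun]). So Gamma^0_{l,m} becomes a linear map on functionals, and only derivatives at the
    identity have to be computed.

    Three facts make this reduction possible. Difference quotients of the sections converge
    uniformly on K, hence in H, so that pi(X) acts by ordinary differentiation
    ([uniform_derivative], [dpi_Phi]). The adjoint action on the X_i is tau_4 ([Ad_Xp]), and
    I^{2l}_{2m} is a classical transvectant of binary forms, hence a K-map ([Imap_equivariant]);
    therefore the image of a section is again of the form functional times tau(k), with the
    functional [Gam] read off at k = 1 ([Gamma0_Phi]). Finally, at the identity each X_i splits as
    strictly upper triangular + diagonal + skew: the first part contributes 0, the second acts
    through nu + rho, the third through the derivative of tau_2l ([LC_Phi_Xp]).

    In [Gam] the terms i = 1, 2, 3 involve the same weight and merge by a linear relation between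
    the coefficients A ([Acoef_middle]). What remains is [Gam_lamSz]: the functional of index p goes
    to the sum over s = -1, 0, 1 of gamma_{p,s} times the functional of index p + m + 2s; the
    symmetry [Acoef_sym] makes the two halves of the functional agree. An index t beyond l' is
    folded back to 2l' - t with the sign (-1)^eps ([lamSz_decomposition]). After a shift by n rows
    the three terms form three diagonals, and folding affects the last column only ([Rmx_entry]);
    the five cases are bookkeeping on indices.

    The matrix is unique because a functional whose sections all vanish in H is zero: tau_2l is
    unitary for binomial weights, so the weighted square norm of the sections is constant on K
    ([emb_lam_inj]). *)

(** * Columns as binary forms *)

Section HomogeneousEvaluation.
Context (F : numFieldType).

Definition heval n (v : 'cV[F]_n.+1) (x y : F) : F :=
  \sum_(j < n.+1) v j 0 * (x ^+ j * y ^+ (n - j)).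

Lemma poly_eq0 (p : {poly F}) : (forall x, p.[x] = 0) -> p = 0.
Proof.
move=> p0.
pose rs := [seq (i%:R : F) | i <- iota 0 (size p)].
apply: (@roots_geq_poly_eq0 _ p rs).
- by apply/allP => x _; rewrite /root p0.
- rewrite map_inj_uniq ?iota_uniq // => i j /eqP.
  by rewrite eqr_nat => /eqP.
- by rewrite size_map size_iota.
Qed.

(** The degree being fixed, setting y = 1 loses nothing, and a polynomial in one variable that
    vanishes everywhere is 0. Identities in V_n and in tensor products are proved below by comparing
    values. *)
Lemma heval_inj n (v w : 'cV[F]_n.+1) :
  (forall x y, heval v x y = heval w x y) -> v = w.
Proof.
move=> vw; pose p (u : 'cV[F]_n.+1) := \poly_(j < n.+1) u (inord j) 0.
have pE u x : (p u).[x] = heval u x 1.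
  rewrite /p horner_poly; apply: eq_bigr => j _.
  by rewrite inord_val expr1n mulr1.
have : p v - p w = 0.
  by apply: poly_eq0 => x; rewrite hornerD hornerN !pE vw subrr.
move/eqP; rewrite subr_eq0 => /eqP pvw.
apply/colP => j; have := congr1 (fun q : {poly F} => q`_j) pvw.
by rewrite /p !coef_poly ltn_ord inord_val.
Qed.

(** Used to read the entries of [tau] as coefficients of a product of linear polynomials in one
    variable. *)
Lemma heval_coef n k (p q : {poly F}) (a b c d : F) :
  (k <= n)%N -> p = a *: 'X + b%:P -> q = c *: 'X + d%:P ->
  forall v : 'cV[F]_n.+1,
  (forall x y, heval v x y = (a * x + b * y) ^+ k * (c * x + d * y) ^+ (n - k)) ->
  forall j : 'I_n.+1, v j 0 = (p ^+ k * q ^+ (n - k))`_j.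
Proof.
move=> kn -> -> v hv j.
have -> : (a *: 'X + b%:P) ^+ k * (c *: 'X + d%:P) ^+ (n - k)
          = \poly_(j < n.+1) v (inord j) 0.
  apply/eqP; rewrite -subr_eq0; apply/eqP; apply: poly_eq0 => x.
  rewrite hornerD hornerN hornerM !horner_exp !hornerD !hornerZ !hornerX !hornerC.
  have := hv x 1; rewrite !mulr1 => <-; apply/eqP; rewrite subr_eq0; apply/eqP.
  by rewrite horner_poly; apply: eq_bigr => i _; rewrite inord_val expr1n mulr1.
by rewrite coef_poly ltn_ord inord_val.
Qed.

End HomogeneousEvaluation.

(** * The representation tau_n as a substitution of variables *)

Section Tau.
Context (R : realType).
Local Notation C := (R[i]).

Lemma homog_meval n (f : mpoly.mpoly 2 C) (v : 'I_2 -> C) :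
  f \is mpoly.ishomog1 n mpoly.mdeg ->
  mpoly.meval v f =
  \sum_(j < n.+1) coef_xy j (n - j) f * (v 0 ^+ j * v 1 ^+ (n - j)).
Proof.
move=> hf; rewrite mpoly.mevalE.
pose mn j : mpoly.multinom 2 := mpoly.Multinom [tuple j; (n - j)%N].
pose L := [seq mn j | j <- iota 0 n.+1].
have mn0 j : mn j 0 = j by rewrite mpoly.multinomE.
have mn1 j : mn j 1 = (n - j)%N by rewrite mpoly.multinomE.
have uL : uniq L.
  rewrite map_inj_uniq ?iota_uniq // => i j ij.
  by rewrite -(mn0 i) ij mn0.
have sub m : m \in mpoly.msupp f -> m \in L.
  move=> /(mpoly.dhomog_mf hf) /=; rewrite mpoly.mdegE !big_ord_recl big_ord0 => mE.
  apply/mapP; exists (m 0).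
    by rewrite mem_iota /= add0n ltnS -mE leq_addr.
  apply/mpoly.mnmP => i; case: (unliftP 0 i) => [i'|] ->; last by rewrite mn0.
  rewrite (ord1 i') (_ : lift _ _ = 1); last exact/val_inj.
  rewrite mn1 -mE addn0 (_ : lift _ _ = 1); last exact/val_inj.
  by rewrite addKn.
have pe : perm_eq (mpoly.msupp f) [seq m <- L | m \in mpoly.msupp f].
  apply: uniq_perm; rewrite ?filter_uniq ?mpoly.msupp_uniq // => m.
  by rewrite mem_filter andb_idr //; exact: sub.
rewrite (perm_big _ pe) big_filter big_mkcond big_map -[in RHS](big_mkord xpredT
  (fun j => coef_xy j (n - j) f * (v 0 ^+ j * v 1 ^+ (n - j)))) /index_iota subn0.
apply: eq_bigr => j _; rewrite !big_ord_recl big_ord0 mulr1.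
rewrite (_ : lift _ _ = 1) ?mn0 ?mn1; last exact/val_inj.
by case: ifPn => // /mpoly.memN_msupp_eq0 mf0; rewrite /coef_xy mf0 mul0r.
Qed.

(** From here on [tau] is used only through substitution; the multivariate polynomials of its
    definition do not reappear. *)
Lemma tau_heval n (g : 'M[C]_2) (k : 'I_n.+1) x y :
  heval (col k (tau n g)) x y =
  (invmx g 0 0 * x + invmx g 0 1 * y) ^+ k *
  (- conjc (invmx g 0 1) * x + conjc (invmx g 0 0) * y) ^+ (n - k).
Proof.
set a := invmx g 0 0; set b := invmx g 0 1.
pose sub := [tuple a *: varx R + b *: vary R;
                   - conjc b *: varx R + conjc a *: vary R].
pose v (i : 'I_2) : C := if i == 0 then x else y.
pose f := mpoly.comp_mpoly sub (varx R ^+ k * vary R ^+ (n - k)).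
have kn : (k <= n)%N by rewrite -ltnS.
have vX : mpoly.meval v (varx R) = x by rewrite mpoly.mevalXU.
have vY : mpoly.meval v (vary R) = y by rewrite mpoly.mevalXU.
have fE : f = tnth sub 0 ^+ k * tnth sub 1 ^+ (n - k).
  by rewrite /f rmorphM !rmorphXn /= !mpoly.comp_mpolyXU.
have hl (c d : C) : c *: varx R + d *: vary R \is mpoly.ishomog1 1 mpoly.mdeg.
  by apply: rpredD; apply: rpredZ; rewrite mpoly.dhomogX /= mpoly.mdeg1.
have hf : f \is mpoly.ishomog1 n mpoly.mdeg.
  rewrite fE -[X in mpoly.ishomog1 X](subnKC kn); apply: mpoly.dhomogM.
    by rewrite -[X in mpoly.ishomog1 X]mul1n; apply: mpoly.dhomogMn; apply: hl.
  by rewrite -[X in mpoly.ishomog1 X]mul1n; apply: mpoly.dhomogMn; apply: hl.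
have := homog_meval v hf.
rewrite {1}fE rmorphM !rmorphXn /= !mpoly.mevalD !mpoly.mevalZ !vX !vY => ->.
by apply: eq_bigr => j _; rewrite !mxE.
Qed.

Lemma heval_sum n (I : finType) (w : I -> C) (V : I -> 'cV[C]_n.+1) x y :
  heval (\sum_i w i *: V i) x y = \sum_i w i * heval (V i) x y.
Proof.
rewrite /heval; under [RHS]eq_bigr do rewrite big_distrr.
rewrite exchange_big; apply: eq_bigr => j _; rewrite summxE big_distrl.
by apply: eq_bigr => i _; rewrite !mxE /= -mulrA.
Qed.

Lemma mulmx_col_sum n m (A : 'M[C]_(n, m)) (v : 'cV[C]_m) :
  A *m v = \sum_k v k 0 *: col k A.
Proof.
apply/colP => j; rewrite !mxE summxE; apply: eq_bigr => k _.
by rewrite !mxE mulrC.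
Qed.

Lemma tau_mul_heval n (g : 'M[C]_2) (v : 'cV[C]_n.+1) x y :
  heval (tau n g *m v) x y =
  heval v (invmx g 0 0 * x + invmx g 0 1 * y)
          (- conjc (invmx g 0 1) * x + conjc (invmx g 0 0) * y).
Proof.
rewrite mulmx_col_sum heval_sum; apply: eq_bigr => k _.
by rewrite tau_heval.
Qed.

End Tau.

Notation i2 := (@Ordinal 3 2 isT).

(** * Entries, sums and determinants in sizes 2 and 3 *)

Section SmallMatrices.

Lemma ord2E (i : 'I_2) : i = 0 \/ i = 1.
Proof. by case: i => [[|[|//]] h]; [left|right]; exact/val_inj. Qed.

Lemma ord3E (i : 'I_3) : [\/ i = 0, i = 1 | i = i2].
Proof.
case: i => [[|[|[|//]]] h]; [constructor 1|constructor 2|constructor 3];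
exact/val_inj.
Qed.

Lemma mx2P (T : Type) (A B : 'M[T]_2) :
  A 0 0 = B 0 0 -> A 0 1 = B 0 1 -> A 1 0 = B 1 0 -> A 1 1 = B 1 1 -> A = B.
Proof.
move=> *; apply/matrixP => i j.
by case: (ord2E i) => ->; case: (ord2E j) => ->.
Qed.

Lemma mx3P (T : Type) (A B : 'M[T]_3) :
  [/\ A 0 0 = B 0 0, A 0 1 = B 0 1 & A 0 i2 = B 0 i2] ->
  [/\ A 1 0 = B 1 0, A 1 1 = B 1 1 & A 1 i2 = B 1 i2] ->
  [/\ A i2 0 = B i2 0, A i2 1 = B i2 1 & A i2 i2 = B i2 i2] -> A = B.
Proof.
move=> [a b c] [d e f] [g h k]; apply/matrixP => i j.
by case: (ord3E i) => ->; case: (ord3E j) => ->.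
Qed.

Lemma sum2E (V : zmodType) (f : 'I_2 -> V) : \sum_i f i = f 0 + f 1.
Proof.
rewrite !big_ord_recl big_ord0 addr0; congr (_ + f _); exact/val_inj.
Qed.

Lemma sum3E (V : zmodType) (f : 'I_3 -> V) : \sum_i f i = f 0 + f 1 + f i2.
Proof.
rewrite !big_ord_recl big_ord0 addr0 -addrA; congr (f _ + (f _ + f _));
exact/val_inj.
Qed.

Lemma det2E (K : comPzRingType) (A : 'M[K]_2) :
  \det A = A 0 0 * A 1 1 - A 0 1 * A 1 0.
Proof.
rewrite (expand_det_row _ 0) sum2E /cofactor !det_mx11 !mxE /=.
by congr (_ * _ + _); rewrite ?expr0 ?expr1 ?mul1r ?mulN1r ?mulrN;
   [congr (A _ _)|congr (- (_ * A _ _))]; apply/val_inj.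
Qed.

Lemma det3E (K : comPzRingType) (A : 'M[K]_3) :
  \det A = A 0 0 * (A 1 1 * A i2 i2 - A 1 i2 * A i2 1)
         - A 0 1 * (A 1 0 * A i2 i2 - A 1 i2 * A i2 0)
         + A 0 i2 * (A 1 0 * A i2 1 - A 1 1 * A i2 0).
Proof.
rewrite (expand_det_row _ 0) sum3E /cofactor !det2E !mxE /=.
have -> : lift (0 : 'I_3) 0 = 1 by exact/val_inj.
have -> : lift (0 : 'I_3) 1 = i2 by exact/val_inj.
have -> : lift (1 : 'I_3) 0 = 0 by exact/val_inj.
have -> : lift (1 : 'I_3) 1 = i2 by exact/val_inj.
have -> : lift i2 0 = 0 by exact/val_inj.
have -> : lift i2 1 = 1 by exact/val_inj.
by rewrite /=; ring.
Qed.

End SmallMatrices.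

(** * SU(2) and the homomorphism [phi] to SO(3) *)

Section Spin.
Context (R : realType).
Local Notation C := (R[i]).
Local Notation M3 := 'M[R]_3.

Lemma conjcD (x y : C) : conjc (x + y) = conjc x + conjc y.
Proof. exact: rmorphD. Qed.

Lemma conjcM (x y : C) : conjc (x * y) = conjc x * conjc y.
Proof. exact: rmorphM. Qed.

Lemma conjcN (x : C) : conjc (- x) = - conjc x.
Proof. exact: rmorphN. Qed.

Definition conjcE := (conjcD, conjcM, conjcN, @conjcK R, @conjc0 R, @conjc1 R).

Definition su2 (al be : C) : 'M[C]_2 :=
  mx_of_seq 2 [:: [:: al; be]; [:: - conjc be; conjc al]].

Lemma su2E al be :
  [/\ su2 al be 0 0 = al, su2 al be 0 1 = be,
      su2 al be 1 0 = - conjc be & su2 al be 1 1 = conjc al].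
Proof. by split; rewrite mxE. Qed.

Lemma su2M a b c d :
  su2 a b *m su2 c d = su2 (a * c - b * conjc d) (a * d + b * conjc c).
Proof.
apply: mx2P; rewrite mxE sum2E !mxE /= ?conjcE; ring.
Qed.

Lemma su2_1 : su2 1 0 = 1%:M.
Proof. by apply: mx2P; rewrite !mxE /= ?conjcE ?oppr0. Qed.

Lemma su2_SU2 al be : al * conjc al + be * conjc be = 1 -> SU2 (su2 al be).
Proof.
move=> h; split; last first.
  by rewrite det2E !mxE /= -h; ring.
apply: mx2P; rewrite mxE sum2E !mxE /= ?conjcE -?h; ring.
Qed.

Lemma SU2_su2 (u : 'M[C]_2) : SU2 u ->
  exists al be, u = su2 al be /\ al * conjc al + be * conjc be = 1.
Proof.
move=> uP; exists (u 0 0), (u 0 1); move: uP.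
rewrite /SU2 /= => -[/matrixP u1]; rewrite det2E.
have := u1 0 0; have := u1 1 0.
rewrite !mxE !sum2E !mxE /=.
move: (u 0 0) (u 0 1) (u 1 0) (u 1 1) (@mx2P _ u) => a b c d uP h2 h1 h3.
split=> //; apply: uP; rewrite !mxE //=.
  transitivity (c * (a * conjc a + b * conjc b)); first by rewrite h1 mulr1.
  rewrite mulrDr; transitivity (a * (c * conjc a + d * conjc b)
     - conjc b * (a * d - b * c)); first by ring.
  by rewrite h2 h3; ring.
transitivity (d * (a * conjc a + b * conjc b)); first by rewrite h1 mulr1.
transitivity (conjc a * (a * d - b * c) + b * (c * conjc a + d * conjc b)).
  by ring.
by rewrite h2 h3; ring.
Qed.

Lemma SU2M (u v : 'M[C]_2) : SU2 u -> SU2 v -> SU2 (u *m v).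
Proof.
move=> [u1 u2] [v1 v2]; split; last by rewrite det_mulmx u2 v2 mulr1.
rewrite map_mxM trmx_mul mulmxA -(mulmxA u) v1 mulmx1; exact: u1.
Qed.

Lemma invmx_su2 al be : al * conjc al + be * conjc be = 1 ->
  invmx (su2 al be) = su2 (conjc al) (- be).
Proof.
move=> h; have e : su2 al be *m su2 (conjc al) (- be) = 1%:M.
  by rewrite su2M !conjcE -su2_1; congr su2; rewrite -?h; ring.
have [ua _] := mulmx1_unit e.
by rewrite -[RHS](mulKmx ua) e mulmx1.
Qed.

Lemma phi_su2M a b c d :
  phi (su2 a b *m su2 c d) = phi (su2 a b) *m phi (su2 c d).
Proof.
rewrite su2M /phi; have [-> -> _ _] := su2E a b; have [-> -> _ _] := su2E c d.
have [-> -> _ _] := su2E (a * c - b * conjc d) (a * d + b * conjc c).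
case: a b c d => [p q] [r s] [p' q'] [r' s']; simpc => /=.
by apply: mx3P; split; rewrite !mxE sum3E !mxE /=; ring.
Qed.

Lemma phiM (u v : 'M[C]_2) : SU2 u -> SU2 v -> phi (u *m v) = phi u *m phi v.
Proof. by move=> /SU2_su2[a [b [-> _]]] /SU2_su2[c [d [-> _]]]; exact: phi_su2M. Qed.

Lemma phi_SO3 (u : 'M[C]_2) : SU2 u -> SO3 (phi u).
Proof.
move=> /SU2_su2[[p q] [[r s] [->]]].
simpc => /(congr1 (@complex.Re R)) /= h.
have h1 : p ^+ 2 + q ^+ 2 + r ^+ 2 + s ^+ 2 = 1.
  by rewrite -h; ring.
(* The entries of x x^T have degree 4 and the determinant has degree 6 in p, q, r, s, so 1 is
   written as the second or third power of the norm. *)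
have h2 : (p ^+ 2 + q ^+ 2 + r ^+ 2 + s ^+ 2) ^+ 2 = 1 by rewrite h1 expr1n.
have h3 : (p ^+ 2 + q ^+ 2 + r ^+ 2 + s ^+ 2) ^+ 3 = 1 by rewrite h1 expr1n.
rewrite /SO3 /= /phi; have [-> -> _ _] := su2E (p +i* q) (r +i* s).
split; last by rewrite det3E !mxE /=; transitivity ((p ^+ 2 + q ^+ 2 + r ^+ 2 + s ^+ 2) ^+ 3);
     [ring|].
apply: mx3P; split; rewrite !mxE sum3E !mxE /=; try ring;
  by transitivity ((p ^+ 2 + q ^+ 2 + r ^+ 2 + s ^+ 2) ^+ 2); [ring|].
Qed.

End Spin.

(** * Surjectivity of the double covering *)

Section Cover.
Context (R : realType).
Local Notation C := (R[i]).
Local Notation M3 := 'M[R]_3.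

Lemma SO3M (x y : M3) : SO3 x -> SO3 y -> SO3 (x *m y).
Proof.
move=> [x1 x2] [y1 y2]; split; last by rewrite det_mulmx x2 y2 mulr1.
rewrite trmx_mul mulmxA -(mulmxA x) y1 mulmx1; exact: x1.
Qed.

Lemma SO3T (x : M3) : SO3 x -> SO3 x^T.
Proof.
by move=> [x1 x2]; split; [rewrite trmxK; exact: mulmx1C|rewrite det_tr].
Qed.

Lemma SO3_rows (x : M3) : SO3 x ->
  [/\ x 0 0 * x 0 0 + x 0 1 * x 0 1 + x 0 i2 * x 0 i2 = 1,
      x 1 0 * x 1 0 + x 1 1 * x 1 1 + x 1 i2 * x 1 i2 = 1 &
      x i2 0 * x i2 0 + x i2 1 * x i2 1 + x i2 i2 * x i2 i2 = 1] /\
  [/\ x 0 0 * x 1 0 + x 0 1 * x 1 1 + x 0 i2 * x 1 i2 = 0,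
      x 0 0 * x i2 0 + x 0 1 * x i2 1 + x 0 i2 * x i2 i2 = 0 &
      x 1 0 * x i2 0 + x 1 1 * x i2 1 + x 1 i2 * x i2 i2 = 0].
Proof.
move=> [/matrixP xr _].
have := xr 0 0; have := xr 0 1; have := xr 0 i2; have := xr 1 1.
have := xr 1 i2; have := xr i2 i2; rewrite !mxE !sum3E !mxE /=.
by do 6! move=> ?.
Qed.

(** The adjugate of [x] is its inverse, hence its transpose. *)
Lemma SO3_cofactors (x : M3) : SO3 x ->
  [/\ x 0 0 = x 1 1 * x i2 i2 - x 1 i2 * x i2 1,
      x 0 1 = x 1 i2 * x i2 0 - x 1 0 * x i2 i2 &
      x 0 i2 = x 1 0 * x i2 1 - x 1 1 * x i2 0] /\
  [/\ x 1 0 = x 0 i2 * x i2 1 - x 0 1 * x i2 i2,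
      x 1 1 = x 0 0 * x i2 i2 - x 0 i2 * x i2 0 &
      x 1 i2 = x 0 1 * x i2 0 - x 0 0 * x i2 1] /\
  [/\ x i2 0 = x 0 1 * x 1 i2 - x 0 i2 * x 1 1,
      x i2 1 = x 0 i2 * x 1 0 - x 0 0 * x 1 i2 &
      x i2 i2 = x 0 0 * x 1 1 - x 0 1 * x 1 0].
Proof.
move=> xS; have [_ xd] := xS.
have xa : \adj x = x^T.
  have [h _] := SO3T xS; rewrite trmxK in h.
  by rewrite -[LHS]mul1mx -h -mulmxA mul_mx_adj xd mulmx1.
have xaE i j := congr1 (fun A : M3 => A i j) xa.
move: (xaE 0 0) (xaE 0 1) (xaE 1 0) (xaE 1 1) (xaE i2 0) (xaE i2 1)
  (xaE i2 i2) (xaE 0 i2) (xaE 1 i2).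
rewrite ![\adj x _ _]mxE /cofactor !det2E !mxE /=.
have -> : lift (0 : 'I_3) 0 = 1 by exact/val_inj.
have -> : lift (0 : 'I_3) 1 = i2 by exact/val_inj.
have -> : lift (1 : 'I_3) 0 = 0 by exact/val_inj.
have -> : lift (1 : 'I_3) 1 = i2 by exact/val_inj.
have -> : lift i2 0 = 0 by exact/val_inj.
have -> : lift i2 1 = 1 by exact/val_inj.
rewrite (_ : (1 + 1 %% 3)%N = 2%N) // (_ : (0 + 1 %% 3)%N = 1%N) //.
rewrite (_ : (2 + 2)%N = 4%N) // (_ : (0 + 2)%N = 2%N) //
  (_ : (2 + 1 %% 3)%N = 3%N) // (_ : (2 + 0)%N = 2%N) // (_ : (1 %% 3 + 0)%N = 1%N) // (_ : (1 %% 3 + 2)%N = 3%N) //.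
rewrite /= ?(expr0, expr1) ?exprS ?expr0 ?expr1 ?mulrN1 ?mulN1r ?opprK ?mul1r ?mulr1.
by move=> c00 c01 c10 c11 c20 c21 c22 c02 c12; split; last split; split; lra.
Qed.

(* With [u] having first row [(p + iq, r + is)], the products of two of
   [p, q, r, s] are affine functions of the entries of [phi u]; the first row
   of the resulting rank one matrix determines [u]. *)
Lemma phi_surj_pos (x : M3) : SO3 x -> 0 < 1 + x 0 0 + x 1 1 + x i2 i2 ->
  exists2 u, SU2 u & phi u = x.
Proof.
move=> xS.
have [[c00 c01 c02] [[c10 c11 c12] [c20 c21 c22]]] := SO3_cofactors xS.
have [[r00 r11 r22] [r01 r02 r12]] := SO3_rows xS.
have [[k00 k11 k22] [k01 k02 k12]] := SO3_rows (SO3T xS).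
rewrite !mxE in k00 k11 k22 k01 k02 k12.
set P := 1 + _ + _ + _ => P0.
pose p := Num.sqrt P / 2.
have p0 : 0 < p by rewrite divr_gt0 ?sqrtr_gt0.
have p2 : p * p = P / 4.
  by rewrite /p mulrACA -expr2 sqr_sqrtr ?ltW //; field.
pose b := x i2 1 - x 1 i2; pose c := x 0 i2 - x i2 0; pose d := x 1 0 - x 0 1.
pose q := b / (4 * p); pose r := c / (4 * p); pose s := d / (4 * p).
have pd u v w : u * v = P * w -> u / (4 * p) * (v / (4 * p)) = w / 4.
  move=> uvw; rewrite mulf_div uvw (_ : 4 * p * (4 * p) = 4 * P); last first.
    by rewrite mulrACA p2; field.
  by field; rewrite lt0r_neq0.
have pp u : p * (u / (4 * p)) = u / 4 by field; rewrite lt0r_neq0.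
have q2 : q * q = (1 + x 0 0 - x 1 1 - x i2 i2) / 4 by apply: pd; rewrite /P /b; lra.
have r2 : r * r = (1 - x 0 0 + x 1 1 - x i2 i2) / 4 by apply: pd; rewrite /P /c; lra.
have s2 : s * s = (1 - x 0 0 - x 1 1 + x i2 i2) / 4 by apply: pd; rewrite /P /d; lra.
have qr : q * r = (x 1 0 + x 0 1) / 4 by apply: pd; rewrite /P /b /c; lra.
have qs : q * s = (x 0 i2 + x i2 0) / 4 by apply: pd; rewrite /P /b /d; lra.
have rs : r * s = (x i2 1 + x 1 i2) / 4 by apply: pd; rewrite /P /c /d; lra.
have pq : p * q = b / 4 by exact: pp.
have pr : p * r = c / 4 by exact: pp.
have ps : p * s = d / 4 by exact: pp.
clearbody q r s p; exists (su2 (p +i* q) (r +i* s)).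
  apply: su2_SU2; simpc; congr (_ +i* _); last by ring.
  by rewrite p2 q2 r2 s2 /P; field.
rewrite /phi; have [-> -> _ _] := su2E (p +i* q) (r +i* s).
apply: mx3P; split; rewrite !mxE /= ?expr2 ?p2 ?q2 ?r2 ?s2 ?qr ?qs ?rs ?pq ?pr ?ps;
  rewrite /b /c /d /P; lra.
Qed.

Lemma phi_diag :
  [/\ phi (su2 (0 +i* 1) 0) = diag3 1 (-1) (-1) :> M3,
      phi (su2 0 1) = diag3 (-1) 1 (-1) :> M3 &
      phi (su2 0 (0 +i* 1)) = diag3 (-1) (-1) 1 :> M3].
Proof.
by split; apply: mx3P; split; rewrite !mxE /=; simpc => /=; lra.
Qed.

Lemma SU2_unit_quaternions :
  [/\ SU2 (su2 (0 +i* 1) 0 : 'M[C]_2), SU2 (su2 0 1 : 'M[C]_2) &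
      SU2 (su2 0 (0 +i* 1) : 'M[C]_2)].
Proof.
split; apply: su2_SU2; simpc => //; congr (_ +i* _); ring.
Qed.

(** The four numbers 1 + x00 + x11 + x22, 1 + x00 - x11 - x22 and so on add up to 4, so one of them
    is positive. Multiplying by the image of a unit quaternion moves it to the first place, where
    [phi_surj_pos] applies. *)
Lemma phi_surj (x : M3) : SO3 x -> exists2 u, SU2 u & phi u = x.
Proof.
move=> xS; have [e1 e2 e3] := phi_diag.
have [w1 w2 w3] := SU2_unit_quaternions.
have red (w : 'M[C]_2) (d : M3) : SU2 w -> phi w = d -> d *m d = 1%:M ->
    0 < 1 + (x *m d) 0 0 + (x *m d) 1 1 + (x *m d) i2 i2 ->
    exists2 u, SU2 u & phi u = x.
  move=> wS wd dd /phi_surj_pos[|u uS ux].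
    by apply: SO3M => //; rewrite -wd; exact: phi_SO3.
  exists (u *m w); first exact: SU2M.
  by rewrite phiM // ux wd -mulmxA dd mulmx1.
have dd a b c : a * a = 1 -> b * b = 1 -> c * c = 1 ->
    diag3 a b c *m diag3 a b c = 1%:M :> M3.
  by move=> ha hb hc; apply: mx3P; split; rewrite !mxE sum3E !mxE /=; lra.
have [h|h] := ltP 0 (1 + x 0 0 + x 1 1 + x i2 i2); first exact: phi_surj_pos.
have [h1|h1] := ltP 0 (1 + x 0 0 - x 1 1 - x i2 i2).
  apply: (red _ _ w1 e1); first by apply: dd; ring.
  by rewrite !mxE !sum3E !mxE /=; lra.
have [h2|h2] := ltP 0 (1 - x 0 0 + x 1 1 - x i2 i2).
  apply: (red _ _ w2 e2); first by apply: dd; ring.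
  by rewrite !mxE !sum3E !mxE /=; lra.
apply: (red _ _ w3 e3); first by apply: dd; ring.
by rewrite !mxE !sum3E !mxE /=; lra.
Qed.

End Cover.

(** * The representation tau_2l on SO(3): polynomial entries and unitarity *)

Lemma mx_col_eq (T : Type) m n (A B : 'M[T]_(m, n)) :
  (forall k, col k A = col k B) -> A = B.
Proof.
by move=> AB; apply/matrixP => j k; have /colP/(_ j) := AB k; rewrite !mxE.
Qed.

Lemma col_mulmx (S : pzRingType) m n p (A : 'M[S]_(m, n)) (B : 'M[S]_(n, p)) k :
  col k (A *m B) = A *m col k B.
Proof. by apply/colP => j; rewrite !mxE; apply: eq_bigr => i _; rewrite !mxE. Qed.

(** k and 2l - k have the same parity, so the linear factors group into p^2, pq and q^2; unlike p
    and q, these descend to SO(3). *)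
Lemma expr_pairs (S : comPzRingType) (p q : S) k l : (k <= 2 * l)%N ->
  p ^+ k * q ^+ (2 * l - k) =
  (p ^+ 2) ^+ k./2 * (p * q) ^+ odd k * (q ^+ 2) ^+ (2 * l - k)./2.
Proof.
move=> kl; rewrite [(p * q) ^+ _]exprMn -!exprM mulrA -exprD -mulrA -exprD.
have od : odd (2 * l - k) = odd k by rewrite oddB // oddM.
have e1 := odd_double_half k; have e2 := odd_double_half (2 * l - k).
rewrite od -!mul2n in e1 e2.
by congr (_ ^+ _ * _ ^+ _); [rewrite addnC e1|rewrite e2].
Qed.

Section TauOnSO3.
Context (R : realType).
Local Notation C := (R[i]).
Local Notation M3 := 'M[R]_3.

Lemma tau_su2_heval n (al be : C) (k : 'I_n.+1) x y :
  al * conjc al + be * conjc be = 1 ->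
  heval (col k (tau n (su2 al be))) x y =
  (conjc al * x + (- be) * y) ^+ k * (conjc be * x + al * y) ^+ (n - k).
Proof.
move=> h; rewrite tau_heval invmx_su2 //; have [-> -> _ _] := su2E (conjc al) (- be).
by rewrite !conjcE opprK.
Qed.

Lemma tauM n (u v : 'M[C]_2) : SU2 u -> SU2 v ->
  tau n (u *m v) = tau n u *m tau n v.
Proof.
move=> uS vS; have uvS := SU2M uS vS.
move: uS vS uvS => /SU2_su2[a [b [-> ab]]] /SU2_su2[c [d [-> cd]]].
rewrite su2M => _; apply: mx_col_eq => k; rewrite col_mulmx.
have ef1 : (a * c - b * conjc d) * conjc (a * c - b * conjc d) +
   (a * d + b * conjc c) * conjc (a * d + b * conjc c) = 1.
  rewrite !conjcE.
  transitivity ((a * conjc a + b * conjc b) * (c * conjc c + d * conjc d)); first by ring.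
  by rewrite ab cd mulr1.
apply: heval_inj => x y.
rewrite tau_su2_heval // tau_mul_heval invmx_su2 //.
have [-> -> _ _] := su2E (conjc a) (- b); rewrite tau_su2_heval //.
by rewrite !conjcE; congr (_ ^+ _ * _ ^+ _); ring.
Qed.

(** Linear functions of the entries of [x] whose values at [phi (su2 al be)] are al^2, be^2, al be
    and conj(al) be ([phi_quadE]). *)
Definition phi_aa (x : M3) : C :=
  ((x 1 1 + x i2 i2) / 2) +i* ((x i2 1 - x 1 i2) / 2).
Definition phi_bb (x : M3) : C :=
  ((x 1 1 - x i2 i2) / 2) +i* ((x i2 1 + x 1 i2) / 2).
Definition phi_ab (x : M3) : C := (- x i2 0 / 2) +i* (x 1 0 / 2).
Definition phi_cb (x : M3) : C := (x 0 i2 / 2) +i* (- x 0 1 / 2).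

Lemma phi_quadE al be : let x : M3 := phi (su2 al be) in
  [/\ phi_aa x = al * al, phi_bb x = be * be, phi_ab x = al * be,
      phi_cb x = conjc al * be & (x 0 0)%:C = al * conjc al - be * conjc be].
Proof.
rewrite /phi /=; have [-> -> _ _] := su2E al be; case: al be => [p q] [r s].
rewrite /phi_aa /phi_bb /phi_ab /phi_cb !mxE /=.
by split; simpc; congr (_ +i* _); field.
Qed.

(** p^2, pq and q^2 for p = conj(al) X - be and q = conj(be) X + al, written in terms of
    [x = phi (su2 al be)]. *)
Definition tk_hi (x : M3) : {poly C} :=
  conjc (phi_aa x) *: 'X^2 + (- 2 * phi_cb x) *: 'X + (phi_bb x)%:P.
Definition tk_mid (x : M3) : {poly C} :=
  conjc (phi_ab x) *: 'X^2 + (x 0 0)%:C *: 'X + (- phi_ab x)%:P.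
Definition tk_lo (x : M3) : {poly C} :=
  conjc (phi_bb x) *: 'X^2 + (2 * conjc (phi_cb x)) *: 'X + (phi_aa x)%:P.

(* The entries of [tau_{2l}] as polynomials in the entries of [x = phi u]: the
   linear factors of [(a X + b)^k (- b^* X + a^* )^(2l-k)] are grouped in pairs. *)
Definition TK l (x : M3) : 'M[C]_((2 * l).+1) :=
  \matrix_(j, k) (tk_hi x ^+ k./2 * tk_mid x ^+ odd k * tk_lo x ^+ (2 * l - k)./2)`_j.

Lemma tau_TK l (u : 'M[C]_2) : SU2 u -> tau (2 * l) u = TK l (phi u).
Proof.
move=> /SU2_su2[a [b [-> ab]]]; apply/matrixP => j k.
have kl : (k <= 2 * l)%N by rewrite -ltnS.
have := heval_coef kl erefl erefl (fun x y => @tau_su2_heval (2 * l) a b k x y ab) j.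
rewrite mxE => ->; rewrite mxE.
have [ea eb ec ed e0] := phi_quadE a b.
set p := _ + _; set q := _ + _.
have -> : tk_hi (phi (su2 a b)) = p ^+ 2.
  rewrite /tk_hi ea eb ed !conjcE /p -!mul_polyC !polyCM !polyCN; ring.
have -> : tk_mid (phi (su2 a b)) = p * q.
  by rewrite /tk_mid e0 ec /p /q !conjcE -!mul_polyC !(polyCM, polyCN, polyCD); ring.
have -> : tk_lo (phi (su2 a b)) = q ^+ 2.
  by rewrite /tk_lo ea eb ed /q !conjcE -!mul_polyC !(polyCM, polyCN, polyCD); ring.
by rewrite [in LHS](@expr_pairs {poly C} p q k l kl).
Qed.

Lemma tauK_lift l (x : M3) : SO3 x ->
  exists2 u, SU2 u /\ phi u = x & tauK l x = tau (2 * l) u.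
Proof.
move=> /phi_surj[u uS ux].
by rewrite /tauK; case: xgetP => [v _ hv|/(_ u)[]//]; exists v.
Qed.

(** The preimage chosen in [tauK] does not matter, since [TK] depends on [phi u] only.
    Multiplicativity and smoothness of [tauK] follow. *)
Lemma tauK_TK l (x : M3) : SO3 x -> tauK l x = TK l x.
Proof. by move=> /(tauK_lift l)[u [uS <-]] ->; exact: tau_TK. Qed.

Lemma tauKM l (x y : M3) : SO3 x -> SO3 y ->
  tauK l (x *m y) = tauK l x *m tauK l y.
Proof.
move=> xS yS; rewrite tauK_TK; last exact: SO3M.
have [u [uS ux] ->] := tauK_lift l xS; have [v [vS vy] ->] := tauK_lift l yS.
by rewrite -tauM // tau_TK ?phiM ?ux ?vy //; exact: SU2M.
Qed.

Lemma heval_linear n (v : 'cV[C]_n.+1) (I : finType) (w : I -> C)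
    (V : I -> 'cV[C]_n.+1) x y :
  (forall j, v j 0 = \sum_i w i * V i j 0) ->
  heval v x y = \sum_i w i * heval (V i) x y.
Proof.
move=> h; rewrite -heval_sum; congr heval; apply/colP => j.
by rewrite h summxE; apply: eq_bigr => i _; rewrite mxE.
Qed.

Lemma heval_delta n (c : C) (k : 'I_n.+1) (v : 'cV[C]_n.+1) x y :
  (forall j, v j 0 = (j == k)%:R * c) ->
  heval v x y = c * (x ^+ k * y ^+ (n - k)).
Proof.
move=> h; rewrite /heval (bigD1 k) //= h eqxx mul1r big1 ?addr0 // => j jk.
by rewrite h (negPf jk) !mul0r.
Qed.

Lemma heval_conj n (v : 'cV[C]_n.+1) x y :
  heval (map_mx conjc v) x y = conjc (heval v (conjc x) (conjc y)).
Proof.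
rewrite /heval rmorph_sum /=; apply: eq_bigr => j _.
by rewrite mxE !conjcM !rmorphXn /= !conjcK.
Qed.

Lemma mx_heval_inj m n (A B : 'M[C]_(m.+1, n.+1)) :
  (forall x y x' y',
     \sum_i \sum_j A i j * (x ^+ i * y ^+ (m - i)) * (x' ^+ j * y' ^+ (n - j)) =
     \sum_i \sum_j B i j * (x ^+ i * y ^+ (m - i)) * (x' ^+ j * y' ^+ (n - j))) ->
  A = B.
Proof.
move=> AB; apply: mx_col_eq => j; apply: heval_inj => x y.
have /colP/(_ j) : \col_j heval (col j A) x y = \col_j heval (col j B) x y.
  apply: heval_inj => x' y'; have := AB x y x' y'.
  rewrite exchange_big [in RHS]exchange_big => h.
  rewrite /heval; under eq_bigr do rewrite mxE big_distrl.
  under [RHS]eq_bigr do rewrite mxE big_distrl.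
  under eq_bigr do (under eq_bigr do rewrite mxE /=).
  by under [RHS]eq_bigr do (under eq_bigr do rewrite mxE /=).
by rewrite !mxE.
Qed.

(** Column k of T is the form L1^k L2^(n-k), so the generating function of the left side is, by the
    binomial theorem, the n-th power of L1 conj(L1') + L2 conj(L2'). Unitarity of u turns this into
    (x x' + y y')^n, the generating function of the right side. *)
Lemma tau_unitary n (u : 'M[C]_2) : SU2 u ->
  tau n u *m diag_mx (\row_k ('C(n, k)%:R : C)) *m (map_mx conjc (tau n u))^T =
  diag_mx (\row_k ('C(n, k)%:R : C)).
Proof.
move=> /SU2_su2[a [b [-> ab]]].
have hT (k : 'I_n.+1) x y := @tau_su2_heval n a b k x y ab.
move: (tau n _) hT => T hT.
apply: mx_heval_inj => x y x' y'.
transitivity (\sum_(k < n.+1) 'C(n, k)%:R * heval (col k T) x y *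
                 conjc (heval (col k T) (conjc x') (conjc y'))).
  have E i j : (T *m diag_mx (\row_k ('C(n, k)%:R : C)) *m (map_mx conjc T)^T) i j =
      \sum_(k < n.+1) 'C(n, k)%:R * T i k * conjc (T j k).
    rewrite mxE; apply: eq_bigr => k _.
    by rewrite mul_mx_diag !mxE [T i k * _]mulrC.
  under eq_bigr do (under eq_bigr do rewrite E !big_distrl).
  under eq_bigr do rewrite exchange_big.
  rewrite exchange_big; apply: eq_bigr => k _.
  rewrite -heval_conj /heval -mulrA big_distrl big_distrr /=; apply: eq_bigr => i _.
  rewrite big_distrr big_distrr /=; apply: eq_bigr => j _.
  by rewrite !mxE; ring.
transitivity ((x * x' + y * y') ^+ n).
  rewrite (_ : x * x' + y * y' =
    (conjc b * x + a * y) * conjc (conjc b * conjc x' + a * conjc y') +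
    (conjc a * x + (- b) * y) * conjc (conjc a * conjc x' + (- b) * conjc y')).
    rewrite exprDn; apply: eq_bigr => k _.
    rewrite !hT conjcM !rmorphXn /= !exprMn -mulr_natl.
    move: (_ ^+ k) (_ ^+ (n - k)) (_ ^+ k) (_ ^+ (n - k)) => p1 p2 p3 p4; ring.
  rewrite !conjcE; transitivity ((a * conjc a + b * conjc b) * (x * x' + y * y')).
    by rewrite ab mul1r.
  by ring.
rewrite addrC exprDn; apply: eq_bigr => i _.
rewrite (bigD1 i) //= big1 ?addr0 => [|j ji].
  rewrite !mxE eqxx mulr1n !exprMn -mulr_natl.
  move: (_ ^+ i) (_ ^+ (n - i)) (_ ^+ i) (_ ^+ (n - i)) => p1 p2 p3 p4; ring.
by rewrite !mxE eq_sym (negPf ji) mulr0n !mul0r.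
Qed.

Lemma tauK_unitary l (x : M3) (lam : 'rV[C]_((2 * l).+1)) : SO3 x ->
  \sum_(q < (2 * l).+1) 'C(2 * l, q)%:R *
     ((lam *m tauK l x) 0 q * conjc ((lam *m tauK l x) 0 q)) =
  \sum_(q < (2 * l).+1) 'C(2 * l, q)%:R * (lam 0 q * conjc (lam 0 q)).
Proof.
move=> xS; have [u [uS _] ->] := tauK_lift l xS.
have U := tau_unitary (2 * l) uS; move: (tau _ _) U => T U.
have E (v : 'rV[C]_((2 * l).+1)) : \sum_(q < (2 * l).+1) 'C(2 * l, q)%:R * (v 0 q * conjc (v 0 q)) =
    (v *m diag_mx (\row_k ('C(2 * l, k)%:R : C)) *m (map_mx conjc v)^T) 0 0.
  rewrite mxE; apply: eq_bigr => k _; rewrite mul_mx_diag !mxE.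
  by rewrite mulrA [X in X * _]mulrC.
rewrite !E; congr (_ 0 0).
by rewrite map_mxM trmx_mul !mulmxA -(mulmxA lam) -(mulmxA lam) U.
Qed.

End TauOnSO3.

(** * The functionals of the induced basis and their behaviour under M0 *)

Lemma monomM (S : comNzRingType) (c d : S) i j :
  (c *: 'X^i) * (d *: 'X^j) = (c * d) *: 'X^(i + j).
Proof. by rewrite -scalerAl -scalerAr scalerA exprD. Qed.

Lemma monomX (S : comNzRingType) (c : S) i n :
  (c *: 'X^i) ^+ n = c ^+ n *: 'X^(i * n).
Proof. by rewrite exprZn exprM. Qed.

Section WeightFunctionals.
Context (R : realType).
Local Notation C := (R[i]).
Local Notation M3 := 'M[R]_3.

(* The functional [v*_{2l-p} + (-1)^eps v*_p] as a row vector. *)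
Definition lamS (sigma : 'I_2 * 'I_2) (l p : nat) : 'rV[C]_((2 * l).+1) :=
  \row_(q < (2 * l).+1)
    ((q == 2 * l - p :> nat)%N%:R + (-1) ^+ eps sigma l * (q == p :> nat)%N%:R).

Lemma coefS_lamS sigma l p q (x : M3) : (p <= l)%N ->
  coefS sigma p q x = (lamS sigma l p *m tauK l x) 0 q.
Proof.
move=> pl; rewrite /coefS.
have p1 : (p < (2 * l).+1)%N by lia.
have p2 : (2 * l - p < (2 * l).+1)%N by lia.
move: (tauK l x) => T; rewrite mxE.
under eq_bigr do rewrite mxE mulrDl.
rewrite big_split /=; congr (_ + _).
  rewrite (bigD1 (inord (2 * l - p))) //= inordK // eqxx mul1r big1 ?addr0 // => i.
  by rewrite -val_eqE /= inordK // => /negPf ->; rewrite mul0r.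
rewrite (bigD1 (inord p)) //= inordK // eqxx mulr1 big1 ?addr0 // => i.
by rewrite -val_eqE /= inordK // => /negPf ->; rewrite mulr0 mul0r.
Qed.

Lemma lamS_rev sigma l p (q : 'I_(2 * l).+1) : (p <= l)%N ->
  lamS sigma l p 0 (rev_ord q) = (-1) ^+ eps sigma l * lamS sigma l p 0 q.
Proof.
move=> pl; rewrite !mxE /= subSS.
have -> : (2 * l - q == 2 * l - p)%N = (q == p :> nat)%N.
  by have := ltn_ord q; move=> hq; apply/eqP/eqP; lia.
have -> : (2 * l - q == p)%N = (q == 2 * l - p :> nat)%N.
  by have := ltn_ord q; move=> hq; apply/eqP/eqP; lia.
by rewrite mulrDr mulrA -expr2 sqrr_sign mul1r addrC.
Qed.

Lemma lamS_parity (sigma : 'I_2 * 'I_2) l p (q : 'I_(2 * l).+1) :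
  (p <= l)%N -> (p = l + sigma.2 %[mod 2])%N -> lamS sigma l p 0 q != 0 ->
  odd q = odd (l + sigma.2).
Proof.
move=> pl pm; have -> : odd (l + sigma.2) = odd p.
  by move: pm; rewrite !modn2; do 2 case: odd.
rewrite mxE; have [-> _|_] := eqVneq (nat_of_ord q) (2 * l - p)%N.
  by rewrite oddB ?oddM //; lia.
by have [->|_] := eqVneq (nat_of_ord q) p => //; rewrite mulr0 add0r eqxx.
Qed.

(** On M0 the three quadratic factors are monomials; for e1 = -1 the outer two are exchanged and the
    matrix becomes antidiagonal. *)
Lemma TK_diag l (e1 e2 : R) (j k : 'I_(2 * l).+1) :
  e1 \in [:: 1; -1] -> e2 \in [:: 1; -1] ->
  TK l (diag3 e1 e2 (e1 * e2)) j k =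
  if e1 == 1 then (e2%:C) ^+ (l + odd k) * (j == k)%:R
  else (-1) ^+ odd k * (e2%:C) ^+ (l + odd k) * (j == rev_ord k)%:R.
Proof.
have kk : (k <= 2 * l)%N by rewrite -ltnS.
have e : (k./2 + (2 * l - k)./2 + odd k = l)%N.
  have := odd_double_half k; have := odd_double_half (2 * l - k).
  by rewrite oddB // oddM /=; lia.
move=> he1 he2.
have m1 : (-1 == 1 :> R) = false by apply/eqP; lra.
rewrite mxE; set x := diag3 _ _ _.
have ab0 : phi_ab x = 0 by rewrite /phi_ab !mxE /=; apply/eqP; rewrite eq_complex /=; apply/andP; split; apply/eqP; lra.
have cb0 : phi_cb x = 0 by rewrite /phi_cb !mxE /=; apply/eqP; rewrite eq_complex /=; apply/andP; split; apply/eqP; lra.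
have x00 : (x 0 0)%:C = e1%:C by rewrite !mxE /=.
have e2s : e2%:C ^+ (l + odd k) = e2%:C ^+ (k./2 + (2 * l - k)./2).
  have -> : (l + odd k = k./2 + (2 * l - k)./2 + 2 * odd k)%N by lia.
  rewrite exprD [X in _ * X]exprM (_ : e2%:C ^+ 2 = 1) ?expr1n ?mulr1 //.
  move: he2; rewrite !inE => /orP[]/eqP ->; first by rewrite expr1n.
  by rewrite rmorphN rmorph1 sqrrN expr1n.
move: he1; rewrite !inE => /orP[]/eqP e1E.
- have aa : phi_aa x = e2%:C.
    rewrite /phi_aa !mxE /= e1E; apply/eqP; rewrite eq_complex /=; apply/andP; split; apply/eqP; lra.
  have bb : phi_bb x = 0.
    rewrite /phi_bb !mxE /= e1E; apply/eqP; rewrite eq_complex /=; apply/andP; split; apply/eqP; lra.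
  have hi : tk_hi x = e2%:C *: 'X^2.
    by rewrite /tk_hi aa bb cb0 conjc_real mulr0 scale0r polyC0 !addr0.
  have mi : tk_mid x = 1 *: 'X^1.
    by rewrite /tk_mid ab0 x00 e1E oppr0 conjc0 polyC0 scale0r add0r addr0.
  have lo : tk_lo x = e2%:C *: 'X^0.
    by rewrite /tk_lo aa bb cb0 !conjc0 mulr0 !scale0r !add0r -alg_polyC.
  rewrite hi mi lo !monomX !monomM e1E eqxx coefZ coefXn expr1n mulr1 -exprD -e2s.
  by congr (_ * (_ == _)%:R); rewrite /= -[in RHS](odd_double_half k); lia.
- have aa : phi_aa x = 0.
    rewrite /phi_aa !mxE /= e1E; apply/eqP; rewrite eq_complex /=; apply/andP; split; apply/eqP; lra.
  have bb : phi_bb x = e2%:C.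
    rewrite /phi_bb !mxE /= e1E; apply/eqP; rewrite eq_complex /=; apply/andP; split; apply/eqP; lra.
  have hi : tk_hi x = e2%:C *: 'X^0.
    by rewrite /tk_hi aa bb cb0 conjc0 mulr0 !scale0r !add0r -alg_polyC.
  have mi : tk_mid x = (-1) *: 'X^1.
    by rewrite /tk_mid ab0 x00 e1E oppr0 conjc0 polyC0 scale0r add0r addr0 rmorphN.
  have lo : tk_lo x = e2%:C *: 'X^2.
    by rewrite /tk_lo aa bb cb0 conjc_real conjc0 mulr0 scale0r polyC0 !addr0.
  rewrite hi mi lo !monomX !monomM e1E m1 coefZ coefXn.
  rewrite -[j == rev_ord k]val_eqE /=.
  rewrite [_ * (-1) ^+ _]mulrC -[X in X * _ = _]mulrA -exprD -e2s.
  congr (_ * _%:R); congr (nat_of_bool (_ == _)).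
  have := odd_double_half (2 * l - k).
  by rewrite oddB // oddM /=; lia.
Qed.

(** The parity of the support of [lamS] gives the character in e2; its symmetry under q -> 2l - q,
    with sign (-1)^eps, gives the character in e1. This explains the parity condition in Z and the
    sign eps. *)
Lemma lamS_M0 (sigma : 'I_2 * 'I_2) l p (m : M3) :
  (p <= l)%N -> (p = l + sigma.2 %[mod 2])%N -> M0 m ->
  lamS sigma l p *m TK l m = chiM sigma m *: lamS sigma l p.
Proof.
move=> pl pm [e1 [e2 [he1 he2 ->]]]; apply/rowP => q.
have odd0 : lamS sigma l p 0 q = 0 \/ odd q = odd (l + sigma.2).
  have [->|/(lamS_parity pl pm)] := eqVneq (lamS sigma l p 0 q) 0; by [left|right].
have := lamS_rev sigma q pl; move: (lamS sigma l p) odd0 => lam odd0 lam_rev.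
rewrite mxE; under eq_bigr do rewrite TK_diag //.
rewrite mxE /chiM !mxE /= rmorphM !rmorphXn /=.
have e2s n : e2%:C ^+ n = e2%:C ^+ odd n.
  move: he2; rewrite !inE => /orP[]/eqP ->; first by rewrite !expr1n.
  by rewrite rmorphN rmorph1 signr_odd.
have si2 : (odd sigma.2 : nat) = sigma.2 by case: (sigma.2) => [[|[]]].
have si1 : (odd sigma.1 : nat) = sigma.1 by case: (sigma.1) => [[|[]]].
move: (he1); rewrite !inE => /orP[]/eqP e1E.
  rewrite e1E eqxx rmorph1 expr1n mul1r (bigD1 q) //= big1 ?addr0; last first.
    by move=> i /negPf ->; rewrite !mulr0.
  rewrite eqxx mulr1 mulrC; case: odd0 => [->|oq]; first by rewrite ?(mulr0, mul0r).
  congr (_ * _); rewrite e2s -[in RHS]si2; congr (_ ^+ _).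
  by rewrite oddD oddb oq oddD; do 2 case: odd.
have m1 : (-1 == 1 :> R) = false by apply/eqP; lra.
rewrite e1E m1 rmorphN rmorph1 (bigD1 (rev_ord q)) //= big1 ?addr0; last first.
  by move=> i /negPf ->; rewrite !mulr0.
rewrite eqxx mulr1 lam_rev.
case: odd0 => [->|oq]; first by rewrite ?(mulr0, mul0r).
have -> : e2%:C ^+ (l + odd q) = e2%:C ^+ sigma.2.
  rewrite e2s -[in RHS]si2; congr (_ ^+ _).
  by rewrite oddD oddb oq oddD; do 2 case: odd.
(* Modulo 2, eps = l + sigma_1 + sigma_2 and q = l + sigma_2 add up to sigma_1. *)
have <- : (-1) ^+ eps sigma l * (-1) ^+ odd q = (-1) ^+ sigma.1 :> C.
  rewrite -exprD -signr_odd -[in RHS]signr_odd; congr (_ ^+ _).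
  by rewrite oddD oddb oq /eps modn2 oddb !oddD; do 3 case: odd.
rewrite mulr1n; move: (_ ^+ _) (_ ^+ _) (_ ^+ _) => u v w; ring.
Qed.

End WeightFunctionals.

(** * The adjoint action on the X_i is tau_4 *)

Section AdjointAction.
Context (R : realType).
Local Notation C := (R[i]).
Local Notation M3 := 'M[R]_3.

Lemma sum5E (V : zmodType) (f : 'I_5 -> V) :
  \sum_i f i = f (@Ordinal 5 0 isT) + f (@Ordinal 5 1 isT) + f (@Ordinal 5 2 isT)
    + f (@Ordinal 5 3 isT) + f (@Ordinal 5 4 isT).
Proof.
rewrite !big_ord_recl big_ord0 addr0 -!addrA.
by congr (f _ + (f _ + (f _ + (f _ + f _)))); apply/val_inj.
Qed.

Lemma mx_of_seqE (T : zmodType) n (s : seq (seq T)) (i j : 'I_n) :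
  mx_of_seq n s i j = (nth [::] s i)`_j.
Proof. by rewrite mxE. Qed.

Lemma scale_mx_of_seq (S : pzRingType) n (c : S) (s : seq (seq S)) :
  c *: mx_of_seq n s = mx_of_seq n (map (map ( *%R c)) s).
Proof.
apply/matrixP => i j; rewrite mxE !mx_of_seqE.
have [h|h] := ltnP i (size s); last first.
  by rewrite !(nth_default [::]) ?size_map // !nth_nil mulr0.
rewrite (nth_map [::]) //; have [h'|h'] := ltnP j (size (nth [::] s i)).
  by rewrite (nth_map 0).
by rewrite [RHS]nth_default ?size_map // [X in c * X]nth_default // mulr0.
Qed.

Lemma XpE :
  [/\ Xp R (@Ordinal 5 0 isT) =
        mx_of_seq 3 [:: [:: 0; 0; 0]; [:: 0; 1; - 'i%C]; [:: 0; - 'i%C; - 1]],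
      Xp R (@Ordinal 5 1 isT) =
        mx_of_seq 3 (map (map ( *%R (- 2^-1)))
          [:: [:: 0; 'i%C; 1]; [:: 'i%C; 0; 0]; [:: 1; 0; 0]]),
      Xp R (@Ordinal 5 2 isT) =
        mx_of_seq 3 (map (map ( *%R (- 3^-1)))
          [:: [:: 2; 0; 0]; [:: 0; -1; 0]; [:: 0; 0; -1]]),
      Xp R (@Ordinal 5 3 isT) =
        mx_of_seq 3 (map (map ( *%R (- 2^-1)))
          [:: [:: 0; 'i%C; -1]; [:: 'i%C; 0; 0]; [:: -1; 0; 0]]) &
      Xp R (@Ordinal 5 4 isT) =
        mx_of_seq 3 [:: [:: 0; 0; 0]; [:: 0; 1; 'i%C]; [:: 0; 'i%C; - 1]]].
Proof. by split; rewrite /Xp -?scale_mx_of_seq. Qed.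

Definition null_vec (s t : C) : 'cV[C]_3 :=
  \col_i [:: - (2 * 'i%C * s * t); t * t + s * s; 'i%C * (s * s - t * t)]`_i.

(* [(s x + t y)^4] corresponds to the rank one matrix [n n^T], where [n] is the
   isotropic vector corresponding to [(s x + t y)^2]. *)
Lemma null_vec_Xp s t :
  null_vec s t *m (null_vec s t)^T =
  \sum_(j < 5) ('C(4, j)%:R * (s ^+ j * t ^+ (4 - j))) *: Xp R j.
Proof.
have lin (c0 c1 c2 c3 c4 : C) (A0 A1 A2 A3 A4 : 'M[C]_3) i j :
    (c0 *: A0 + c1 *: A1 + c2 *: A2 + c3 *: A3 + c4 *: A4) i j =
    c0 * A0 i j + c1 * A1 i j + c2 * A2 i j + c3 * A3 i j + c4 * A4 i j.
  by rewrite !mxE.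
have out (u : 'cV[C]_3) i j : (u *m u^T) i j = u i 0 * u j 0.
  by rewrite mxE big_ord1 mxE.
have nE i : null_vec s t i 0 = [:: - (2 * 'i%C * s * t); t * t + s * s;
                                   'i%C * (s * s - t * t)]`_i by rewrite mxE.
rewrite sum5E; have [] := XpE.
have b2 : 'C(4, 2) = 6%N by []. have b3 : 'C(4, 3) = 4%N by [].
rewrite !subn0 subnn (_ : (4 - 1 = 3)%N) // (_ : (4 - 2 = 2)%N) // (_ : (4 - 3 = 1)%N) //.
rewrite bin0 bin1 b2 b3 binn.
move: (Xp R _) (Xp R _) (Xp R _) (Xp R _) (Xp R _) => X0 X1 X2 X3 X4 E0 E1 E2 E3 E4.
have {}E0 i j := etrans (congr1 (fun A : 'M[C]_3 => A i j) E0) (mx_of_seqE _ i j); have {}E1 i j := etrans (congr1 (fun A : 'M[C]_3 => A i j) E1) (mx_of_seqE _ i j).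
have {}E2 i j := etrans (congr1 (fun A : 'M[C]_3 => A i j) E2) (mx_of_seqE _ i j); have {}E3 i j := etrans (congr1 (fun A : 'M[C]_3 => A i j) E3) (mx_of_seqE _ i j).
have {}E4 i j := etrans (congr1 (fun A : 'M[C]_3 => A i j) E4) (mx_of_seqE _ i j).
have hi : 'i%C * 'i%C = -1 :> C by rewrite -expr2 sqr_i.
apply/matrixP => i j; rewrite out [RHS]lin !nE E0 E1 E2 E3 E4 {E0 E1 E2 E3 E4 lin out nE}.
move: 'i%C hi => I hi.
case: i => [[|[|[|//]]] ?]; case: j => [[|[|[|//]]] ?]; cbn [nth map nat_of_ord].
all: try (by field).
- by transitivity (4 * (I * I) * (s * s) * (t * t)); [ring|rewrite hi; field].
- by transitivity (- 2 * (I * I) * (s * t) * (s * s - t * t)); [ring|rewrite hi; field].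
- by transitivity (- 2 * (I * I) * (s * t) * (s * s - t * t)); [ring|rewrite hi; field].
- by transitivity ((I * I) * (s * s - t * t) ^+ 2); [ring|rewrite hi; field].
Qed.

(** Isotropic vectors are parametrized by squares of linear forms s x + t y, and a rotation acts on
    them through the action of SU(2) on the form. *)
Lemma phi_null_vec (a b s t : C) :
  map_mx (real_complex R) (phi (su2 a b)) *m null_vec s t =
  null_vec (s * conjc a + t * conjc b) (t * a - s * b).
Proof.
rewrite /phi; have [-> -> _ _] := su2E a b.
case: a b s t => [p q] [r s] [x y] [z w].
apply/colP => i; rewrite mxE sum3E !mxE.
case: (ord3E i) => -> /=.
all: by apply/eqP; rewrite eq_complex; apply/andP; split; apply/eqP => /=; ring.
Qed.

Lemma heval_binomial n (s t x y : C) :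
  heval (\col_(k < n.+1) ('C(n, k)%:R * (s ^+ k * t ^+ (n - k)))) x y =
  (s * x + t * y) ^+ n.
Proof.
rewrite /heval [s * x + _]addrC exprDn; apply: eq_bigr => k _.
rewrite mxE -mulr_natl !exprMn.
by move: (_ ^+ k) (_ ^+ k) (_ ^+ (n - k)) (_ ^+ (n - k)) => *; ring.
Qed.

(** By [null_vec_Xp] and [phi_null_vec] both sides agree after summation against the coefficients of
    (s x + t y)^4; comparing the coefficients of s^k t^(4-k) separates the X_k. *)
Lemma Ad_Xp (x : M3) (k : 'I_5) : SO3 x ->
  map_mx (real_complex R) x *m Xp R k *m (map_mx (real_complex R) x)^T =
  \sum_j tauK 2 x j k *: Xp R j.
Proof.
move=> xS; have [u [uS <-] ->] := tauK_lift 2 xS.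
move: uS => /SU2_su2[a [b [-> ab]]].
have tau4 s t x' y' := @tau_mul_heval R 4 (su2 a b)
  (\col_(k < 5) ('C(4, k)%:R * (s ^+ k * t ^+ (4 - k)))) x' y'.
have [i0 i1 _ _] := su2E (conjc a) (- b).
have {}tau4 s t : tau 4 (su2 a b) *m (\col_(k < 5) ('C(4, k)%:R * (s ^+ k * t ^+ (4 - k)))) =
    \col_(k < 5) ('C(4, k)%:R * ((s * conjc a + t * conjc b) ^+ k
                                * (t * a - s * b) ^+ (4 - k))).
  apply: heval_inj => x' y'; rewrite tau4 !heval_binomial invmx_su2 // i0 i1 !conjcE.
  by congr (_ ^+ _); ring.
move: (tau 4 _) tau4 => T tau4 {i0 i1}.
set P := map_mx _ _.
pose Y k := P *m Xp R k *m P^T; pose Z (k : 'I_5) := \sum_j T j k *: Xp R j.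
have YZ s t : \sum_(k < 5) ('C(4, k)%:R * (s ^+ k * t ^+ (4 - k))) *: Y k =
              \sum_(k < 5) ('C(4, k)%:R * (s ^+ k * t ^+ (4 - k))) *: Z k.
  transitivity (P *m (null_vec s t *m (null_vec s t)^T) *m P^T).
    rewrite null_vec_Xp mulmx_sumr mulmx_suml; apply: eq_bigr => i _.
    by rewrite -scalemxAr -scalemxAl.
  rewrite mulmxA phi_null_vec -mulmxA -trmx_mul phi_null_vec null_vec_Xp.
  rewrite /Z; under [RHS]eq_bigr do rewrite scaler_sumr.
  rewrite exchange_big; apply: eq_bigr => j _.
  under eq_bigr do rewrite scalerA; rewrite -scaler_suml; congr (_ *: _).
  have /colP/(_ j) := tau4 s t; rewrite !mxE => <-.
  by apply: eq_bigr => i _; rewrite mxE mulrC.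
rewrite -/(Y k) -/(Z k).
apply/matrixP => i j.
have : \col_(k < 5) ('C(4, k)%:R * Y k i j) = \col_(k < 5) ('C(4, k)%:R * Z k i j).
  apply: heval_inj => s t; have /matrixP/(_ i j) := YZ s t.
  rewrite !summxE /heval => h.
  transitivity (\sum_(k < 5) (('C(4, k)%:R * (s ^+ k * t ^+ (4 - k))) *: Y k) i j).
    by apply: eq_bigr => k' _; rewrite !mxE mulrAC.
  by rewrite h; apply: eq_bigr => k' _; rewrite !mxE mulrAC.
move=> /colP/(_ k); rewrite !mxE; apply: mulfI.
by rewrite pnatr_eq0 -lt0n bin_gt0 -ltnS.
Qed.

End AdjointAction.

(** * I^{2l}_{2m} as a transvectant *)

Section Transvectants.
Context (R : realType).
Local Notation C := (R[i]).

(** Expands binomial coefficients into polynomials, which [field] can compare. *)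
Lemma bin_natS (k j : nat) :
  ('C(k, j.+1)%:R : C) = 'C(k, j)%:R * (k%:R - j%:R) / j.+1%:R.
Proof.
apply: (canRL (mulfK _)); first by rewrite pnatr_eq0.
have [jk|kj] := leqP j k; last first.
  by rewrite !bin_small ?mul0r // ltnW.
by rewrite -natrM mulnC mul_bin_left -natrB // -natrM mulnC.
Qed.

(* The coefficient of [x'^i y'^(4-i)] in the [T^r] part of
   [(x + T x')^k (y + T y')^h (x y' - x' y)^(4-r)] (at [x = y = 1]). *)
Definition Abin (r k h i : nat) : C :=
  \sum_(j < r.+1) \sum_(s < (4 - r).+1)
    (j + s == i)%N%:R * ((-1) ^+ s * 'C(k, j)%:R * 'C(h, r - j)%:R * 'C(4 - r, s)%:R).

Definition cA (l : nat) (m : int) (r : nat) : C := r`!%:R / (d_den (2 * l)%:Z m)%:~R.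

(** The tables [a_list] are coefficients of a transvectant up to the factor r!. With h = 2l' - k and
    2l = k + h - 2m the claim is, for each of the 25 pairs (r, i), a polynomial identity in k and
    h. *)
Lemma Acoef_bin (l l' : nat) (m : int) (r k i : nat) :
  r%:Z = m + 2 -> (r <= 4)%N -> l'%:Z = l%:Z + m -> (k <= 2 * l')%N -> (i < 5)%N ->
  Acoef R (2 * l) m k%:Z i = cA l m r * Abin r k (2 * l' - k) i.
Proof.
move=> rm r4 ll' kl i5.
have mE : m = r%:Z - 2 by rewrite rm; lia.
have [h hE] : exists h, (2 * l' - k = h)%N by eexists.
have LE : (2 * l)%:Z = k%:Z + h%:Z - 2 * m by lia.
rewrite /Acoef ifT; last by lia.
rewrite /cA mulrAC; congr (_ / _); rewrite hE LE mE.
move: r4 i5 {rm ll' kl mE hE LE l l' m}; clear.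
case: r => [|[|[|[|[|//]]]]] _; case: i => [|[|[|[|[|//]]]]] _;
  rewrite /a_list /Abin !big_ord_recl !big_ord0 /= /bump /= ?(mul0r, mul1r, add0r, addr0);
  repeat (match goal with |- context [binomial (subn 4 ?a) ?b] =>
    let v := eval vm_compute in (binomial (subn 4 a) b) in
    rewrite (_ : binomial (subn 4 a) b = v); [|by []] end);
  repeat (match goal with |- context [binomial k ?b] =>
    let v := eval vm_compute in b in progress change (binomial k b) with (binomial k v) end);
  repeat (match goal with |- context [binomial h ?b] =>
    let v := eval vm_compute in b in progress change (binomial h b) with (binomial h v) end);
  rewrite ?bin_natS ?bin0.
all: try match goal with |- context [factorial ?r] =>
    let v := eval vm_compute in (factorial r) in
    rewrite (_ : factorial r = v); [|by []] end.
all: by field.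
Qed.

(** If the index q of the basis vector is out of range, each summand has a vanishing binomial
    coefficient; so setting v_q = 0 there loses nothing. *)
Lemma Abin_out r k h i (q : int) : (r <= 4)%N ->
  q = k%:Z + 4 - r%:Z - i%:Z -> ~~ (0 <= q <= k%:Z + h%:Z + 4 - 2 * r%:Z) ->
  Abin r k h i = 0.
Proof.
move=> r4 -> out; rewrite /Abin big1 // => j _; rewrite big1 // => s _.
have [ji|_] := eqVneq (j + s)%N i; last by rewrite mul0r.
have [kj|jk] := ltnP k j; first by rewrite (bin_small kj) mulr0 !mul0r mulr0.
have [hj|jh] := ltnP h (r - j); first by rewrite (bin_small hj) mulr0 !mul0r mulr0.
have := ltn_ord j; have := ltn_ord s; move: (nat_of_ord j) (nat_of_ord s) ji jk jh.
by move=> j' s' ? ? ? ? ?; exfalso; move: out; lia.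
Qed.

(** Exchanging the two variables reverses all indices and multiplies (x y' - x' y)^(4-r) by its
    sign. *)
Lemma Abin_sym r k h i : (r <= 4)%N -> (i <= 4)%N ->
  Abin r h k (4 - i) = (-1) ^+ (4 - r) * Abin r k h i.
Proof.
move=> r4 i4; rewrite /Abin (reindex_inj rev_ord_inj) big_distrr /=.
apply: eq_bigr => j _; rewrite (reindex_inj rev_ord_inj) big_distrr /=.
apply: eq_bigr => s _; have := ltn_ord j; have := ltn_ord s; rewrite !ltnS => s4 jr.
rewrite !subSS.
have -> : (r - j + (4 - r - s) == 4 - i)%N = (j + s == i)%N by lia.
rewrite (bin_sub s4) subKn //.
have -> : (-1) ^+ (4 - r) = (-1) ^+ (4 - r - s) * (-1) ^+ s :> C.
  by rewrite -exprD subnK.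
have sq : (-1) ^+ s * (-1) ^+ s = 1 :> C by rewrite -expr2 sqrr_sign.
transitivity ((j + s == i)%N%:R * ((-1) ^+ (4 - r - s) * ((-1) ^+ s * (-1) ^+ s)
   * 'C(h, r - j)%:R * 'C(k, j)%:R * 'C(4 - r, s)%:R) : C); last by ring.
by rewrite sq mulr1.
Qed.

Definition ev2 m n (A : 'M[C]_(m.+1, n.+1)) (x y x' y' : C) : C :=
  \sum_i \sum_j A i j * (x ^+ i * y ^+ (m - i)) * (x' ^+ j * y' ^+ (n - j)).

Lemma ev2_heval m n (A : 'M[C]_(m.+1, n.+1)) x y x' y' :
  ev2 A x y x' y' = heval (\col_j heval (col j A) x y) x' y'.
Proof.
rewrite /ev2 exchange_big; apply: eq_bigr => j _; rewrite mxE big_distrl /=.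
by apply: eq_bigr => i _; rewrite mxE.
Qed.

Lemma ev2_tensor m n (u : 'M[C]_2) (A : 'M[C]_(m.+1, n.+1)) x y x' y' :
  let a := invmx u 0 0 in let b := invmx u 0 1 in
  ev2 (tau m u *m A *m (tau n u)^T) x y x' y' =
  ev2 A (a * x + b * y) (- conjc b * x + conjc a * y)
        (a * x' + b * y') (- conjc b * x' + conjc a * y').
Proof.
move=> a b; rewrite !ev2_heval.
rewrite -[RHS]tau_mul_heval; congr (heval _ x' y'); apply/colP => j.
rewrite mxE.
transitivity (heval (\sum_k tau n u j k *: (tau m u *m col k A)) x y).
  congr (heval _ x y); apply/colP => i; rewrite !mxE summxE; apply: eq_bigr => k _.
  rewrite !mxE mulrC; congr (_ * _).
  by apply: eq_bigr => i' _; rewrite !mxE.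
rewrite heval_sum [RHS]mxE; apply: eq_bigr => k _.
by rewrite tau_mul_heval [X in _ = _ * X]mxE.
Qed.

(* [w] evaluated at [(x + T x', y + T y')]. *)
Definition taylor n (w : 'cV[C]_n.+1) (x y x' y' : C) : {poly C} :=
  \sum_(k < n.+1) w k 0 *: ((x%:P + x' *: 'X) ^+ k * (y%:P + y' *: 'X) ^+ (n - k)).

Lemma taylor_horner n (w : 'cV[C]_n.+1) x y x' y' t :
  (taylor w x y x' y').[t] = heval w (x + x' * t) (y + y' * t).
Proof.
rewrite /taylor horner_sum; apply: eq_bigr => k _.
by rewrite hornerZ hornerM !horner_exp !hornerD !hornerC !hornerZ !hornerX.
Qed.

Lemma taylor_tau n (u : 'M[C]_2) (w : 'cV[C]_n.+1) x y x' y' :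
  let a := invmx u 0 0 in let b := invmx u 0 1 in
  taylor (tau n u *m w) x y x' y' =
  taylor w (a * x + b * y) (- conjc b * x + conjc a * y)
           (a * x' + b * y') (- conjc b * x' + conjc a * y').
Proof.
move=> a b; apply/eqP; rewrite -subr_eq0; apply/eqP; apply: poly_eq0 => t.
rewrite hornerD hornerN !taylor_horner tau_mul_heval -/a -/b.
by apply/eqP; rewrite subr_eq0; apply/eqP; congr heval; ring.
Qed.

Lemma coef_linear_exp (x x' : C) k j :
  ((x%:P + x' *: 'X) ^+ k)`_j = 'C(k, j)%:R * (x ^+ (k - j) * x' ^+ j).
Proof.
have -> : (x%:P + x' *: 'X) ^+ k =
    \poly_(i < k.+1) ('C(k, i)%:R * (x ^+ (k - i) * x' ^+ i)).
  rewrite exprDn poly_def; apply: eq_bigr => i _.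
  rewrite exprZn -polyC_exp mul_polyC scalerA -scaler_nat scalerA.
  by congr (_ *: _); rewrite mulrC.
rewrite coef_poly ltnS; case: leqP => // kj.
by rewrite bin_small // mul0r.
Qed.

Lemma Imap_entry (l l' : nat) (m : int) (w : 'cV[C]_((2 * l').+1)) j i :
  Imap l m w j i =
  \sum_(k < (2 * l').+1) w k 0 *
    (Acoef R (2 * l) m k%:Z i * (j%:Z == k%:Z + 2 - m - i%:Z)%:R).
Proof.
rewrite /Imap summxE; apply: eq_bigr => k _.
rewrite mxE summxE; congr (_ * _).
rewrite (bigD1 i) //= big1 ?addr0 => [|i' i'i].
  rewrite mxE; congr (_ * _); rewrite mxE big_ord1 !mxE /=.
  by rewrite !eqxx mulr1.
rewrite mxE [X in _ * X](_ : _ = 0) ?mulr0 // mxE big_ord1 !mxE /=.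
by rewrite ?[i == _]eq_sym (negPf i'i) ?andbF mulr0.
Qed.

Lemma Imap_transvectant (l l' : nat) (m : int) (r : nat) (w : 'cV[C]_((2 * l').+1))
    x y x' y' :
  r%:Z = m + 2 -> (r <= 4)%N -> l'%:Z = l%:Z + m ->
  ev2 (Imap l m w) x y x' y' =
  cA l m r * ((taylor w x y x' y')`_r * (x * y' - x' * y) ^+ (4 - r)).
Proof.
move=> rm r4 ll'.
have kl (k : 'I_(2 * l').+1) : (k <= 2 * l')%N by rewrite -ltnS.
(* The monomial x^q y^(2l-q) with q = k + 2 - m - i, or 0 if q is not between 0 and 2l. *)
pose mono (k : 'I_(2 * l').+1) (i : nat) : C :=
  \sum_(j < (2 * l).+1) (j%:Z == k%:Z + 2 - m - i%:Z)%:R * (x ^+ j * y ^+ (2 * l - j)).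
have monoE (k : 'I_(2 * l').+1) (i q q' : nat) :
    q%:Z = k%:Z + 2 - m - i%:Z -> (q + q' = 2 * l)%N -> mono k i = x ^+ q * y ^+ q'.
  move=> hq qq'; have q2l : (q < (2 * l).+1)%N by rewrite ltnS -qq' leq_addr.
  rewrite /mono (bigD1 (Ordinal q2l)) //= big1 ?addr0.
    by rewrite hq eqxx mul1r -qq' addKn.
  by move=> j; rewrite -val_eqE /= -hq eqz_nat => /negPf ->; rewrite mul0r.
transitivity (\sum_(k < (2 * l').+1) w k 0 * (\sum_(i < 5) cA l m r *
    Abin r k (2 * l' - k) i * mono k i * (x' ^+ i * y' ^+ (4 - i)))).
  rewrite /ev2 exchange_big; under [RHS]eq_bigr do rewrite big_distrr.
  rewrite [RHS]exchange_big; apply: eq_bigr => i _.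
  under eq_bigr do rewrite Imap_entry -mulrA big_distrl.
  rewrite exchange_big; apply: eq_bigr => k _.
  rewrite -(Acoef_bin rm r4 ll' (kl k) (ltn_ord i)) /mono big_distrr /=.
  rewrite big_distrl /= big_distrr; apply: eq_bigr => j _ /=; ring.
clearbody mono; rewrite /taylor coef_sum big_distrl big_distrr; apply: eq_bigr => k _.
rewrite coefZ /= -[w k 0 * _ * _]mulrA [RHS]mulrCA; congr (_ * _).
have -> : (x * y' - x' * y) ^+ (4 - r) = \sum_(s < (4 - r).+1)
    'C(4 - r, s)%:R * (-1) ^+ s * ((x * y') ^+ (4 - r - s) * (x' * y) ^+ s).
  rewrite exprDn; apply: eq_bigr => s _.
  rewrite [(- (x' * y)) ^+ _]exprNn -mulr_natl.
  by move: (_ ^+ _) (_ ^+ _) (_ ^+ _) => *; ring.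
rewrite coefM big_distrl big_distrr /=.
under [RHS]eq_bigr do rewrite big_distrr big_distrr /=.
pose F j s : C := (-1) ^+ s * 'C(k, j)%:R * 'C(2 * l' - k, r - j)%:R * 'C(4 - r, s)%:R.
pose T i j s := (j + s == i)%N%:R * (cA l m r * F j s * mono k i * (x' ^+ i * y' ^+ (4 - i))).
transitivity (\sum_(i < 5) \sum_(j < r.+1) \sum_(s < (4 - r).+1) T i j s).
  apply: eq_bigr => i _; rewrite /Abin /T.
  rewrite big_distrr /= [_ * mono _ _]big_distrl /= big_distrl /=; apply: eq_bigr => j _.
  rewrite big_distrr /= [_ * mono _ _]big_distrl /= big_distrl /=; apply: eq_bigr => s _.
  by rewrite -/(F j s); ring.
rewrite exchange_big; apply: eq_bigr => j _; rewrite exchange_big.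
apply: eq_bigr => s _.
have js5 : (j + s < 5)%N.
  by have := ltn_ord j; have := ltn_ord s; move: (nat_of_ord j) (nat_of_ord s) => *; lia.
rewrite (bigD1 (Ordinal js5)) //= big1 ?addr0 => [|i]; last first.
  by rewrite -val_eqE /= eq_sym /T => /negPf ->; rewrite mul0r.
rewrite /T eqxx mul1r !coef_linear_exp /F.
(* Where the monomial would be out of range, a binomial coefficient vanishes. *)
have [kj|jk] := ltnP k j; first by rewrite (bin_small kj) !(mulr0, mul0r).
have [hj|jh] := ltnP (2 * l' - k) (r - j); first by rewrite (bin_small hj) !(mulr0, mul0r).
have jr : (j <= r)%N by rewrite -ltnS.
have sr : (s <= 4 - r)%N by rewrite -ltnS.
have hk := kl k.
rewrite (monoE k (j + s)%N (k - j + (4 - r - s))%N (2 * l' - k - (r - j) + s)%N); last 2 first.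
- by rewrite !PoszD; lia.
- by lia.
rewrite !exprD !exprMn (_ : (4 - (j + s) = (r - j) + (4 - r - s))%N); last by lia.
rewrite !exprD; move: (_ ^+ _) (_ ^+ _) (_ ^+ _) (_ ^+ _) => *.
ring.
Qed.

(* A tensor is determined by its values as a polynomial function, and [Imap] is
   a multiple of [w |-> [T^r] w(x + T x', y + T y') (x y' - x' y)^(4-r)]. *)
Lemma Imap_equivariant (l l' : nat) (m : int) (x : 'M[R]_3) w :
  -2 <= m <= 2 -> l'%:Z = l%:Z + m -> SO3 x ->
  Imap l m (tauK l' x *m w) = tensK x (Imap l m w).
Proof.
move=> m2 ll' xS; have [r rm] : exists r : nat, r%:Z = m + 2.
  by exists (absz (m + 2)); lia.
have r4 : (r <= 4)%N by lia.
rewrite /tensK; have [u [uS ux] _] := tauK_lift 2 xS.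
have tE n : tauK n x = tau (2 * n) u by rewrite tauK_TK // tau_TK // ux.
rewrite !tE; apply: mx_heval_inj => z z' y y'.
have := ev2_tensor u (Imap l m w) z z' y y'; rewrite {1}/ev2 => ->.
have := Imap_transvectant (tau (2 * l') u *m w) z z' y y' rm r4 ll'; rewrite {1}/ev2 => ->.
rewrite (Imap_transvectant _ _ _ _ _ rm r4 ll') taylor_tau.
congr (_ * (_ * _ ^+ _)).
move: uS => /SU2_su2[a [b [-> ab]]]; rewrite invmx_su2 //.
have [-> -> _ _] := su2E (conjc a) (- b); rewrite !conjcE.
(* The bracket x y' - x' y is invariant under substitutions of determinant 1. *)
transitivity ((a * conjc a + b * conjc b) * (z * y' - y * z')); last by ring.
by rewrite ab mul1r.
Qed.

End Transvectants.

(** * A class of smooth functions closed under differentiation *)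

Section ElementaryFunctions.
Context (R : realType).
Local Notation C := (R[i]).
Local Notation M3 := 'M[R]_3.

(* Closed under directional derivatives on [U], since the derivatives of exp,
   cos, sin and ln (1/f = exp (- ln f)) are expressible in the class. *)
Inductive elem (U : set M3) : (M3 -> R) -> Prop :=
| elem_cst c : elem U (fun=> c)
| elem_coord i j : elem U (fun x => x i j)
| elem_add f g : elem U f -> elem U g -> elem U (fun x => f x + g x)
| elem_mul f g : elem U f -> elem U g -> elem U (fun x => f x * g x)
| elem_exp f : elem U f -> elem U (fun x => expR (f x))
| elem_cos f : elem U f -> elem U (fun x => cos (f x))
| elem_sin f : elem U f -> elem U (fun x => sin (f x))
| elem_ln f : (forall x, U x -> 0 < f x) -> elem U f -> elem U (fun x => ln (f x)).

Lemma diff_comp1 (f : M3 -> R) (g : R -> R) (d : R) x :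
  differentiable f x -> is_derive (f x) 1 g d ->
  differentiable (fun y => g (f y)) x /\
  forall v, 'D_v (fun y => g (f y)) x = d * 'D_v f x.
Proof.
move=> df [dg gd].
have dg' : differentiable g (f x) by exact/derivable1_diffP.
have dgf : differentiable (g \o f) x by exact: differentiable_comp.
split=> // v; rewrite (deriveE _ dgf) diff_comp //= deriveE //.
by rewrite diff1E //= derive1E gd mulrC.
Qed.

Lemma elem_diff_derive U f : elem U f ->
  (forall x, U x -> differentiable f x) /\
  (forall v, exists2 g, elem U g & forall x, U x -> 'D_v f x = g x).
Proof.
elim=> {f} [c|i j|f g ef [df Df] eg [dg Dg]|f g ef [df Df] eg [dg Dg]
           |f ef [df Df]|f ef [df Df]|f ef [df Df]|f f0 ef [df Df]].
- split=> [x _|v]; first exact: differentiable_cst.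
  by exists (fun=> 0); [exact: elem_cst|move=> x _; rewrite derive_cst].
- split=> [x _|v]; first exact: differentiable_coord.
  exists (fun=> v i j); [exact: elem_cst|move=> x _].
  apply: cvg_lim => //; apply: cvg_near_cst; near=> h.
  rewrite /= !mxE addrK [LHS]mulKf //; near: h; exact: nbhs_dnbhs_neq.
- split=> [x Ux|v]; first exact: (differentiableD (df _ Ux) (dg _ Ux)).
  have [f' ef' Df'] := Df v; have [g' eg' Dg'] := Dg v.
  exists (fun x => f' x + g' x); first exact: elem_add.
  move=> x Ux; rewrite -Df' // -Dg' //.
  by apply: deriveD; apply: diff_derivable; [exact: df|exact: dg].
- split=> [x Ux|v]; first exact: (differentiableM (df _ Ux) (dg _ Ux)).
  have [f' ef' Df'] := Df v; have [g' eg' Dg'] := Dg v.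
  exists (fun x => f x * g' x + g x * f' x).
    by apply: elem_add; apply: elem_mul.
  move=> x Ux; rewrite -Df' // -Dg' //.
  by apply: deriveM; apply: diff_derivable; [exact: df|exact: dg].
- split=> [x Ux|v]; first by have [] := diff_comp1 (df _ Ux) (is_derive_expR (f x)).
  have [f' ef' Df'] := Df v; exists (fun x => expR (f x) * f' x).
    by apply: elem_mul => //; apply: elem_exp.
  by move=> x Ux; have [_ ->] := diff_comp1 (df _ Ux) (is_derive_expR (f x)); rewrite Df'.
- split=> [x Ux|v]; first by have [] := diff_comp1 (df _ Ux) (is_derive_cos (f x)).
  have [f' ef' Df'] := Df v; exists (fun x => (-1 * sin (f x)) * f' x).
    by apply: elem_mul => //; apply: elem_mul; [exact: elem_cst|exact: elem_sin].
  move=> x Ux; have [_ ->] := diff_comp1 (df _ Ux) (is_derive_cos (f x)).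
  by rewrite Df' // mulN1r.
- split=> [x Ux|v]; first by have [] := diff_comp1 (df _ Ux) (is_derive_sin (f x)).
  have [f' ef' Df'] := Df v; exists (fun x => cos (f x) * f' x).
    by apply: elem_mul => //; apply: elem_cos.
  by move=> x Ux; have [_ ->] := diff_comp1 (df _ Ux) (is_derive_sin (f x)); rewrite Df'.
- split=> [x Ux|v].
    by have [] := diff_comp1 (df _ Ux) (is_derive1_ln (f0 _ Ux)).
  have [f' ef' Df'] := Df v; exists (fun x => expR (-1 * ln (f x)) * f' x).
    apply: elem_mul => //; apply: elem_exp; apply: elem_mul; first exact: elem_cst.
    exact: elem_ln.
  move=> x Ux; have [_ ->] := diff_comp1 (df _ Ux) (is_derive1_ln (f0 _ Ux)).
  by rewrite Df' // mulN1r expRN lnK // posrE f0.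
Unshelve. all: by end_near. Qed.

Lemma elem_differentiable U f x : elem U f -> U x -> differentiable f x.
Proof. by move=> /elem_diff_derive[h _] /h. Qed.

(** Stated for any [h] equal to [f] on [U], because the derivative of an elementary function agrees
    with an elementary one on [U] only; openness of [U] allows this equality to be differentiated
    again. *)
Lemma elem_Cdiff n U f h : open U -> elem U f -> (forall x, U x -> h x = f x) ->
  Cdiff n U h.
Proof.
move=> oU; elim: n f h => [|n IH] f h ef hf.
all: have nhf x : U x -> \forall y \near x, f y = h y
  by move=> Ux; near=> y; rewrite hf //; near: y; exact: open_nbhs_nbhs.
all: have ch x : U x -> {for x, continuous h}
  by (move=> Ux; rewrite /prop_for /continuous_at hf //;
      apply: (cvg_trans (near_eq_cvg (nhf _ Ux)));
      have := differentiable_continuous (elem_differentiable ef Ux); exact).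
  by split.
split=> // v; have [_ /(_ v)[g eg fg]] := elem_diff_derive ef.
split=> [x Ux|].
  apply: near_eq_derivable (nhf _ Ux) _.
  exact/diff_derivable/(elem_differentiable ef).
apply: (IH g) => // x Ux; rewrite -fg //; apply/esym/near_eq_derive; exact: nhf.
Unshelve. all: by end_near. Qed.

Lemma elem_sub U V f : V `<=` U -> elem U f -> elem V f.
Proof.
move=> VU; elim; try by constructor.
by move=> g g0 _ eg; apply: elem_ln => // x /VU; exact: g0.
Qed.

Lemma elem_comp U V (k : M3 -> M3) f : (forall i j, elem U (fun x => k x i j)) ->
  (forall x, U x -> V (k x)) -> elem V f -> elem U (fun x => f (k x)).
Proof.
move=> ek kUV; elim=> {f} [c|i j|f g _ ef _ eg|f g _ ef _ eg
  |f _ ef|f _ ef|f _ ef|f f0 _ ef].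
- exact: elem_cst.
- exact: ek.
- exact: (elem_add ef eg).
- exact: (elem_mul ef eg).
- exact: (elem_exp ef).
- exact: (elem_cos ef).
- exact: (elem_sin ef).
- by apply: (elem_ln _ ef) => x /kUV; exact: f0.
Qed.

Lemma elem_continuous f : elem setT f -> continuous f.
Proof.
by move=> ef x; apply: differentiable_continuous; exact: (elem_differentiable ef).
Qed.

Lemma elem_sum U (I : Type) (r : seq I) (F : I -> M3 -> R) :
  (forall i, elem U (F i)) -> elem U (fun x => \sum_(i <- r) F i x).
Proof.
move=> eF; elim: r => [|i r IH].
  by under eq_fun do rewrite big_nil; exact: elem_cst.
by under eq_fun do rewrite big_cons; exact: elem_add.
Qed.

Definition celem U (F : M3 -> C) :=
  elem U (fun x => complex.Re (F x)) /\ elem U (fun x => complex.Im (F x)).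

Lemma ReD (a b : C) : complex.Re (a + b) = complex.Re a + complex.Re b.
Proof. by case: a b => ? ? [? ?]. Qed.
Lemma ImD (a b : C) : complex.Im (a + b) = complex.Im a + complex.Im b.
Proof. by case: a b => ? ? [? ?]. Qed.
Lemma ReM (a b : C) : complex.Re (a * b) =
  complex.Re a * complex.Re b + (- 1) * (complex.Im a * complex.Im b).
Proof. by case: a b => ? ? [? ?]; rewrite /= mulN1r. Qed.
Lemma ImM (a b : C) : complex.Im (a * b) =
  complex.Re a * complex.Im b + complex.Im a * complex.Re b.
Proof. by case: a b => ? ? [? ?]. Qed.

Lemma celem_cst U c : celem U (fun=> c).
Proof. by split; exact: elem_cst. Qed.

Lemma celem_add U F G : celem U F -> celem U G -> celem U (fun x => F x + G x).
Proof.
move=> [F1 F2] [G1 G2]; split.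
  by under eq_fun do rewrite ReD; exact: elem_add.
by under eq_fun do rewrite ImD; exact: elem_add.
Qed.

Lemma celem_mul U F G : celem U F -> celem U G -> celem U (fun x => F x * G x).
Proof.
move=> [F1 F2] [G1 G2]; split.
  under eq_fun do rewrite ReM; apply: elem_add; first exact: elem_mul.
  by apply: elem_mul; [exact: elem_cst|exact: elem_mul].
by under eq_fun do rewrite ImM; apply: elem_add; exact: elem_mul.
Qed.

Lemma celem_sum U (I : Type) (r : seq I) (F : I -> M3 -> C) :
  (forall i, celem U (F i)) -> celem U (fun x => \sum_(i <- r) F i x).
Proof.
move=> eF; elim: r => [|i r IH].
  by under eq_fun do rewrite big_nil; exact: celem_cst.
by under eq_fun do rewrite big_cons; exact: celem_add.
Qed.

Lemma celem_sub U V F : V `<=` U -> celem U F -> celem V F.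
Proof. by move=> VU [F1 F2]; split; exact: (elem_sub VU). Qed.

Lemma celem_comp U V (k : M3 -> M3) F : (forall i j, elem U (fun x => k x i j)) ->
  (forall x, U x -> V (k x)) -> celem V F -> celem U (fun x => F (k x)).
Proof.
move=> ek kUV [F1 F2]; split.
  exact: (elem_comp (f := fun x => complex.Re (F x)) ek kUV F1).
exact: (elem_comp (f := fun x => complex.Im (F x)) ek kUV F2).
Qed.

Lemma celem_conj U F : celem U F -> celem U (fun x => conjc (F x)).
Proof.
move=> [F1 F2]; split.
  by have -> : (fun x => complex.Re (conjc (F x))) = (fun x => complex.Re (F x))
    by apply/funext => x; case: (F x).
have -> : (fun x => complex.Im (conjc (F x))) = (fun x => (-1) * complex.Im (F x)).
  by apply/funext => x; case: (F x) => a b; rewrite mulN1r.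
by apply: elem_mul => //; exact: elem_cst.
Qed.

Lemma celem_real U f : elem U f -> celem U (fun x => (f x)%:C).
Proof. by move=> ef; split=> //=; exact: elem_cst. Qed.

Lemma celem_complex U f g : elem U f -> elem U g -> celem U (fun x => f x +i* g x).
Proof. by move=> ef eg; split. Qed.

End ElementaryFunctions.

(** * Explicit Iwasawa decomposition *)

Section Iwasawa.
Context (R : realType).
Local Notation C := (R[i]).
Local Notation M3 := 'M[R]_3.
Implicit Types x g k : M3.

(** Squared length of row 3; [iw_c0], [iw_c1], [iw_c2] form the cross product of rows 2 and 3, and
    [iw_n23] is its squared length. Left multiplication by N0 changes none of them. *)
Definition iw_n3 x : R := x i2 0 * x i2 0 + x i2 1 * x i2 1 + x i2 i2 * x i2 i2.
Definition iw_c0 x : R := x 1 1 * x i2 i2 + - 1 * (x 1 i2 * x i2 1).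
Definition iw_c1 x : R := x 1 i2 * x i2 0 + - 1 * (x 1 0 * x i2 i2).
Definition iw_c2 x : R := x 1 0 * x i2 1 + - 1 * (x 1 1 * x i2 0).
Definition iw_n23 x : R :=
  iw_c0 x * iw_c0 x + iw_c1 x * iw_c1 x + iw_c2 x * iw_c2 x.

(** The inverse square root, written so as to stay in the class [elem]. *)
Definition isqrt (r : R) : R := expR (- 2^-1 * ln r).

Lemma isqrtE r : 0 < r -> isqrt r * isqrt r * r = 1.
Proof.
move=> r0; rewrite /isqrt -expRD -[X in _ * X = _](lnK (x := r)) ?posrE // -expRD.
by rewrite (_ : _ + _ = 0) ?expR0 //; field.
Qed.

Lemma isqrt1 : isqrt 1 = 1.
Proof. by rewrite /isqrt ln1 mulr0 expR0. Qed.

Lemma isqrtM a r : 0 < a -> 0 < r -> a * isqrt (a * a * r) = isqrt r.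
Proof.
move=> a0 r0; rewrite /isqrt !lnM ?posrE ?mulr_gt0 //.
rewrite -{1}(lnK (x := a)) ?posrE // -expRD; congr expR; by field.
Qed.

(* The Iwasawa components: rows 1 and 3 of [kap x] are the normalized cross
   product of rows 2 and 3 of [x] and the normalized row 3 of [x]. *)
Definition kap x : M3 :=
  let s := isqrt (iw_n23 x) in let t := isqrt (iw_n3 x) in
  let u0 := iw_c0 x * s in let u1 := iw_c1 x * s in let u2 := iw_c2 x * s in
  let w0 := x i2 0 * t in let w1 := x i2 1 * t in let w2 := x i2 i2 * t in
  \matrix_(i, j) (nth [::]
    [:: [:: u0; u1; u2];
        [:: w1 * u2 + -1 * (w2 * u1); w2 * u0 + -1 * (w0 * u2); w0 * u1 + -1 * (w1 * u0)];
        [:: w0; w1; w2]] i)`_j.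

(** Logarithms of the first two diagonal entries of the A0-component: for x = n a k, [iw_n3] is
    a_3^2 and [iw_n23] is (a_2 a_3)^2 = a_1^-2. *)
Definition iw_l1 x : R := - 2^-1 * ln (iw_n23 x).
Definition iw_l2 x : R := 2^-1 * ln (iw_n23 x) + - 2^-1 * ln (iw_n3 x).

(** An open set of matrices containing SL(3,R) on which the formulas make sense; smoothness on the
    submanifold is witnessed there. *)
Definition iwU : set M3 := [set x | 0 < iw_n3 x /\ 0 < iw_n23 x].

Definition cexp (z : C) : C :=
  (expR (complex.Re z))%:C * (cos (complex.Im z) +i* sin (complex.Im z)).

Lemma cexpD z w : cexp (z + w) = cexp z * cexp w.
Proof.
case: z w => [a b] [c d]; rewrite /cexp /= expRD cosD sinD.
apply/eqP; rewrite eq_complex; apply/andP; split; apply/eqP => /=; ring.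
Qed.

Lemma cexp0 : cexp 0 = 1.
Proof. by rewrite /cexp /= expR0 cos0 sin0 mulr1. Qed.

Lemma cpowE (a : R) (z : C) : cpow a z = cexp (z * (ln a)%:C).
Proof. by case: z => p q; rewrite /cpow /cexp /= !mulr0 subr0 add0r. Qed.

Definition iwE (mu : C * C) x : C :=
  cexp (mu.1 * (iw_l1 x)%:C + mu.2 * (iw_l2 x)%:C).

(** The extension to G of a function [P] on K, with left covariance e^mu under N0 A0. *)
Definition Ext (mu : C * C) (P : M3 -> C) x : C := iwE mu x * P (kap x).

Lemma elem_iw : [/\ elem setT iw_n3, elem setT iw_c0, elem setT iw_c1,
  elem setT iw_c2 & elem setT iw_n23].
Proof.
have e0 : elem setT iw_c0 by do ?[exact: elem_coord|exact: elem_cst|apply: elem_add|apply: elem_mul].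
have e1 : elem setT iw_c1 by do ?[exact: elem_coord|exact: elem_cst|apply: elem_add|apply: elem_mul].
have e2 : elem setT iw_c2 by do ?[exact: elem_coord|exact: elem_cst|apply: elem_add|apply: elem_mul].
have e3 : elem setT iw_n23 by do ?[assumption|apply: elem_add|apply: elem_mul].
split=> //.
by do ?[exact: elem_coord|apply: elem_add|apply: elem_mul].
Qed.

Lemma iwU_open : open iwU.
Proof.
have [/elem_continuous c3 _ _ _ /elem_continuous c23] := elem_iw.
rewrite (_ : iwU = (iw_n3 @^-1` [set r | 0 < r]) `&` (iw_n23 @^-1` [set r | 0 < r])) //.
apply: openI.
  by apply: open_comp => [x _|]; [exact: c3|exact: open_gt].
by apply: open_comp => [x _|]; [exact: c23|exact: open_gt].
Qed.

Lemma elem_isqrt U f : (forall x, U x -> 0 < f x) -> elem U f ->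
  elem U (fun x => isqrt (f x)).
Proof.
move=> f0 ef; apply: elem_exp; apply: elem_mul; first exact: elem_cst.
exact: elem_ln.
Qed.

Lemma elem_kap i j : elem iwU (fun x => kap x i j).
Proof.
have [e3 e0 e1 e2 e23] := elem_iw.
have sT : iwU `<=` setT by [].
have t3 : elem iwU (fun x => isqrt (iw_n3 x)).
  by apply: elem_isqrt => [x []//|]; exact: elem_sub e3.
have t23 : elem iwU (fun x => isqrt (iw_n23 x)).
  by apply: elem_isqrt => [x []//|]; exact: elem_sub e23.
have u0 : elem iwU (fun x => iw_c0 x * isqrt (iw_n23 x)).
  by apply: elem_mul => //; exact: elem_sub e0.
have u1 : elem iwU (fun x => iw_c1 x * isqrt (iw_n23 x)).
  by apply: elem_mul => //; exact: elem_sub e1.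
have u2 : elem iwU (fun x => iw_c2 x * isqrt (iw_n23 x)).
  by apply: elem_mul => //; exact: elem_sub e2.
have w j' : elem iwU (fun x => x i2 j' * isqrt (iw_n3 x)).
  by apply: elem_mul => //; exact: elem_coord.
have cr a b c d : elem iwU a -> elem iwU b -> elem iwU c -> elem iwU d ->
    elem iwU (fun x => a x * b x + -1 * (c x * d x)).
  move=> *; apply: elem_add; first exact: elem_mul.
  by apply: elem_mul; [exact: elem_cst|exact: elem_mul].
by case: (ord3E i) => ->; case: (ord3E j) => ->; rewrite /kap;
  under eq_fun do rewrite mxE /=; first [exact: w|assumption|apply: cr].
Qed.

Lemma celem_cexp U F : celem U F -> celem U (fun x => cexp (F x)).
Proof.
move=> [F1 F2]; apply: celem_mul; first by apply: celem_real; exact: elem_exp.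
by apply: celem_complex; [exact: elem_cos|exact: elem_sin].
Qed.

Lemma celem_iwE mu : celem iwU (iwE mu).
Proof.
have [e3 e0 e1 e2 e23] := elem_iw; have sT : iwU `<=` setT by [].
have l3 : elem iwU (fun x => ln (iw_n3 x)).
  by apply: elem_ln => [x []//|]; exact: elem_sub e3.
have l23 : elem iwU (fun x => ln (iw_n23 x)).
  by apply: elem_ln => [x []//|]; exact: elem_sub e23.
apply: celem_cexp; apply: celem_add; apply: celem_mul; try exact: celem_cst.
  by apply: celem_real; apply: elem_mul => //; exact: elem_cst.
by apply: celem_real; apply: elem_add; apply: elem_mul => //; exact: elem_cst.
Qed.

Lemma celem_Ext mu P : celem setT P -> celem iwU (Ext mu P).
Proof.
move=> eP; apply: celem_mul; first exact: celem_iwE.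
by apply: celem_comp eP => // i j; exact: elem_kap.
Qed.

Lemma SL3_iwU x : SL3 x -> iwU x.
Proof.
rewrite /SL3 /= det3E => d1.
have sq (a b c : R) : ~ (a = 0 /\ b = 0 /\ c = 0) -> 0 < a * a + b * b + c * c.
  move=> h; rewrite lt0r !addr_ge0 -?expr2 ?sqr_ge0 // andbT.
  apply/negP; rewrite !paddr_eq0 ?addr_ge0 ?sqr_ge0 // !sqrf_eq0.
  by move=> /andP[/andP[/eqP a0 /eqP b0] /eqP c0]; apply: h.
split; apply: sq; rewrite /iw_c0 /iw_c1 /iw_c2 => -[h0 [h1 h2]].
  by move: d1; rewrite h0 h1 h2 => d1; lra.
suff : (0 : R) = 1 by lra.
rewrite -d1; transitivity (x 0 0 * (x 1 1 * x i2 i2 + -1 * (x 1 i2 * x i2 1))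
   + x 0 1 * (x 1 i2 * x i2 0 + -1 * (x 1 0 * x i2 i2))
   + x 0 i2 * (x 1 0 * x i2 1 + -1 * (x 1 1 * x i2 0))); last by ring.
by rewrite h0 h1 h2 !mulr0 !addr0.
Qed.

Lemma kap_SO3 x : iwU x -> SO3 (kap x).
Proof.
move=> [n3 n23]; rewrite /kap.
have := isqrtE n3; have := isqrtE n23.
set s := isqrt _; set t := isqrt _.
rewrite /iw_n3 /iw_n23; set c0 := iw_c0 x; set c1 := iw_c1 x; set c2 := iw_c2 x.
have orth : c0 * x i2 0 + c1 * x i2 1 + c2 * x i2 i2 = 0.
  by rewrite /c0 /c1 /c2 /iw_c0 /iw_c1 /iw_c2; ring.
move: c0 c1 c2 (x i2 0) (x i2 1) (x i2 i2) s t orth => c0 c1 c2 a0 a1 a2 s t orth hs ht.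
have {hs}: c0 * s * (c0 * s) + c1 * s * (c1 * s) + c2 * s * (c2 * s) = 1 by rewrite -hs; ring.
have {ht}: a0 * t * (a0 * t) + a1 * t * (a1 * t) + a2 * t * (a2 * t) = 1 by rewrite -ht; ring.
have {orth}: c0 * s * (a0 * t) + c1 * s * (a1 * t) + c2 * s * (a2 * t) = 0.
  by transitivity (s * t * (c0 * a0 + c1 * a1 + c2 * a2)); [ring|rewrite orth mulr0].
move: (c0 * s) (c1 * s) (c2 * s) (a0 * t) (a1 * t) (a2 * t) => u0 u1 u2 w0 w1 w2 uw ww uu.
(* Lagrange's identity for the cross product of two orthonormal vectors. *)
have l3 : (w1 * u2 + -1 * (w2 * u1)) ^+ 2 + (w2 * u0 + -1 * (w0 * u2)) ^+ 2
        + (w0 * u1 + -1 * (w1 * u0)) ^+ 2 = 1.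
  transitivity ((w0 * w0 + w1 * w1 + w2 * w2) * (u0 * u0 + u1 * u1 + u2 * u2)
     - (u0 * w0 + u1 * w1 + u2 * w2) ^+ 2); first by ring.
  by rewrite uu ww uw mulr1 expr0n subr0.
split; last by rewrite det3E !mxE /=; apply: etrans l3; ring.
apply: mx3P; split; rewrite !mxE sum3E !mxE /=; try ring.
all: first [exact: uu|exact: ww|exact: uw|by apply: etrans uw; ring
           |by apply: etrans l3; ring].
Qed.

End Iwasawa.

(** * Covariance of the extended functions; elementary sections *)

Section Sections.
Context (R : realType).
Local Notation C := (R[i]).
Local Notation M3 := 'M[R]_3.
Implicit Types x g k : M3.

Lemma SL3M x y : SL3 x -> SL3 y -> SL3 (x *m y).
Proof. by rewrite /SL3 /= det_mulmx => -> ->; rewrite mulr1. Qed.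

Lemma SO3_SL3 x : SO3 x -> SL3 x. Proof. by case. Qed.

Lemma NAM_rows (n x : M3) (a1 a2 a3 e1 e2 e3 : R) j : N0 n ->
  let y := n *m diag3 a1 a2 a3 *m diag3 e1 e2 e3 *m x in
  y 1 j = a2 * e2 * x 1 j + n 1 i2 * (a3 * e3) * x i2 j /\
  y i2 j = a3 * e3 * x i2 j.
Proof.
move=> [n0 n1] y.
have nE i : y i j = n i 0 * (a1 * e1) * x 0 j + n i 1 * (a2 * e2) * x 1 j
                 + n i i2 * (a3 * e3) * x i2 j.
  by rewrite /y /diag3 !mul_mx_diag mxE sum3E !mxE /=; ring.
rewrite !nE n1 (n0 1 0) // (n0 i2 0) // (n0 i2 1) // n1.
by split; ring.
Qed.

Lemma M0_sq (m : M3) : M0 m -> exists e1 e2 : R,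
  [/\ e1 * e1 = 1, e2 * e2 = 1 & m = diag3 e1 e2 (e1 * e2)].
Proof.
move=> [e1 [e2 [h1 h2 ->]]]; exists e1, e2; split=> //.
  by move: h1; rewrite !inE => /orP[]/eqP ->; rewrite ?mulr1 // mulrNN mulr1.
by move: h2; rewrite !inE => /orP[]/eqP ->; rewrite ?mulr1 // mulrNN mulr1.
Qed.

(** Row 3 is multiplied by a3 e1 e2 and the cross product of rows 2 and 3 by a2 a3 e1; normalization
    removes the positive factors and keeps the signs. *)
Lemma iw_NAM (n a m x : M3) : N0 n -> A0 a -> M0 m -> iwU x ->
  let y := n *m a *m m *m x in
  [/\ kap y = m *m kap x, iw_l1 y = ln (a 0 0) + iw_l1 x &
      iw_l2 y = ln (a 1 1) + iw_l2 x].
Proof.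
move=> Nn [a1 [a2 [a3 [p1 p2 p3 p123 ->]]]] /M0_sq[e1 [e2 [s1 s2 ->]]] [x3 x23] y.
have R1 j := (@NAM_rows n x a1 a2 a3 e1 e2 (e1 * e2) j Nn).1.
have R2 j := (@NAM_rows n x a1 a2 a3 e1 e2 (e1 * e2) j Nn).2.
rewrite -/y in R1 R2.
have c0 : iw_c0 y = a2 * a3 * e1 * iw_c0 x.
  rewrite /iw_c0 !R1 !R2; transitivity (a2 * a3 * e1 * (e2 * e2) * iw_c0 x);
  by [rewrite /iw_c0; ring|rewrite s2 mulr1].
have c1 : iw_c1 y = a2 * a3 * e1 * iw_c1 x.
  rewrite /iw_c1 !R1 !R2; transitivity (a2 * a3 * e1 * (e2 * e2) * iw_c1 x);
  by [rewrite /iw_c1; ring|rewrite s2 mulr1].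
have c2 : iw_c2 y = a2 * a3 * e1 * iw_c2 x.
  rewrite /iw_c2 !R1 !R2; transitivity (a2 * a3 * e1 * (e2 * e2) * iw_c2 x);
  by [rewrite /iw_c2; ring|rewrite s2 mulr1].
have n3 : iw_n3 y = a3 * a3 * iw_n3 x.
  rewrite /iw_n3 !R2; transitivity (a3 * a3 * (e1 * e1) * (e2 * e2) * iw_n3 x);
  by [rewrite /iw_n3; ring|rewrite s1 s2 !mulr1].
have n23 : iw_n23 y = (a2 * a3) * (a2 * a3) * iw_n23 x.
  rewrite /iw_n23 c0 c1 c2.
  transitivity ((a2 * a3) * (a2 * a3) * (e1 * e1) * iw_n23 x);
  by [rewrite /iw_n23; ring|rewrite s1 !mulr1].
have p23 : 0 < a2 * a3 by exact: mulr_gt0.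
have t3 := isqrtM p3 x3; have t23 := isqrtM p23 x23.
split.
- have w j : y i2 j * isqrt (iw_n3 y) = e1 * e2 * (x i2 j * isqrt (iw_n3 x)).
    by rewrite R2 n3 -t3; ring.
  have u0 : iw_c0 y * isqrt (iw_n23 y) = e1 * (iw_c0 x * isqrt (iw_n23 x)).
    by rewrite c0 n23 -t23; ring.
  have u1 : iw_c1 y * isqrt (iw_n23 y) = e1 * (iw_c1 x * isqrt (iw_n23 x)).
    by rewrite c1 n23 -t23; ring.
  have u2 : iw_c2 y * isqrt (iw_n23 y) = e1 * (iw_c2 x * isqrt (iw_n23 x)).
    by rewrite c2 n23 -t23; ring.
  rewrite /kap u0 u1 u2 !w.
  move: (iw_c0 x * _) (iw_c1 x * _) (iw_c2 x * _) => v0 v1 v2.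
  move: (x i2 0 * _) (x i2 1 * _) (x i2 i2 * _) => z0 z1 z2.
  apply: mx3P; split; rewrite mul_diag_mx !mxE /=; try ring;
  by (transitivity (e1 * e1 * e2 * (z1 * v2 + -1 * (z2 * v1))); [ring|rewrite s1; ring])
   || (transitivity (e1 * e1 * e2 * (z2 * v0 + -1 * (z0 * v2))); [ring|rewrite s1; ring])
   || (transitivity (e1 * e1 * e2 * (z0 * v1 + -1 * (z1 * v0))); [ring|rewrite s1; ring]).
- rewrite /iw_l1 n23 !lnM ?posrE ?mulr_gt0 // !mxE /= mulr1n.
  have -> : a1 = (a2 * a3)^-1.
    by apply: (mulIf (lt0r_neq0 p23)); rewrite mulVf ?lt0r_neq0 // mulrA.
  rewrite lnV ?posrE // lnM ?posrE //; by field.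
- rewrite /iw_l2 n23 n3 !lnM ?posrE ?mulr_gt0 // !mxE /= mulr1n; by field.
Qed.

Lemma Ext_covariant mu (P : M3 -> C) sigma :
  (forall m k, M0 m -> SO3 k -> P (m *m k) = chiM sigma m * P k) ->
  forall n a m x, N0 n -> A0 a -> M0 m -> SL3 x ->
    Ext mu P (n *m a *m m *m x) = eA mu a * chiM sigma m * Ext mu P x.
Proof.
move=> hP n a m x Nn Aa Mm xS; have xU := SL3_iwU xS.
rewrite /Ext /iwE; have [-> -> ->] := iw_NAM Nn Aa Mm xU.
rewrite hP //; last exact: kap_SO3.
rewrite /eA !cpowE -cexpD.
set A := (X in _ = cexp X * _ * _); set B := (X in _ = _ * (cexp X * _)).
have -> : mu.1 * (ln (a 0 0) + iw_l1 x)%:C + mu.2 * (ln (a 1 1) + iw_l2 x)%:C = A + B.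
  by rewrite /A /B !rmorphD /=; ring.
by rewrite cexpD; move: (cexp _) (cexp _) => *; ring.
Qed.

(** A rotation equals its own cofactor matrix, so the cross product rotates with the rows, and
    lengths are preserved. *)
Lemma iw_SO3 (g k : M3) : SO3 k ->
  [/\ iw_c0 (g *m k) = iw_c0 g * k 0 0 + iw_c1 g * k 1 0 + iw_c2 g * k i2 0,
      iw_c1 (g *m k) = iw_c0 g * k 0 1 + iw_c1 g * k 1 1 + iw_c2 g * k i2 1,
      iw_c2 (g *m k) = iw_c0 g * k 0 i2 + iw_c1 g * k 1 i2 + iw_c2 g * k i2 i2,
      iw_n3 (g *m k) = iw_n3 g & iw_n23 (g *m k) = iw_n23 g].
Proof.
move=> kS; have [[c00 c01 c02] [[c10 c11 c12] [c20 c21 c22]]] := SO3_cofactors kS.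
have [[r00 r11 r22] [r01 r02 r12]] := SO3_rows kS.
have E i j : (g *m k) i j = g i 0 * k 0 j + g i 1 * k 1 j + g i i2 * k i2 j.
  by rewrite mxE sum3E.
have e0 : iw_c0 (g *m k) = iw_c0 g * k 0 0 + iw_c1 g * k 1 0 + iw_c2 g * k i2 0.
  by rewrite /iw_c0 /iw_c1 /iw_c2 !E c00 c10 c20; ring.
have e1 : iw_c1 (g *m k) = iw_c0 g * k 0 1 + iw_c1 g * k 1 1 + iw_c2 g * k i2 1.
  by rewrite /iw_c0 /iw_c1 /iw_c2 !E c01 c11 c21; ring.
have e2 : iw_c2 (g *m k) = iw_c0 g * k 0 i2 + iw_c1 g * k 1 i2 + iw_c2 g * k i2 i2.
  by rewrite /iw_c0 /iw_c1 /iw_c2 !E c02 c12 c22; ring.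
have nrm (a b c : R) :
    (a * k 0 0 + b * k 1 0 + c * k i2 0) * (a * k 0 0 + b * k 1 0 + c * k i2 0) +
    (a * k 0 1 + b * k 1 1 + c * k i2 1) * (a * k 0 1 + b * k 1 1 + c * k i2 1) +
    (a * k 0 i2 + b * k 1 i2 + c * k i2 i2) * (a * k 0 i2 + b * k 1 i2 + c * k i2 i2) =
    a * a + b * b + c * c.
  transitivity (a * a * (k 0 0 * k 0 0 + k 0 1 * k 0 1 + k 0 i2 * k 0 i2) +
    b * b * (k 1 0 * k 1 0 + k 1 1 * k 1 1 + k 1 i2 * k 1 i2) +
    c * c * (k i2 0 * k i2 0 + k i2 1 * k i2 1 + k i2 i2 * k i2 i2) +
    2 * a * b * (k 0 0 * k 1 0 + k 0 1 * k 1 1 + k 0 i2 * k 1 i2) +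
    2 * a * c * (k 0 0 * k i2 0 + k 0 1 * k i2 1 + k 0 i2 * k i2 i2) +
    2 * b * c * (k 1 0 * k i2 0 + k 1 1 * k i2 1 + k 1 i2 * k i2 i2)); first by ring.
  by rewrite r00 r11 r22 r01 r02 r12 !mulr0 !mulr1 !addr0.
split=> //; first by rewrite /iw_n3 !E nrm.
by rewrite {1}/iw_n23 e0 e1 e2 nrm.
Qed.

Lemma kap_mulSO3 (g k : M3) : SO3 k -> kap (g *m k) = kap g *m k.
Proof.
move=> kS; have [[c00 c01 c02] [[c10 c11 c12] [c20 c21 c22]]] := SO3_cofactors kS.
have [e0 e1 e2 n3 n23] := iw_SO3 g kS.
have E j : (g *m k) i2 j = g i2 0 * k 0 j + g i2 1 * k 1 j + g i2 i2 * k i2 j.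
  by rewrite mxE sum3E.
rewrite /kap e0 e1 e2 n3 n23 !E.
move: (isqrt _) (isqrt _) (iw_c0 g) (iw_c1 g) (iw_c2 g) => s t a b c.
move: (g i2 0) (g i2 1) (g i2 i2) => u v w.
apply: mx3P; split; rewrite !mxE sum3E !mxE /=; try ring.
- by rewrite c00 c10 c20; ring.
- by rewrite c01 c11 c21; ring.
- by rewrite c02 c12 c22; ring.
Qed.

Lemma Ext_mulSO3 mu P (g k : M3) : SO3 k ->
  Ext mu P (g *m k) = iwE mu g * P (kap g *m k).
Proof.
move=> kS; rewrite /Ext /iwE /iw_l1 /iw_l2 kap_mulSO3 //.
by have [_ _ _ -> ->] := iw_SO3 g kS.
Qed.

Lemma iw_1 : kap (1%:M : M3) = 1%:M /\ forall mu, iwE mu (1%:M : M3) = 1.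
Proof.
have n3 : iw_n3 (1%:M : M3) = 1 by rewrite /iw_n3 !mxE /=; ring.
have c0 : iw_c0 (1%:M : M3) = 1 by rewrite /iw_c0 !mxE /=; ring.
have c1 : iw_c1 (1%:M : M3) = 0 by rewrite /iw_c1 !mxE /=; ring.
have c2 : iw_c2 (1%:M : M3) = 0 by rewrite /iw_c2 !mxE /=; ring.
have n23 : iw_n23 (1%:M : M3) = 1 by rewrite /iw_n23 c0 c1 c2; ring.
split; last first.
  by move=> mu; rewrite /iwE /iw_l1 /iw_l2 n3 n23 ln1 !mulr0 addr0 !mulr0 addr0 cexp0.
rewrite /kap n3 n23 c0 c1 c2 isqrt1.
by apply: mx3P; split; rewrite !mxE /=; ring.
Qed.

Lemma Ext_SO3 mu P (k : M3) : SO3 k -> Ext mu P k = P k.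
Proof.
move=> kS; rewrite -[X in Ext _ _ X]mul1mx Ext_mulSO3 //.
by have [-> ->] := iw_1; rewrite mul1mx mul1r.
Qed.

Lemma continuous_mx3 (T : topologicalType) (f : T -> M3) :
  (forall i j, continuous (fun t => f t i j)) -> continuous f.
Proof.
move=> fc t; apply/cvgrPdist_le => e e0; near=> s.
rewrite /Num.Def.normr/= mx_normrE (bigmax_le _ (ltW e0))//= => i _.
rewrite !mxE/=; move: i; near: s; apply: filter_forall => i.
exact: ((cvgrPdist_le _ _).1 (fc i.1 i.2 t)).
Unshelve. all: by end_near. Qed.

(** Sections given by elementary formulas near SL(3,R): stable under linear combinations and right
    translations, and containing every section differentiated below. *)
Definition elem_section (nu : C * C) (sigma : 'I_2 * 'I_2) (f : M3 -> C) : Prop :=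
  (exists2 U : set M3, open U /\ (forall x, SL3 x -> U x) & celem U f) /\
  forall n a m x, N0 n -> A0 a -> M0 m -> SL3 x ->
    f (n *m a *m m *m x) =
    eA (nu.1 + (rho0 R).1, nu.2 + (rho0 R).2) a * chiM sigma m * f x.

Lemma elem_section_smooth nu sigma f : elem_section nu sigma f ->
  smooth_sections nu sigma f.
Proof.
move=> [[U [oU US] [ef1 ef2]] hf]; split=> // g gS; exists U, f; split=> //.
  exact: US.
move=> n; split; first exact: (elem_Cdiff n oU ef1 (fun x _ => erefl)).
exact: (elem_Cdiff n oU ef2 (fun x _ => erefl)).
Qed.

Lemma elem_section_lin nu sigma (c : C) (f h : M3 -> C) : elem_section nu sigma f ->
  elem_section nu sigma h -> elem_section nu sigma (fun x => c * f x + h x).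
Proof.
move=> [[U [oU US] ef] hf] [[V [oV VS] eg] hg]; split.
  exists (U `&` V); first by split; [exact: openI|move=> x xS; split; [exact: US|exact: VS]].
  apply: celem_add; last by apply: celem_sub eg => x [].
  by apply: celem_mul; [exact: celem_cst|apply: celem_sub ef => x []].
by move=> n a m x Nn Aa Mm xS; rewrite hf // hg //; ring.
Qed.

Lemma elem_section_Ext nu sigma P : celem setT P ->
  (forall m k, M0 m -> SO3 k -> P (m *m k) = chiM sigma m * P k) ->
  elem_section nu sigma (Ext (nu.1 + (rho0 R).1, nu.2 + (rho0 R).2) P).
Proof.
move=> eP hP; split; last exact: Ext_covariant.
exists (@iwU R); last exact: celem_Ext.
by split; [exact: iwU_open|exact: SL3_iwU].
Qed.

Lemma elem_section_translate nu sigma f g : SL3 g -> elem_section nu sigma f ->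
  elem_section nu sigma (fun x => f (x *m g)).
Proof.
move=> gS [[U [oU US] ef] hf]; split; last first.
  by move=> n a m x Nn Aa Mm xS; rewrite -mulmxA hf //; exact: SL3M.
have em i j : elem setT (fun x : M3 => (x *m g) i j).
  under eq_fun do rewrite mxE; apply: elem_sum => k.
  by apply: elem_mul; [exact: elem_coord|exact: elem_cst].
exists [set x | U (x *m g)].
  split; last by move=> x xS; apply: US; exact: SL3M.
  apply: (open_comp (f := fun x : M3 => x *m g)) oU => x _.
  by apply: continuous_mx3 => i j; exact: elem_continuous (em i j).
apply: celem_comp ef => // i j; exact: elem_sub (em i j).
Qed.

End Sections.

(** * Differences of smooth sections *)

Section CdiffLinear.
Context (R : realType).
Local Notation C := (R[i]).
Local Notation M3 := 'M[R]_3.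

Lemma Cdiff_ext n (U : set M3) (f g : M3 -> R) : open U ->
  (forall x, U x -> g x = f x) -> Cdiff n U f -> Cdiff n U g.
Proof.
move=> oU; elim: n f g => [|n IH] f g gf.
all: have nfg x : U x -> \forall y \near x, f y = g y
  by move=> Ux; near=> y; rewrite gf //; near: y; exact: open_nbhs_nbhs.
all: have cg : (forall x, U x -> {for x, continuous f}) ->
  forall x, U x -> {for x, continuous g}
  by (move=> cf x Ux; rewrite /prop_for /continuous_at gf //;
      apply: (cvg_trans (near_eq_cvg (nfg _ Ux))); exact: cf).
  by move=> [/cg cf _].
move=> [/cg cf df]; split=> // v; have [dv Cv] := df v; split.
  by move=> x Ux; apply: near_eq_derivable (nfg _ Ux) _; exact: dv.
apply: IH Cv => x Ux; apply/esym/near_eq_derive; exact: nfg.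
Unshelve. all: by end_near. Qed.

Lemma Cdiff_subset n (U V : set M3) (f : M3 -> R) : V `<=` U -> Cdiff n U f -> Cdiff n V f.
Proof.
move=> VU; elim: n f => [|n IH] f [cf df]; split=> //; try by move=> x /VU; exact: cf.
by move=> v; have [dv Cv] := df v; split; [move=> x /VU; exact: dv|exact: IH].
Qed.

Lemma Cdiff_linear n (U : set M3) (a : R) (f g : M3 -> R) : open U ->
  Cdiff n U f -> Cdiff n U g -> Cdiff n U (fun x => a * f x + g x).
Proof.
move=> oU; elim: n f g => [|n IH] f g [cf df] [cg dg].
  by split=> // x Ux; exact: (cvgD (cvgM (cvg_cst a) (cf x Ux)) (cg x Ux)).
split=> [x Ux|v]; first by exact: (cvgD (cvgM (cvg_cst a) (cf x Ux)) (cg x Ux)).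
have [dfv Cfv] := df v; have [dgv Cgv] := dg v.
have dd x : U x -> derivable (a \*: f) x v by move=> Ux; apply: derivableZ; exact: dfv.
split; first by move=> x Ux; apply: (derivableD (dd x Ux)); exact: dgv.
apply: Cdiff_ext (IH _ _ Cfv Cgv) => // x Ux.
rewrite [LHS](deriveD (dd x Ux)); last exact: dgv.
by rewrite deriveZ //; exact: dfv.
Qed.

(** The section chosen in [s_fun] is known only to be smooth, so [emb_eq] has to subtract general
    smooth sections. *)
Lemma smooth_sections_sub nu sigma (f g : M3 -> C) :
  smooth_sections nu sigma f -> smooth_sections nu sigma g ->
  smooth_sections nu sigma (fun x => -1 * f x + g x).
Proof.
move=> [sf cf] [sg cg]; split; last first.
  by move=> n a m x Nn Aa Mm xS; rewrite cf // cg //; ring.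
move=> x xS; have [U [F [oU Ux FU CF]]] := sf x xS; have [V [G [oV Vx GV CG]]] := sg x xS.
exists (U `&` V), (fun x => -1 * F x + G x); split.
- exact: openI.
- by [].
- by move=> y [Uy Vy] yS; rewrite FU // GV.
- move=> n; have [F1 F2] := CF n; have [G1 G2] := CG n.
  have oUV : open (U `&` V) by exact: openI.
  have UVU : U `&` V `<=` U by move=> y [].
  have UVV : U `&` V `<=` V by move=> y [].
  split.
    apply: Cdiff_ext (Cdiff_linear (-1) oUV (Cdiff_subset UVU F1) (Cdiff_subset UVV G1)) => //.
    by move=> y _; rewrite ReD mulN1r; case: (F y) => ? ?; rewrite /= mulN1r.
  apply: Cdiff_ext (Cdiff_linear (-1) oUV (Cdiff_subset UVU F2) (Cdiff_subset UVV G2)) => //.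
  by move=> y _; rewrite ImD mulN1r; case: (F y) => ? ?; rewrite /= mulN1r.
Qed.

End CdiffLinear.

(** * Measurability and integrals over SO(3) *)

Section MeasureSO3.
Context (R : realType).
Local Notation C := (R[i]).
Local Notation M3 := 'M[R]_3.
Local Notation TM := (g_sigma_algebraType (@open M3)).

Lemma open_measurable_M3 (A : set M3) : open A -> measurable (A : set TM).
Proof. by move=> oA; apply: sub_sigma_algebra. Qed.

Lemma elem_level_measurable (f : M3 -> R) c : elem setT f ->
  measurable ([set x | f x = c] : set TM).
Proof.
move=> /elem_continuous cf; rewrite -[X in measurable X]setCK; apply: measurableC.
apply: open_measurable_M3.
rewrite (_ : ~` _ = f @^-1` [set r | r != c]); last first.
  by apply/seteqP; split=> x /= /eqP.
by apply: open_comp => [x _|]; [exact: cf|exact: open_neq].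
Qed.

Lemma SO3_measurable : measurable (@SO3 R : set TM).
Proof.
have ec i j : elem setT (fun x : M3 => (x *m x^T) i j).
  under eq_fun do (rewrite mxE; under eq_bigr do rewrite mxE).
  by apply: elem_sum => k; apply: elem_mul; exact: elem_coord.
have ed : elem setT (fun x : M3 => \det x).
  have m1 f g : elem setT f -> elem setT g -> elem setT (fun x : M3 => f x + -1 * g x).
    by move=> ef eg; apply: elem_add => //; apply: elem_mul => //; exact: elem_cst.
  rewrite (_ : (fun x : M3 => \det x) = fun x =>
    x 0 0 * (x 1 1 * x i2 i2 + -1 * (x 1 i2 * x i2 1))
  + -1 * (x 0 1 * (x 1 0 * x i2 i2 + -1 * (x 1 i2 * x i2 0)))
  + x 0 i2 * (x 1 0 * x i2 1 + -1 * (x 1 1 * x i2 0))); last first.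
    by apply/funext => x; rewrite det3E; ring.
  have m3 (i j k i' j' : 'I_3) : elem setT (fun x : M3 =>
      x 0 i * (x 1 j * x i2 k + -1 * (x 1 i' * x i2 j'))).
    apply: elem_mul; first exact: elem_coord.
    by apply: m1; apply: elem_mul; exact: elem_coord.
  by apply: elem_add; [apply: m1; exact: m3|exact: m3].
rewrite (_ : (@SO3 R : set TM) = (\bigcap_(p in [set: 'I_3 * 'I_3])
    [set x | (x *m x^T) p.1 p.2 = (1%:M : M3) p.1 p.2]) `&` [set x | \det x = 1]).
  apply: measurableI; last exact: elem_level_measurable.
  apply: fin_bigcap_measurable; first exact: finite_finset.
  by move=> [i j] _; exact: elem_level_measurable.
apply/seteqP; split => x; first by move=> [x1 x2]; split=> // p _; rewrite /= x1.
by move=> [x1 x2]; split=> //; apply/matrixP => i j; exact: (x1 (i, j)).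
Qed.

Lemma elem_measurable (U : set M3) (f : M3 -> R) : open U -> elem U f ->
  measurable_fun (U : set TM) (f : TM -> R).
Proof.
move=> oU ef; apply: (measurability _ (RGenOpens.measurableE R)).
move=> _ [_ [a [b ->]] <-]; apply: open_measurable_M3.
rewrite openE => x [Ux fx].
have cf := differentiable_continuous (elem_differentiable ef Ux).
apply: filterI; first exact: open_nbhs_nbhs.
by apply: cf; apply: open_nbhs_nbhs; split=> //; exact: interval_open.
Qed.


Context (dk : probability TM R) (dk1 : dk (@SO3 R) = 1%E).

Definition sqnorm (f : M3 -> C) (k : M3) : R :=
  complex.Re (f k) ^+ 2 + complex.Im (f k) ^+ 2.

Lemma sqnorm_measurable (U : set M3) (f : M3 -> C) : open U ->
  (forall x, SO3 x -> U x) -> celem U f ->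
  measurable_fun (@SO3 R : set TM) (fun k : TM => (sqnorm f k)%:E).
Proof.
move=> oU SU [e1 e2]; apply/measurable_EFinP.
apply: (@measurable_funS _ _ _ _ (U : set TM)) => //.
  exact: open_measurable_M3.
apply: elem_measurable => //; rewrite /sqnorm.
under eq_fun do rewrite !expr2.
by apply: elem_add; exact: elem_mul.
Qed.

Lemma integral_sqnorm_le (U : set M3) (f : M3 -> C) (b : R) : open U ->
  (forall x, SO3 x -> U x) -> celem U f -> (forall k, SO3 k -> sqnorm f k <= b) ->
  (\int[dk]_(k in @SO3 R) (sqnorm f k)%:E <= b%:E)%E.
Proof.
move=> oU SU ef fb; rewrite -[leRHS]mule1 -dk1 -integral_cst; last exact: SO3_measurable.
apply: ge0_le_integral => //.
- exact: SO3_measurable.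
- by move=> k _; rewrite lee_fin addr_ge0 // sqr_ge0.
- exact: (sqnorm_measurable oU).
Qed.

End MeasureSO3.

(** * From functions on K to vectors of H *)

Section Embedding.
Context (R : realType).
Local Notation C := (R[i]).
Local Notation M3 := 'M[R]_3.
Local Notation TM := (g_sigma_algebraType (@open M3)).
Context (nu : C * C) (sigma : 'I_2 * 'I_2) (dk : probability TM R).
Context (Hdk : is_haar_SO3 dk) (H : completeNormedModType C).
Context (emb : (M3 -> C) -> H) (act : M3 -> H -> H).
Context (Hact : is_principal_series nu sigma dk emb act).

Lemma elem_section_SO3 (f : M3 -> C) : elem_section nu sigma f ->
  exists2 U : set M3, open U /\ (forall k, SO3 k -> U k) & celem U f.
Proof.
move=> [[U [oU SU] eU] _]; exists U => //; split=> // k kS.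
by apply: SU; exact: SO3_SL3.
Qed.

(** [dk] has mass 1 on SO(3), so a bound on K is a bound in H; uniform convergence on K therefore
    gives convergence in H. *)
Lemma emb_norm_le (f : M3 -> C) (b : R) : elem_section nu sigma f -> 0 <= b ->
  (forall k, SO3 k -> sqnorm f k <= b ^+ 2) -> `|emb f| <= b%:C.
Proof.
move=> fs b0 fb; have [U [oU SU] ef] := elem_section_SO3 fs.
rewrite (emb_isometry Hact); last exact: elem_section_smooth.
rewrite lecR /normK -[leRHS](ger0_norm b0) -sqrtr_sqr ler_wsqrtr //.
have := integral_sqnorm_le Hdk.1 oU SU ef fb.
have : (0 <= \int[dk]_(k in @SO3 R) (sqnorm f k)%:E)%E.
  by apply: integral_ge0 => k _; rewrite lee_fin addr_ge0 // sqr_ge0.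
by rewrite /sqnorm; case: (integral _ _ _) => [r||].
Qed.

(** The norm sees only the restriction to SO(3). Identities in H are thereby reduced to identities
    of functions on K. *)
Lemma emb_eq (f g : M3 -> C) : smooth_sections nu sigma f ->
  smooth_sections nu sigma g -> (forall k, SO3 k -> f k = g k) -> emb f = emb g.
Proof.
move=> fs gs fg; apply/eqP; rewrite eq_sym -subr_eq0 addrC -scaleN1r.
rewrite -(emb_linear Hact) // -normr_eq0 (emb_isometry Hact); last exact: smooth_sections_sub.
rewrite /normK (eq_integral (cst 0%E)) ?integral0 /= ?sqrtr0 // => k.
by rewrite inE => kS; rewrite fg // mulN1r addNr /= expr0n /= addr0.
Qed.

Lemma elem_section0 : elem_section nu sigma (fun=> 0).
Proof.
split; last by move=> *; rewrite mulr0.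
by exists setT; [split=> //; exact: openT|exact: celem_cst].
Qed.

Lemma elem_section_sum (I : Type) (r : seq I) (c : I -> C) (f : I -> M3 -> C) :
  (forall i, elem_section nu sigma (f i)) ->
  elem_section nu sigma (fun x => \sum_(i <- r) c i * f i x).
Proof.
move=> fs; elim: r => [|i r IH].
  by under eq_fun do rewrite big_nil; exact: elem_section0.
by under eq_fun do rewrite big_cons; exact: elem_section_lin.
Qed.

Lemma emb_sum (I : Type) (r : seq I) (c : I -> C) (f : I -> M3 -> C) :
  (forall i, elem_section nu sigma (f i)) ->
  emb (fun x => \sum_(i <- r) c i * f i x) = \sum_(i <- r) c i *: emb (f i).
Proof.
move=> fs; elim: r => [|i r IH].
  have s0 := elem_section_smooth elem_section0.
  under eq_fun do rewrite big_nil; rewrite big_nil.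
  have := emb_linear Hact (-1) s0 s0.
  by under eq_fun do rewrite mulr0 addr0; rewrite scaleN1r addNr.
under eq_fun do rewrite big_cons; rewrite big_cons (emb_linear Hact) ?IH //.
  exact: elem_section_smooth.
by apply: elem_section_smooth; exact: elem_section_sum.
Qed.

Lemma emb_eq0_integral (f : M3 -> C) (b : R) : elem_section nu sigma f ->
  (forall k, SO3 k -> sqnorm f k <= b) -> emb f = 0 ->
  (\int[dk]_(k in @SO3 R) (sqnorm f k)%:E = 0)%E.
Proof.
move=> fs fb f0; have [U [oU SU] ef] := elem_section_SO3 fs.
have := emb_isometry Hact (elem_section_smooth fs); rewrite f0 normr0 => /esym/eqP.
rewrite eq_complex /= eqxx andbT /normK sqrtr_eq0.
(* The bound excludes an infinite integral, which [fine] would also send to 0. *)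
have := integral_sqnorm_le Hdk.1 oU SU ef fb.
have : (0 <= \int[dk]_(k in @SO3 R) (sqnorm f k)%:E)%E.
  by apply: integral_ge0 => k _; rewrite lee_fin addr_ge0 // sqr_ge0.
rewrite /sqnorm; case: (integral _ _ _) => [r||] //=.
by rewrite lee_fin => r0 _ r0'; congr EFin; apply/eqP; rewrite eq_le r0'.
Qed.

Lemma sqnormE (f : M3 -> C) k : (sqnorm f k)%:C = f k * conjc (f k).
Proof.
rewrite /sqnorm; case: (f k) => a b; apply/eqP; rewrite eq_complex.
by apply/andP; split; apply/eqP => /=; ring.
Qed.

(* By unitarity [sum_q C(2l,q) |(lam tau(x))_q|^2] does not depend on [x], so
   it vanishes if its integral does. *)
Lemma emb_lam_inj (l : nat) (lam : 'rV[C]_((2 * l).+1)) (f : 'I_(2 * l).+1 -> M3 -> C) :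
  (forall q, elem_section nu sigma (f q)) ->
  (forall q k, SO3 k -> f q k = (lam *m tauK l k) 0 q) ->
  (forall q, emb (f q) = 0) -> lam = 0.
Proof.
move=> fs fE f0.
have binR (q : nat) : 'C(2 * l, q)%:R = ('C(2 * l, q)%:R : R)%:C by rewrite rmorph_nat.
pose S k := \sum_(q < (2 * l).+1) 'C(2 * l, q)%:R * sqnorm (f q) k.
pose c := \sum_(q < (2 * l).+1) 'C(2 * l, q)%:R *
  (complex.Re (lam 0 q) ^+ 2 + complex.Im (lam 0 q) ^+ 2).
have Sc k : SO3 k -> S k = c.
  move=> kS; apply: (@complexI R); rewrite /S /c !rmorph_sum /=.
  transitivity (\sum_(q < (2 * l).+1) 'C(2 * l, q)%:R * (lam 0 q * conjc (lam 0 q))).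
    rewrite -(tauK_unitary lam kS); apply: eq_bigr => q _.
    by rewrite rmorphM /= -binR sqnormE fE.
  apply: eq_bigr => q _; rewrite rmorphM /= -binR; congr (_ * _).
  by rewrite -(sqnormE (fun=> lam 0 q) 0).
have sq0 q k : 0 <= sqnorm (f q) k by rewrite addr_ge0 ?sqr_ge0.
have bin1 (q : 'I_(2 * l).+1) : (1 : R) <= 'C(2 * l, q)%:R.
  by rewrite ler1n bin_gt0 -ltnS.
have fb q k : SO3 k -> sqnorm (f q) k <= c.
  move=> /Sc <-; rewrite /S (bigD1 q) //= ler_wpDr //.
    by apply: sumr_ge0 => i _; rewrite mulr_ge0.
  by rewrite ler_peMl.
have int0 q := emb_eq0_integral (fs q) (fb q) (f0 q).
have c0 : c = 0.
  have : (\int[dk]_(k in @SO3 R) (S k)%:E = 0)%E.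
    under eq_integral do rewrite /S -sumEFin.
    rewrite ge0_integral_sum //; last 3 first.
    - exact: SO3_measurable.
    - move=> q; have [U [oU SU] ef] := elem_section_SO3 (fs q).
      under eq_fun do rewrite EFinM; apply: measurable_funeM.
      exact: (sqnorm_measurable oU SU ef).
    - by move=> q k _; rewrite lee_fin mulr_ge0.
    rewrite big1 // => q _; under eq_integral do rewrite EFinM.
    have [U [oU SU] ef] := elem_section_SO3 (fs q).
    rewrite ge0_integralZl_EFin //.
    - by rewrite int0 mule0.
    - exact: SO3_measurable.
    - by move=> k _; rewrite lee_fin.
    - exact: (sqnorm_measurable oU SU ef).
  rewrite (eq_integral (cst c%:E)) => [|k]; last by rewrite inE => /Sc ->.
  rewrite integral_cst; last exact: SO3_measurable.
  by rewrite [X in (_ * X)%E]Hdk.1 mule1 => -[].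
apply/rowP => q; rewrite mxE.
move: c0 => /eqP; rewrite /c psumr_eq0 => [/allP/(_ q)|i _]; last first.
  by rewrite mulr_ge0 // addr_ge0 // sqr_ge0.
rewrite mem_index_enum => /(_ isT); rewrite mulf_eq0 paddr_eq0 ?sqr_ge0 // !sqrf_eq0.
rewrite gt_eqF /= ?(lt_le_trans ltr01) // => /andP[/eqP a /eqP b].
by case: (lam 0 q) a b => a b /= -> ->.
Qed.

End Embedding.

(** * Exponential curves and derivatives uniform in K *)

Section Exponential.
Context (R : realType).
Local Notation M3 := 'M[R]_3.
Implicit Types (X Q : M3).

Lemma mx_entry_norm (A : M3) i j : `|A i j| <= `|A|.
Proof.
rewrite [leRHS]/Num.Def.normr/= mx_normrE.
exact: (le_bigmax _ (fun ij : 'I_3 * 'I_3 => `|A ij.1 ij.2|) (i, j)).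
Qed.

Lemma mx_norm_le (A : M3) c : 0 <= c -> (forall i j, `|A i j| <= c) -> `|A| <= c.
Proof.
move=> c0 h; rewrite [leLHS]/Num.Def.normr/= mx_normrE.
by apply: bigmax_le => // -[i j] _; exact: h.
Qed.

Lemma cvg_mx3 (T : Type) (F : set_system T) (FF : Filter F) (f : T -> M3) (A : M3) :
  (forall i j, (fun t => f t i j) @ F --> A i j) -> f @ F --> A.
Proof.
move=> h; apply/cvgrPdist_le => e e0; near=> t.
apply: mx_norm_le; first exact: ltW.
move=> i j; rewrite !mxE.
have : forall ij : 'I_3 * 'I_3, `|A ij.1 ij.2 - f t ij.1 ij.2| <= e; last by move/(_ (i, j)).
near: t; apply: filter_forall => ij.
exact: ((cvgrPdist_le _ _).1 (h ij.1 ij.2)).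
Unshelve. all: by end_near. Qed.

Lemma der_cst (c : R) : is_derive (0 : R) 1 (fun=> c) 0.
Proof. exact: is_derive_cst. Qed.

Lemma der_add (f g : R -> R) a b : is_derive (0 : R) 1 f a ->
  is_derive (0 : R) 1 g b -> is_derive (0 : R) 1 (fun t => f t + g t) (a + b).
Proof. exact: is_deriveD. Qed.

Lemma der_mul (f g : R -> R) a b : is_derive (0 : R) 1 f a ->
  is_derive (0 : R) 1 g b ->
  is_derive (0 : R) 1 (fun t => f t * g t) (f 0 * b + g 0 * a).
Proof. exact: is_deriveM. Qed.

Lemma der_expR (d : R) : is_derive (0 : R) 1 (fun t => expR (t * d)) d.
Proof.
have h : is_derive (0 : R) 1 (fun t : R => t * d) d.
  have := der_mul (is_derive_id (0 : R) 1) (der_cst d).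
  by rewrite mulr0 add0r mulr1.
have := @is_derive1_comp R expR (fun t : R => t * d) 0 _ _ (is_derive_expR _) h.
by rewrite mul0r expR0 mul1r.
Qed.

(* [X] has an orthonormal eigenbasis; this covers the real and imaginary
   parts of the [X_i]. *)
Definition diagonalized X Q (d0 d1 d2 : R) : Prop :=
  [/\ Q *m Q^T = 1%:M, d0 + d1 + d2 = 0 & X = Q *m diag3 d0 d1 d2 *m Q^T].

Definition diag_curve Q (d0 d1 d2 t : R) : M3 :=
  Q *m diag3 (expR (t * d0)) (expR (t * d1)) (expR (t * d2)) *m Q^T.

Lemma conj_diag_entry Q (a b c : R) i j : (Q *m diag3 a b c *m Q^T) i j =
  Q i 0 * a * Q j 0 + Q i 1 * b * Q j 1 + Q i i2 * c * Q j i2.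
Proof. by rewrite mxE sum3E /diag3 mul_mx_diag !mxE. Qed.

Lemma expmx_diagonalized X Q d0 d1 d2 t : diagonalized X Q d0 d1 d2 ->
  expmx (t *: X) = diag_curve Q d0 d1 d2 t.
Proof.
move=> [QQ _ ->].
have QQ' : Q^T *m Q = 1%:M by exact: mulmx1C.
have pw k : (t *: (Q *m diag3 d0 d1 d2 *m Q^T)) ^+ k =
    Q *m diag3 ((t * d0) ^+ k) ((t * d1) ^+ k) ((t * d2) ^+ k) *m Q^T.
  elim: k => [|k IH].
    rewrite !expr0 (_ : diag3 1 1 1 = 1%:M); first by rewrite mulmx1 QQ.
    by apply: mx3P; split; rewrite !mxE.
  rewrite exprS IH (_ : forall A B : M3, A * B = A *m B) // -scalemxAl.
  rewrite !mulmxA -(mulmxA (Q *m diag3 d0 d1 d2) Q^T Q) QQ' mulmx1.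
  rewrite -(mulmxA Q (diag3 d0 d1 d2)) scalemxAl scalemxAr.
  congr (_ *m _ *m _).
  by apply: mx3P; split; rewrite /diag3 !mxE sum3E !mxE /= !exprS; ring.
apply: cvg_lim => //; apply: cvg_mx3 => i j.
have e d : (fun n => series (exp_coeff (t * d)) n) @ \oo --> expR (t * d).
  exact: is_cvg_series_exp_coeff.
rewrite conj_diag_entry.
rewrite (_ : (fun n => _) = fun n =>
   Q i 0 * series (exp_coeff (t * d0)) n * Q j 0
 + Q i 1 * series (exp_coeff (t * d1)) n * Q j 1
 + Q i i2 * series (exp_coeff (t * d2)) n * Q j i2).
  have cm a b d : (fun n => a * series (exp_coeff (t * d)) n * b) @ \oo --> a * expR (t * d) * b.
    by apply: cvgM; [apply: cvgM; [exact: cvg_cst|exact: e]|exact: cvg_cst].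
  by apply: cvgD; [apply: cvgD; exact: cm|exact: cm].
apply/funext => n; rewrite /series /= summxE !big_distrr !big_distrl /= -!big_split /=.
apply: eq_bigr => k _; rewrite mxE pw conj_diag_entry /exp_coeff /=; ring.
Qed.

Lemma diag_curve_SL3 Q d0 d1 d2 t : Q *m Q^T = 1%:M -> d0 + d1 + d2 = 0 ->
  SL3 (diag_curve Q d0 d1 d2 t).
Proof.
move=> QQ d; rewrite /SL3 /= /diag_curve !det_mulmx mulrAC -det_mulmx QQ det1 mul1r.
rewrite /diag3 det_diag.
rewrite (_ : \prod_i _ = expR (t * d0) * expR (t * d1) * expR (t * d2)).
  by rewrite -!expRD -!mulrDr d mulr0 expR0.
rewrite !big_ord_recl big_ord0 mulr1 !mxE /= mulrA //.
Qed.

(* [g] is a curve through 1 with velocity [X] at time 0 *)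
Definition tangent (g : R -> M3) X : Prop :=
  g 0 = 1%:M /\ forall i j, is_derive (0 : R) 1 (fun t => g t i j) (X i j).

Lemma diag_curve_tangent X Q d0 d1 d2 : diagonalized X Q d0 d1 d2 ->
  tangent (diag_curve Q d0 d1 d2) X.
Proof.
move=> [QQ _ ->]; split.
  rewrite /diag_curve !mul0r expR0 (_ : diag3 1 1 1 = 1%:M); first by rewrite mulmx1 QQ.
  by apply: mx3P; split; rewrite !mxE.
move=> i j; rewrite conj_diag_entry /diag_curve.
under eq_fun do rewrite conj_diag_entry.
have c a b d : is_derive (0 : R) 1 (fun t => a * expR (t * d) * b) (a * d * b).
  have := der_mul (der_mul (der_cst a) (der_expR d)) (der_cst b).
  by rewrite !mulr0 addr0 add0r mulrC.
exact: (der_add (der_add (c _ _ _) (c _ _ _)) (c _ _ _)).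
Qed.

Lemma SO3_entry_le1 (k : M3) i j : SO3 k -> `|k i j| <= 1.
Proof.
move=> /SO3_rows[[r0 r1 r2] _].
have sq (a b c : R) : a * a + b * b + c * c = 1 -> [/\ `|a| <= 1, `|b| <= 1 & `|c| <= 1].
  by move=> h; split; rewrite -(ler_pXn2r (n := 2)) ?nnegrE // expr1n real_normK ?num_real //; nra.
have [? ? ?] := sq _ _ _ r0; have [? ? ?] := sq _ _ _ r1; have [? ? ?] := sq _ _ _ r2.
by case: (ord3E i) => ->; case: (ord3E j) => ->.
Qed.

(** In the maximum norm, each product with a matrix whose entries are at most 1 costs a factor 3. *)
Lemma norm_conj_SO3 (k A : M3) : SO3 k -> `|k *m A *m k^T| <= 9 * `|A|.
Proof.
move=> kS; apply: mx_norm_le; first by rewrite mulr_ge0.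
move=> i j; rewrite mxE.
have b2 (a c : R) : `|c| <= 1 -> `|a * c| <= `|a|.
  by move=> c1; rewrite normrM ler_piMr.
apply: le_trans (ler_norm_sum _ _ _) _.
rewrite sum3E.
have t l : `|(k *m A) i l * k^T l j| <= 3 * `|A|.
  rewrite [k^T _ _]mxE; apply: le_trans (b2 _ _ _) _; first exact: SO3_entry_le1.
  rewrite mxE; apply: le_trans (ler_norm_sum _ _ _) _; rewrite sum3E.
  have u l' : `|k i l' * A l' l| <= `|A|.
    rewrite mulrC; apply: le_trans (b2 _ _ _) _; first exact: SO3_entry_le1.
    exact: mx_entry_norm.
  by have := u 0; have := u 1; have := u i2; lra.
by have := t 0; have := t 1; have := t i2; lra.
Qed.

Lemma tangent_norm g X (e : R) : tangent g X -> 0 < e ->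
  \forall t \near (0 : R)^', `|g t - 1%:M - t *: X| <= e * `|t|.
Proof.
move=> [g0 dg] e0.
have h (ij : 'I_3 * 'I_3) : \forall t \near (0 : R)^',
    `|X ij.1 ij.2 - t^-1 * (g t ij.1 ij.2 - (1%:M : M3) ij.1 ij.2)| <= e.
  have [dv eq] := dg ij.1 ij.2.
  have cv : (fun t : R => t^-1 * (g t ij.1 ij.2 - (1%:M : M3) ij.1 ij.2)) @ 0^' --> X ij.1 ij.2.
    rewrite -eq (_ : (fun t => _) = fun t : R => t^-1 *: ((fun t => g t ij.1 ij.2) (t *: 1 + 0) -
      (fun t => g t ij.1 ij.2) 0)); first exact: dv.
    by apply/funext => t; rewrite /= addr0 g0 [t *: 1]mulr1.
  exact: (cvgrPdist_le _ _).1 cv e e0.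
near=> t.
have t0 : t != 0 by near: t; exact: nbhs_dnbhs_neq.
have ht : forall ij : 'I_3 * 'I_3,
    `|X ij.1 ij.2 - t^-1 * (g t ij.1 ij.2 - (1%:M : M3) ij.1 ij.2)| <= e.
  by near: t; exact: filter_forall.
apply: mx_norm_le; first by rewrite mulr_ge0 // ltW.
move=> i j; have := ht (i, j) => /= hij.
have -> : (g t - 1%:M - t *: X) i j = - t * (X i j - t^-1 * (g t i j - (1%:M : M3) i j)).
  by rewrite !mxE; field.
by rewrite normrM normrN mulrC ler_wpM2r.
Unshelve. all: by end_near. Qed.

(* Uniformity in [k] comes from Frechet differentiability at 1: the curves
   [k g(t) k^-1] leave 1 with velocity [k X k^-1], uniformly in [k]. *)
Lemma uniform_derivative (F : M3 -> R) g X (e : R) :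
  differentiable F (1%:M : M3) -> tangent g X -> 0 < e ->
  \forall t \near (0 : R)^', forall k, SO3 k ->
    `|t^-1 * (F (k *m g t *m k^T) - F 1%:M) - 'd F (1%:M : M3) (k *m X *m k^T)| <= e.
Proof.
move=> dF tg e0.
have [c c0 hc] := linear_lipschitz (diff_continuous dF).
(* Each of two errors must be at most (e / 2) |t|. [e1] controls the remainder of the differential,
   [e2] the deviation of the curve from its tangent, amplified by the Lipschitz constant [c]; the
   factor 9 of [norm_conj_SO3] enters both. The minimum with 1 gives |g t - 1| <= (|X| + 1) |t|. *)
pose e1 := e / (18 * (`|X| + 1)).
have e10 : 0 < e1 by rewrite divr_gt0 // mulr_gt0 // ltr_wpDl.
pose e2 := Num.min 1 (e / (18 * c)).
have e20 : 0 < e2 by rewrite lt_min ltr01 divr_gt0 // mulr_gt0.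
have /eqaddoP/(_ _ e10) := diff_locally dF.
move=> /nbhs_ballP[d /= d0 hd].
have d10 : 0 < d / (9 * (`|X| + 1)) by rewrite divr_gt0 // mulr_gt0 // ltr_wpDl.
near=> t.
have t0 : t != 0 by near: t; exact: nbhs_dnbhs_neq.
have tn : `|g t - 1%:M - t *: X| <= e2 * `|t| by near: t; exact: tangent_norm.
have td : `|t| < d / (9 * (`|X| + 1)) by near: t; exact: dnbhs0_lt.
move=> k kS.
pose B := k *m (g t - 1%:M) *m k^T.
have kk : k *m k^T = 1%:M by case: kS.
have BE : k *m g t *m k^T = B + 1%:M.
  by rewrite /B mulmxBr mulmxBl mulmx1 kk subrK.
have An : `|g t - 1%:M| <= (`|X| + 1) * `|t|.
  have -> : g t - 1%:M = (g t - 1%:M - t *: X) + t *: X by rewrite subrK.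
  apply: le_trans (ler_normD _ _) _.
  rewrite normrZ mulrDl mul1r addrC [`|t| * _]mulrC lerD2l.
  apply: le_trans tn _; rewrite -[leRHS]mul1r ler_wpM2r //.
  by rewrite ge_min lexx.
have Bn : `|B| <= 9 * (`|X| + 1) * `|t|.
  by apply: le_trans (norm_conj_SO3 _ kS) _; rewrite -mulrA ler_wpM2l.
have Bd : `|B| < d.
  by apply: le_lt_trans Bn _; rewrite mulrC -ltr_pdivlMr.
have := hd B; rewrite -ball_normE /= sub0r normrN => /(_ Bd) hB.
have {hB} h1 : `|F (B + 1%:M) - (F 1%:M + 'd F (1%:M : M3) B)| <= e1 * `|B| := hB.
have h2 : `|'d F (1%:M : M3) B - t * 'd F (1%:M : M3) (k *m X *m k^T)| <= c * (9 * (e2 * `|t|)).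
  have -> : t * 'd F (1%:M : M3) (k *m X *m k^T) = 'd F (1%:M : M3) (k *m (t *: X) *m k^T).
    by rewrite -scalemxAr -scalemxAl linearZ.
  rewrite -linearB /= /B -mulmxBl -mulmxBr.
  apply: le_trans (hc _) _; apply: ler_wpM2l; first exact: ltW.
  by apply: le_trans (norm_conj_SO3 _ kS) _; rewrite ler_wpM2l.
rewrite BE.
set D := 'd F (1%:M : M3) (k *m X *m k^T) in h2 *.
have -> : t^-1 * (F (B + 1%:M) - F 1%:M) - D = t^-1 *
   ((F (B + 1%:M) - (F 1%:M + 'd F (1%:M : M3) B)) + ('d F (1%:M : M3) B - t * D)).
  by field.
rewrite normrM normfV ler_pdivrMl ?normr_gt0 //.
apply: le_trans (ler_normD _ _) _.
have b1 : e1 * `|B| <= e / 2 * `|t|.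
  apply: (@le_trans _ _ (e1 * (9 * (`|X| + 1) * `|t|))); first by apply: ler_wpM2l => //; exact: ltW.
  by rewrite /e1 le_eqVlt; apply/orP; left; apply/eqP; field; rewrite gt_eqF // ltr_wpDl.
have b2 : c * (9 * (e2 * `|t|)) <= e / 2 * `|t|.
  apply: (@le_trans _ _ (c * (9 * (e / (18 * c) * `|t|)))).
    apply: ler_wpM2l; first exact: ltW.
    by apply: ler_wpM2l => //; apply: ler_wpM2r => //; rewrite ge_min lexx orbT.
  by rewrite le_eqVlt; apply/orP; left; apply/eqP; field; rewrite gt_eqF.
apply: le_trans (lerD (le_trans h1 b1) (le_trans h2 b2)) _.
by rewrite -mulrDl mulrC -splitr.
Unshelve. all: by end_near. Qed.

End Exponential.

(** * Differentials of complex-valued functions and of polynomial coefficients *)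

Section ComplexDifferential.
Context (R : realType).
Local Notation C := (R[i]).
Local Notation M3 := 'M[R]_3.

(** A real-valued submultiplicative norm on C, for epsilon estimates over [R]. *)
Definition n1 (z : C) : R := `|complex.Re z| + `|complex.Im z|.

Lemma n1_ge0 z : 0 <= n1 z. Proof. by rewrite addr_ge0. Qed.

Lemma n1D z w : n1 (z + w) <= n1 z + n1 w.
Proof. by rewrite /n1 ReD ImD addrACA lerD // ler_normD. Qed.

Lemma n1M z w : n1 (z * w) <= n1 z * n1 w.
Proof.
rewrite /n1 ReM ImM mulN1r.
case: z w => a b [c d] /=; rewrite mulrDl !mulrDr -!normrM.
have h1 := ler_normB (a * c) (b * d); have h2 := ler_normD (a * d) (b * c); lra.
Qed.

Lemma n1_sum (I : Type) (r : seq I) (f : I -> C) :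
  n1 (\sum_(i <- r) f i) <= \sum_(i <- r) n1 (f i).
Proof.
elim: r => [|i r IH]; first by rewrite !big_nil /n1 /= normr0 addr0.
by rewrite !big_cons; apply: le_trans (n1D _ _) _; rewrite lerD2l.
Qed.

Lemma n1_eq0 z : n1 z <= 0 -> z = 0.
Proof.
case: z => a b; rewrite /n1 /= => h.
have /eqP := le_anti (introT andP (conj h (addr_ge0 (normr_ge0 a) (normr_ge0 b)))).
by rewrite paddr_eq0 // !normr_eq0 => /andP[/eqP -> /eqP ->].
Qed.

(* The differential of [F] at 1, as a real-linear map. *)
Definition LF (F : M3 -> C) (V : M3) : C :=
  'd (fun x => complex.Re (F x)) (1%:M : M3) V +i*
  'd (fun x => complex.Im (F x)) (1%:M : M3) V.

Lemma iwU1 : iwU (1%:M : M3).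
Proof. by apply: SL3_iwU; rewrite /SL3 /= det1. Qed.

Lemma LF_lin F a V W : LF F (a *: V + W) = a%:C * LF F V + LF F W.
Proof.
rewrite /LF !linearP; apply/eqP; rewrite eq_complex; apply/andP; split; apply/eqP => /=;
by rewrite /= ?mul0r ?subr0 ?addr0.
Qed.

Lemma LFZ F a V : LF F (a *: V) = a%:C * LF F V.
Proof.
by have := LF_lin F a V 0; rewrite addr0 => ->; rewrite /LF !linear0 addr0.
Qed.

Lemma LFD F V W : LF F (V + W) = LF F V + LF F W.
Proof. by have := LF_lin F 1 V W; rewrite scale1r mul1r. Qed.

Lemma LF_sum F (I : Type) (r : seq I) (f : I -> M3) :
  LF F (\sum_(i <- r) f i) = \sum_(i <- r) LF F (f i).
Proof.
elim: r => [|i r IH]; first by rewrite !big_nil /LF !linear0.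
by rewrite !big_cons LFD IH.
Qed.

Lemma LF_entries F V : LF F V =
  \sum_(i < 3) \sum_(j < 3) (V i j)%:C * LF F (delta_mx i j).
Proof.
rewrite {1}[V]matrix_sum_delta LF_sum; apply: eq_bigr => i _.
by rewrite LF_sum; apply: eq_bigr => j _; rewrite LFZ.
Qed.

Lemma uniform_LF (F : M3 -> C) g X (e : R) :
  celem (@iwU R) F -> tangent g X -> 0 < e ->
  \forall t \near (0 : R)^', forall k, SO3 k ->
    n1 ((t^-1)%:C * (F (k *m g t *m k^T) - F 1%:M) - LF F (k *m X *m k^T)) <= e.
Proof.
move=> [e1 e2] tg e0; have e20 : 0 < e / 2 by rewrite divr_gt0.
have h1 := uniform_derivative (elem_differentiable e1 iwU1) tg e20.
have h2 := uniform_derivative (elem_differentiable e2 iwU1) tg e20.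
apply: filterS2 h1 h2 => t h1 h2 k kS; have k1 := h1 k kS; have k2 := h2 k kS.
rewrite [e]splitr /n1 /LF; move: k1 k2.
move: ('d _ _ _) ('d _ _ _) (F (k *m g t *m k^T)) (F 1%:M) => a b [c d] [c' d'] /= k1 k2.
by rewrite !mul0r subr0 addr0; exact: lerD.
Qed.

Definition cder (f : R -> C) (d : C) : Prop :=
  is_derive (0 : R) 1 (fun t => complex.Re (f t)) (complex.Re d) /\
  is_derive (0 : R) 1 (fun t => complex.Im (f t)) (complex.Im d).

Lemma is_derive_cvg (f : R -> R) (d : R) : is_derive (0 : R) 1 f d ->
  (fun t => t^-1 * (f t - f 0)) @ (0 : R)^' --> d.
Proof.
move=> [dv <-].
rewrite (_ : (fun t => _) = fun t : R => t^-1 *: (f (t *: 1 + 0) - f 0)); first exact: dv.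
by apply/funext => t; rewrite addr0 [t *: 1]mulr1.
Qed.

(** The chain rule along a curve differentiable at 0 only: [uniform_derivative] at k = 1 and
    uniqueness of limits. *)
Lemma curve_derivative (F : M3 -> R) g X (d : R) :
  differentiable F (1%:M : M3) -> tangent g X ->
  is_derive (0 : R) 1 (fun t => F (g t)) d -> 'd F (1%:M : M3) X = d.
Proof.
move=> dF tg /is_derive_cvg cd.
have g0 := tg.1; rewrite g0 in cd.
have S1 : SO3 (1%:M : M3) by split; rewrite ?trmx1 ?mulmx1 ?det1.
apply: (cvg_unique _ _ cd) => //.
apply/cvgrPdist_le => e e0; near=> t.
have : forall k, SO3 k -> `|t^-1 * (F (k *m g t *m k^T) - F 1%:M)
   - 'd F (1%:M : M3) (k *m X *m k^T)| <= e.
  by near: t; exact: uniform_derivative.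
by move=> /(_ _ S1); rewrite trmx1 !mulmx1 !mul1mx distrC.
Unshelve. all: by end_near. Qed.

Lemma LF_curve (F : M3 -> C) g X d : celem (@iwU R) F -> tangent g X ->
  cder (fun t => F (g t)) d -> LF F X = d.
Proof.
move=> [e1 e2] tg [c1 c2]; rewrite /LF.
rewrite (curve_derivative (elem_differentiable e1 iwU1) tg c1).
by rewrite (curve_derivative (elem_differentiable e2 iwU1) tg c2); case: d {c1 c2}.
Qed.

Lemma cder_cst c : cder (fun=> c) 0.
Proof. by split; exact: der_cst. Qed.

Lemma cder_add f g a b : cder f a -> cder g b -> cder (fun t => f t + g t) (a + b).
Proof.
move=> [f1 f2] [g1 g2]; split.
  by under eq_fun do rewrite ReD; rewrite ReD; exact: der_add.
by under eq_fun do rewrite ImD; rewrite ImD; exact: der_add.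
Qed.

Lemma is_derive_eq0 (f : R -> R) a b : is_derive (0 : R) 1 f a -> a = b ->
  is_derive (0 : R) 1 f b.
Proof. by move=> h <-. Qed.

Lemma cder_mul f g a b : cder f a -> cder g b ->
  cder (fun t => f t * g t) (f 0 * b + a * g 0).
Proof.
move=> [f1 f2] [g1 g2]; split.
  under eq_fun do rewrite ReM.
  apply: is_derive_eq0 (der_add (der_mul f1 g1) (der_mul (der_cst (-1)) (der_mul f2 g2))) _.
  by rewrite ReD !ReM; ring.
under eq_fun do rewrite ImM.
apply: is_derive_eq0 (der_add (der_mul f1 g2) (der_mul f2 g1)) _.
by rewrite ImD !ImM; ring.
Qed.

Lemma cder_sum (I : Type) (r : seq I) (f : I -> R -> C) (d : I -> C) :
  (forall i, cder (f i) (d i)) ->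
  cder (fun t => \sum_(i <- r) f i t) (\sum_(i <- r) d i).
Proof.
move=> fd; elim: r => [|i r IH].
  by under eq_fun do rewrite big_nil; rewrite big_nil; exact: cder_cst.
by under eq_fun do rewrite big_cons; rewrite big_cons; exact: cder_add.
Qed.

Lemma cder_complex (f g : R -> R) a b : is_derive (0 : R) 1 f a ->
  is_derive (0 : R) 1 g b -> cder (fun t => f t +i* g t) (a +i* b).
Proof. by split. Qed.

Lemma der_sin (d : R) : is_derive (0 : R) 1 (fun t => sin (t * d)) d.
Proof.
have h : is_derive (0 : R) 1 (fun t : R => t * d) d.
  have := der_mul (is_derive_id (0 : R) 1) (der_cst d).
  by rewrite mulr0 add0r mulr1.
have := @is_derive1_comp R sin (fun t : R => t * d) 0 _ _ (is_derive_sin _) h.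
by rewrite mul0r cos0 mul1r.
Qed.

Lemma der_cos (d : R) : is_derive (0 : R) 1 (fun t => cos (t * d)) 0.
Proof.
have h : is_derive (0 : R) 1 (fun t : R => t * d) d.
  have := der_mul (is_derive_id (0 : R) 1) (der_cst d).
  by rewrite mulr0 add0r mulr1.
have := @is_derive1_comp R cos (fun t : R => t * d) 0 _ _ (is_derive_cos _) h.
by rewrite mul0r sin0 oppr0 mul0r.
Qed.

Lemma cder_cexp (z : C) : cder (fun t => cexp (t%:C * z)) z.
Proof.
case: z => a b.
have h : cder (fun t : R => (expR (t * a) +i* 0) * (cos (t * b) +i* sin (t * b))) (a +i* b).
  have := cder_mul (cder_complex (der_expR a) (der_cst 0)) (cder_complex (der_cos b) (der_sin b)).
  rewrite !mul0r expR0 cos0 sin0.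
  rewrite (_ : _ + _ = a +i* b) //.
  by apply/eqP; rewrite eq_complex; apply/andP; split; apply/eqP => /=; ring.
rewrite (_ : (fun t : R => cexp _) = fun t : R =>
   (expR (t * a) +i* 0) * (cos (t * b) +i* sin (t * b))) //.
by apply/funext => t; rewrite /cexp /= !mul0r subr0 addr0.
Qed.

Definition pder (P : R -> {poly C}) (P' : {poly C}) : Prop :=
  forall j, cder (fun t => (P t)`_j) P'`_j.

Lemma pder_mul P Q P' Q' : pder P P' -> pder Q Q' ->
  pder (fun t => P t * Q t) (P 0 * Q' + P' * Q 0).
Proof.
move=> hP hQ j; rewrite coefD !coefM -big_split /=.
under eq_fun do rewrite coefM.
by apply: cder_sum => i; exact: cder_mul.
Qed.

Lemma pder_exp P P' n : pder P P' ->
  pder (fun t => P t ^+ n) (P 0 ^+ n.-1 * P' *+ n).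
Proof.
move=> hP; elim: n => [|n IH].
  by move=> j; rewrite mulr0n coef0; under eq_fun do rewrite expr0; exact: cder_cst.
under eq_fun do rewrite exprS.
have := pder_mul hP IH; congr pder.
case: n {IH} => [|n]; first by rewrite !mulr0n mulr0 add0r expr0 mulr1 mul1r mulr1n.
rewrite [n.+2.-1]/= mulrnAr mulrA -exprS [P' * _]mulrC.
by rewrite [in RHS]mulrSr.
Qed.

Definition pelem (P : M3 -> {poly C}) : Prop := forall j, celem setT (fun x => (P x)`_j).

Lemma pelem_mul P Q : pelem P -> pelem Q -> pelem (fun x => P x * Q x).
Proof.
move=> hP hQ j; under eq_fun do rewrite coefM.
by apply: celem_sum => i; exact: celem_mul.
Qed.

Lemma pelem_exp P n : pelem P -> pelem (fun x => P x ^+ n).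
Proof.
move=> hP; elim: n => [|n IH].
  by move=> j; under eq_fun do rewrite expr0; exact: celem_cst.
by under eq_fun do rewrite exprS; exact: pelem_mul.
Qed.

Lemma quad_coef (a b c : C) j : (a *: 'X^2 + b *: 'X + c%:P)`_j =
  a * (j == 2)%N%:R + b * (j == 1)%N%:R + c * (j == 0)%N%:R.
Proof.
rewrite !coefD !coefZ coefXn coefX coefC.
by congr (_ + _); case: (j == 0)%N; rewrite ?mulr1 ?mulr0.
Qed.

Lemma pelem_quad a b c : celem setT a -> celem setT b -> celem setT c ->
  pelem (fun x => a x *: 'X^2 + b x *: 'X + (c x)%:P).
Proof.
move=> ha hb hc j; under eq_fun do rewrite quad_coef.
by apply: celem_add; [apply: celem_add|]; apply: celem_mul => //; exact: celem_cst.
Qed.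

Lemma celem_phi : [/\ celem setT (@phi_aa R), celem setT (@phi_bb R),
  celem setT (@phi_ab R), celem setT (@phi_cb R) &
  celem setT (fun x : M3 => (x 0 0)%:C)].
Proof.
have ec i j : elem setT (fun x : M3 => x i j) by exact: elem_coord.
have h1 f g : elem setT f -> elem setT g -> elem setT (fun x : M3 => (f x + g x) / 2).
  by move=> ef eg; apply: elem_mul; [exact: elem_add|exact: elem_cst].
have h2 f : elem setT f -> elem setT (fun x : M3 => - f x).
  move=> ef; under eq_fun do rewrite -mulN1r.
  by apply: elem_mul => //; exact: elem_cst.
have h3 f : elem setT f -> elem setT (fun x : M3 => f x / 2).
  by move=> ef; apply: elem_mul => //; exact: elem_cst.
split; apply: celem_complex; rewrite ?/GRing.opp; first [exact: h1|exact: h3|idtac].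
all: try by apply: h1 => //; exact: h2.
all: try by apply: h3; exact: h2.
exact: elem_coord.
exact: elem_cst.
Qed.

Lemma celem_TK l j q : celem setT (fun x : M3 => TK l x j q).
Proof.
have [aa bb ab cb x00] := celem_phi.
under eq_fun do rewrite mxE.
have hm c f : celem setT f -> celem setT (fun x : M3 => c * f x).
  by move=> cf; apply: celem_mul => //; exact: celem_cst.
apply: pelem_mul; first apply: pelem_mul; apply: pelem_exp; apply: pelem_quad => //.
- exact: celem_conj.
- exact: hm.
- exact: celem_conj.
- under eq_fun do rewrite -mulN1r; exact: hm.
- exact: celem_conj.
- by apply: hm; exact: celem_conj.
Qed.

End ComplexDifferential.

(** * The sections attached to a functional, and their derivatives in H *)

Section Differentiation.
Context (R : realType).
Local Notation C := (R[i]).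
Local Notation M3 := 'M[R]_3.
Local Notation TM := (g_sigma_algebraType (@open M3)).

(** By [tauK_unitary] for a basis row, the squares in row j, weighted by binomials, add up to C(2l,
    j), and every weight is at least 1. *)
Lemma TK_bounded l : exists2 B : R, 0 < B &
  forall (k : M3) j q, SO3 k -> n1 (TK l k j q) <= B.
Proof.
pose B : R := \sum_(j < (2 * l).+1) 'C(2 * l, j)%:R.
have binge (j : 'I_(2 * l).+1) : (1 : R) <= 'C(2 * l, j)%:R.
  by rewrite ler1n bin_gt0 -ltnS.
have binB (j : 'I_(2 * l).+1) : 'C(2 * l, j)%:R <= B.
  rewrite /B (bigD1 j) //= ler_wpDr // sumr_ge0 // => i _; exact: ler0n.
have B1 : 1 <= B by apply: le_trans (binge ord0) (binB ord0).
have B0 : 0 < B by apply: lt_le_trans B1.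
exists (2 * B) => [|k j q kS]; first exact: mulr_gt0.
have := tauK_unitary (delta_mx 0 j : 'rV[C]_((2 * l).+1)) kS.
rewrite -rowE tauK_TK //; move: (TK l k) => T.
pose s (z : C) : R := complex.Re z ^+ 2 + complex.Im z ^+ 2.
have sE z : z * conjc z = (s z)%:C.
  case: z => a b; apply/eqP; rewrite eq_complex; apply/andP; split; apply/eqP;
  by rewrite /s /=; ring.
have s0 z : 0 <= s z by rewrite addr_ge0 ?sqr_ge0.
have binR (i : nat) : 'C(2 * l, i)%:R = ('C(2 * l, i)%:R : R)%:C by rewrite rmorph_nat.
under eq_bigr do rewrite mxE sE binR -rmorphM /=.
rewrite [X in _ = X -> _](_ : _ = ('C(2 * l, j)%:R : R)%:C); last first.
  rewrite (bigD1 j) //= big1 ?addr0 => [|i /negPf ij]; last first.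
    by rewrite !mxE eqxx ij mul0r mulr0.
  by rewrite !mxE !eqxx conjc1 !mulr1 binR.
rewrite -rmorph_sum /= => /complexI h.
have sB : s (T j q) <= B.
  apply: le_trans (binB j); rewrite -h (bigD1 q) //= ler_wpDr //.
    by apply: sumr_ge0 => i _; rewrite mulr_ge0.
  by rewrite ler_peMl.
have sB2 : s (T j q) <= B ^+ 2 by apply: le_trans sB _; rewrite expr2 ler_peMr // ltW.
have h1 (x : R) : x ^+ 2 <= s (T j q) -> `|x| <= B.
  move=> xs; rewrite leNgt; apply/negP => Bx; have := le_trans xs sB2.
  by rewrite -(real_normK (num_real x)) => h'; nra.
rewrite /n1 mulr_natl mulr2n; apply: lerD; apply: h1; rewrite /s.
  by rewrite ler_wpDr ?sqr_ge0.
by rewrite ler_wpDl ?sqr_ge0.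
Qed.

Lemma M0_SO3 (m : M3) : M0 m -> SO3 m.
Proof.
move=> /M0_sq[e1 [e2 [s1 s2 ->]]]; have s3 : (e1 * e2) * (e1 * e2) = 1.
  by rewrite mulrACA s1 s2 mulr1.
split.
  by apply: mx3P; split; rewrite !mxE sum3E !mxE /=; rewrite ?mulr1n ?mulr0n; lra.
by rewrite det3E !mxE /= ?mulr1n ?mulr0n; lra.
Qed.

Lemma TKM l (x y : M3) : SO3 x -> SO3 y -> TK l (x *m y) = TK l x *m TK l y.
Proof.
by move=> xS yS; rewrite -!tauK_TK // ?tauKM //; exact: SO3M.
Qed.

Context (nu : C * C) (sigma : 'I_2 * 'I_2) (l : nat) (lam : 'rV[C]_((2 * l).+1)).
Context (lam_M0 : forall m : M3, M0 m -> lam *m TK l m = chiM sigma m *: lam).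

Let mu : C * C := (nu.1 + (rho0 R).1, nu.2 + (rho0 R).2).

(** Under [lam_M0] these are the images of the v_q under a K-homomorphism; [lam] is recovered from
    their values at 1 ([Phi_1]). *)
Definition Phi (q : 'I_(2 * l).+1) : M3 -> C :=
  Ext mu (fun k => (lam *m TK l k) 0 q).

Lemma celem_lamTK q : celem setT (fun k : M3 => (lam *m TK l k) 0 q).
Proof.
under eq_fun do rewrite mxE; apply: celem_sum => j.
by apply: celem_mul; [exact: celem_cst|exact: celem_TK].
Qed.

Lemma elem_section_Phi q : elem_section nu sigma (Phi q).
Proof.
apply: elem_section_Ext; first exact: celem_lamTK.
move=> m k mM kS; rewrite TKM //; last exact: M0_SO3.
by rewrite mulmxA lam_M0 // -scalemxAl mxE.
Qed.

Lemma Phi_celem q : celem (@iwU R) (Phi q).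
Proof. by apply: celem_Ext; exact: celem_lamTK. Qed.

(** Applied to k g k^-1, it writes Phi_q(k g) as a combination of the Phi_j(k g k^-1), which carries
    differentiation at k back to the identity. *)
Lemma Phi_mulr q (g k : M3) : iwU g -> SO3 k ->
  Phi q (g *m k) = \sum_j TK l k j q * Phi j g.
Proof.
move=> gU kS; rewrite /Phi Ext_mulSO3 // TKM //; last exact: kap_SO3.
rewrite mulmxA mxE big_distrr /=; apply: eq_bigr => j _.
by rewrite /Ext; ring.
Qed.

(** The derivative of [Phi q] at [k] along [X], carried back to the identity. *)
Definition Psi (X : M3) q (k : M3) : C :=
  \sum_j TK l k j q * LF (Phi j) (k *m X *m k^T).

Lemma celem_Psi X q : celem setT (Psi X q).
Proof.
apply: celem_sum => j; apply: celem_mul; first exact: celem_TK.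
under eq_fun do rewrite LF_entries.
apply: celem_sum => a; apply: celem_sum => b; apply: celem_mul; last exact: celem_cst.
apply: celem_real; under eq_fun do rewrite mxE.
apply: elem_sum => c; under eq_fun do rewrite [X in _ * X]mxE.
apply: elem_mul; last exact: elem_coord.
under eq_fun do rewrite mxE; apply: elem_sum => d.
by apply: elem_mul; [exact: elem_coord|exact: elem_cst].
Qed.

Lemma SO3_1 : SO3 (1%:M : M3).
Proof. by split; rewrite ?trmx1 ?mulmx1 ?det1. Qed.

Lemma uniform_Psi X (g : R -> M3) q (e : R) : tangent g X ->
  (forall t, SL3 (g t)) -> 0 < e ->
  \forall t \near (0 : R)^', forall k, SO3 k ->
    n1 ((t^-1)%:C * (Phi q (k *m g t) - Phi q k) - Psi X q k) <= e.
Proof.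
move=> tg gS e0; have [B B0 hB] := TK_bounded l.
pose N : R := (2 * l).+1%:R; have N0 : 0 < N by rewrite ltr0n.
have e10 : 0 < e / (N * B) by rewrite divr_gt0 // mulr_gt0.
have h (j : 'I_(2 * l).+1) := uniform_LF (Phi_celem j) tg e10.
have hh : \forall t \near (0 : R)^', forall (j : 'I_(2 * l).+1) (k : M3), SO3 k ->
    n1 ((t^-1)%:C * (Phi j (k *m g t *m k^T) - Phi j 1%:M) - LF (Phi j) (k *m X *m k^T))
    <= e / (N * B) by exact: filter_forall.
apply: filterS hh => t {}h k kS.
have kk : k^T *m k = 1%:M by apply: mulmx1C; case: kS.
have gU : iwU (k *m g t *m k^T).
  apply: SL3_iwU; apply: SL3M; last exact: SO3_SL3 (SO3T kS).
  by apply: SL3M => //; exact: SO3_SL3.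
have := Phi_mulr q gU kS; rewrite -[k *m g t *m k^T *m k]mulmxA kk mulmx1 => ->.
have := Phi_mulr q (iwU1 R) kS; rewrite mul1mx => ->.
rewrite /Psi -sumrB big_distrr -sumrB /=.
apply: le_trans (n1_sum _ _) _.
apply: (@le_trans _ _ (\sum_(j < (2 * l).+1) (B * (e / (N * B))))); last first.
  rewrite sumr_const card_ord -mulr_natl le_eqVlt; apply/orP; left; apply/eqP.
  by rewrite -/N; field; rewrite !gt_eqF.
apply: ler_sum => j _.
have E (a b c d x : C) : d * (a * b - a * c) - a * x = a * (d * (b - c) - x) by ring.
rewrite E.
apply: le_trans (n1M _ _) _; apply: ler_pM; rewrite ?n1_ge0 //; first exact: hB.
exact: h.
Qed.

(** A limit of M0-covariant difference quotients. *)
Lemma Psi_M0 X (g : R -> M3) q : tangent g X -> (forall t, SL3 (g t)) ->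
  forall m k, M0 m -> SO3 k -> Psi X q (m *m k) = chiM sigma m * Psi X q k.
Proof.
move=> tg gS m k mM kS; have mS := M0_SO3 mM.
apply/eqP; rewrite -subr_eq0; apply/eqP; apply: n1_eq0.
apply/ler_addgt0Pr => e e0; rewrite add0r.
pose c := n1 (chiM sigma m).
have e1 : 0 < e / (1 + c) by rewrite divr_gt0 // ltr_wpDr ?n1_ge0.
have [t ht] := filter_ex (uniform_Psi q tg gS e1).
have h1 := ht _ (SO3M mS kS); have h2 := ht _ kS.
have cov y : SL3 y -> Phi q (m *m y) = chiM sigma m * Phi q y.
  have N1 : N0 (1%:M : M3).
    by split=> [i j ij|i]; rewrite mxE ?eqxx // -val_eqE /= gtn_eqF.
  have A1 : A0 (1%:M : M3).
    exists 1, 1, 1; rewrite !mulr1 !ltr01; split=> //.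
    by apply: mx3P; split; rewrite !mxE.
  move=> yS; have := (elem_section_Phi q).2 _ _ _ _ N1 A1 mM yS.
  by rewrite !mul1mx /eA !mxE /= !cpowE ln1 !mulr0 cexp0 !mul1r.
have := h1; rewrite -mulmxA !cov; last 2 first.
- exact: SO3_SL3.
- by apply: SL3M => //; exact: SO3_SL3.
move=> {}h1.
set D := (t^-1)%:C * (Phi q (k *m g t) - Phi q k) in h2.
have E (x y a b z d : C) : x - z * y =
   -1 * (d * (z * a - z * b) - x) + z * (d * (a - b) - y) by ring.
rewrite (E _ _ (Phi q (k *m g t)) (Phi q k) _ (t^-1)%:C) -/D.
apply: le_trans (n1D _ _) _.
have m1 : n1 (-1 : C) = 1 by rewrite /n1 /= oppr0 normrN normr1 normr0 addr0.
apply: (@le_trans _ _ (1 * (e / (1 + c)) + c * (e / (1 + c)))).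
  apply: lerD; apply: le_trans (n1M _ _) _; rewrite ?m1.
    by rewrite !mul1r.
  by rewrite ler_wpM2l ?n1_ge0.
by rewrite -mulrDl mulrC divfK // gt_eqF // ltr_wpDr ?n1_ge0.
Qed.

Context (dk : probability TM R) (Hdk : is_haar_SO3 dk) (H : completeNormedModType C).
Context (emb : (M3 -> C) -> H) (act : M3 -> H -> H).
Context (Hact : is_principal_series nu sigma dk emb act).

(** The difference quotients converge uniformly on K by [uniform_Psi], hence in H by [emb_norm_le]:
    the limit in [dpi] exists and is the section with restriction [Psi]. *)
Lemma dpi_Phi X Q d0 d1 d2 q : diagonalized X Q d0 d1 d2 ->
  elem_section nu sigma (Ext mu (Psi X q)) /\
  dpi act X (emb (Phi q)) = emb (Ext mu (Psi X q)).
Proof.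
move=> dX; have [QQ d _] := dX.
have tg := diag_curve_tangent dX.
have gS t : SL3 (diag_curve Q d0 d1 d2 t) by exact: diag_curve_SL3.
have sPsi : elem_section nu sigma (Ext mu (Psi X q)).
  by apply: elem_section_Ext; [exact: celem_Psi|exact: (Psi_M0 _ tg gS)].
split=> //; apply: cvg_lim => //.
apply/cvgrPdist_le => e e0.
have eR : e = (complex.Re e)%:C.
  by move: e0; case: (e) => a b; rewrite ltcE /= => /andP[/eqP -> _].
have e0' : 0 < complex.Re e by move: e0; rewrite eR ltcR.
have := uniform_Psi q tg gS e0'.
apply: filterS => t ht.
rewrite (expmx_diagonalized t dX).
rewrite (act_emb Hact (gS t) (elem_section_smooth (elem_section_Phi q))).
set g := diag_curve _ _ _ _ _.
have s1 : elem_section nu sigma (fun x => Phi q (x *m g)).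
  exact: (elem_section_translate (gS t) (elem_section_Phi q)).
have s2 := elem_section_Phi q.
have s3 := elem_section_lin ((t^-1)%:C) s2 sPsi.
have s4 := elem_section_lin (- (t^-1)%:C) s1 s3.
have bound := emb_norm_le Hdk Hact s4 (ltW e0').
have := emb_linear Hact (- (t^-1)%:C) (elem_section_smooth s1) (elem_section_smooth s3).
rewrite (emb_linear Hact (t^-1)%:C (elem_section_smooth s2) (elem_section_smooth sPsi)) => embE.
rewrite [X in _ <= X]eR.
have E (a : C) (x y z : H) : z - a *: (x - y) = - a *: x + (a *: y + z).
  by rewrite scalerBr opprB scaleNr addrC -addrA addrC -addrA [z + _]addrC.
rewrite E -embE; apply: bound => k kS {embE E}.
have -> : sqnorm (fun x => - (t^-1)%:C * Phi q (x *m g) + ((t^-1)%:C * Phi q x + Ext mu (Psi X q) x)) k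
  = sqnorm (fun=> (t^-1)%:C * (Phi q (k *m g) - Phi q k) - Psi X q k) k.
  rewrite /sqnorm Ext_SO3 //.
  have E (a b c z : C) : - a * b + (a * c + z) = - (a * (b - c) - z) by ring.
  rewrite E.
  by case: (_ - _) => a b; rewrite /= !sqrrN.
have := ht _ kS; rewrite -/g /sqnorm.
case: (_ - _) => a b; rewrite /n1 /= => ab.
apply: (@le_trans _ _ ((`|a| + `|b|) ^+ 2)).
  rewrite -(real_normK (num_real a)) -(real_normK (num_real b)) sqrrD.
  by rewrite addrAC lerDl mulrn_wge0 // mulr_ge0.
have := addr_ge0 (normr_ge0 a) (normr_ge0 b); nra.
Qed.

End Differentiation.

(** * The action of so(3) on V_2l *)

Section LieDerivatives.
Context (R : realType).
Local Notation C := (R[i]).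
Local Notation M3 := 'M[R]_3.

Definition kap12 : M3 := mx_of_seq 3 [:: [:: 0; 1; 0]; [:: -1; 0; 0]; [:: 0; 0; 0]].
Definition kap13 : M3 := mx_of_seq 3 [:: [:: 0; 0; 1]; [:: 0; 0; 0]; [:: -1; 0; 0]].
Definition kap23 : M3 := mx_of_seq 3 [:: [:: 0; 0; 0]; [:: 0; 0; 1]; [:: 0; -1; 0]].

Definition rot12 (t : R) : M3 :=
  mx_of_seq 3 [:: [:: cos t; sin t; 0]; [:: - sin t; cos t; 0]; [:: 0; 0; 1]].
Definition rot13 (t : R) : M3 :=
  mx_of_seq 3 [:: [:: cos t; 0; sin t]; [:: 0; 1; 0]; [:: - sin t; 0; cos t]].
Definition rot23 (t : R) : M3 :=
  mx_of_seq 3 [:: [:: 1; 0; 0]; [:: 0; cos t; sin t]; [:: 0; - sin t; cos t]].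

Lemma der_cos1 : is_derive (0 : R) 1 cos 0.
Proof. by have := der_cos (1 : R); under eq_fun do rewrite mulr1. Qed.

Lemma der_sin1 : is_derive (0 : R) 1 sin 1.
Proof. by have := der_sin (1 : R); under eq_fun do rewrite mulr1. Qed.

Lemma der_opp (f : R -> R) a : is_derive (0 : R) 1 f a ->
  is_derive (0 : R) 1 (fun t => - f t) (- a).
Proof.
move=> fa; under eq_fun do rewrite -mulN1r.
by apply: is_derive_eq0 (der_mul (der_cst (-1)) fa) _; rewrite mulr0 addr0 mulN1r.
Qed.

Lemma rot_tangent : [/\ tangent rot12 kap12, tangent rot13 kap13 & tangent rot23 kap23].
Proof.
have c1 := der_cos1; have s1 := der_sin1; have o1 := der_opp s1.
have z (x : R) := der_cst x.
split; split.
1,3,5: by apply: mx3P; split; rewrite !mxE /= ?sin0 ?cos0 ?oppr0.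
all: move=> i j; under eq_fun do rewrite mx_of_seqE; rewrite mx_of_seqE.
all: by case: (ord3E i) => ->; case: (ord3E j) => -> /=.
Qed.

Lemma rot_SO3 t : [/\ SO3 (rot12 t), SO3 (rot13 t) & SO3 (rot23 t)].
Proof.
have cs : cos t * cos t + sin t * sin t = 1 by rewrite -!expr2 cos2Dsin2.
by split; split; rewrite ?det3E; try apply: mx3P; try split;
  rewrite !mxE ?sum3E ?mxE /= ?mxE /=; lra.
Qed.

Lemma TK1 l : TK l (1%:M : M3) = 1%:M.
Proof.
have d1 : (1%:M : M3) = diag3 1 1 (1 * 1).
  by apply: mx3P; split; rewrite !mxE /= ?mulr1.
apply/matrixP => j k; rewrite {1}d1 TK_diag ?inE ?eqxx //.
by rewrite expr1n mul1r !mxE.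
Qed.

Lemma tk_1 : [/\ tk_hi (1%:M : M3) = 'X^2, tk_mid (1%:M : M3) = 'X & tk_lo (1%:M : M3) = 1].
Proof.
have aa : phi_aa (1%:M : M3) = 1.
  by rewrite /phi_aa !mxE /=; apply/eqP; rewrite eq_complex /=; apply/andP; split; apply/eqP; lra.
have bb : phi_bb (1%:M : M3) = 0.
  by rewrite /phi_bb !mxE /=; apply/eqP; rewrite eq_complex /=; apply/andP; split; apply/eqP; lra.
have ab : phi_ab (1%:M : M3) = 0.
  by rewrite /phi_ab !mxE /=; apply/eqP; rewrite eq_complex /=; apply/andP; split; apply/eqP; lra.
have cb : phi_cb (1%:M : M3) = 0.
  by rewrite /phi_cb !mxE /=; apply/eqP; rewrite eq_complex /=; apply/andP; split; apply/eqP; lra.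
have d1 : (1%:M : M3) 0 0 = 1 by rewrite mxE.
rewrite /tk_hi /tk_mid /tk_lo aa bb ab cb d1 !conjc0 !conjc1.
by rewrite !(mulr0, scale0r, oppr0, polyC0, addr0, add0r) !scale1r.
Qed.

(** The three quadratic factors are linear in the entries of the matrix, so their derivative along a
    curve is their value at the tangent vector. *)
Lemma pder_tk (g : R -> M3) X : tangent g X ->
  [/\ pder (fun t => tk_hi (g t)) (tk_hi X), pder (fun t => tk_mid (g t)) (tk_mid X) &
      pder (fun t => tk_lo (g t)) (tk_lo X)].
Proof.
move=> [_ tg].
have lin2 (i j k m : 'I_3) (u v : R) :
    is_derive (0 : R) 1 (fun t => u * g t i j + v * g t k m) (u * X i j + v * X k m).
  by apply: is_derive_eq0 (der_add (der_mul (der_cst _) (tg _ _)) (der_mul (der_cst _) (tg _ _))) _;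
    rewrite !mulr0 !addr0.
have cj (f : R -> C) (z : C) : cder f z -> cder (fun t => conjc (f t)) (conjc z).
  move=> [f1 f2]; split.
    have -> : (fun t => complex.Re (conjc (f t))) = (fun t => complex.Re (f t)).
      by apply/funext => t; case: (f t).
    by case: z f1 {f2}.
  have -> : (fun t => complex.Im (conjc (f t))) = (fun t => - complex.Im (f t)).
    by apply/funext => t; case: (f t).
  by case: z f2 {f1} => u v f2; exact: (der_opp f2).
have cm (k : C) (f : R -> C) (z : C) : cder f z -> cder (fun t => k * f t) (k * z).
  by move=> fz; have := cder_mul (cder_cst k) fz; rewrite mul0r addr0.
have cq (f h k : R -> C) (u v w : C) : cder f u -> cder h v -> cder k w ->
    pder (fun t => f t *: 'X^2 + h t *: 'X + (k t)%:P) (u *: 'X^2 + v *: 'X + w%:P).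
  move=> fu gv hw j; rewrite quad_coef; under eq_fun do rewrite quad_coef.
  have cz (f' : R -> C) z x : cder f' z -> cder (fun t => f' t * x) (z * x).
    by move=> fz; have := cder_mul fz (cder_cst x); rewrite mulr0 add0r.
  by apply: cder_add; [apply: cder_add|]; apply: cz.
have l2 (f : M3 -> R) i j k m u v : (forall x, f x = u * x i j + v * x k m) ->
    is_derive (0 : R) 1 (fun t => f (g t)) (f X).
  by move=> fE; rewrite fE; under eq_fun do rewrite fE; exact: lin2.
have haa : cder (fun t => phi_aa (g t)) (phi_aa X).
  apply: cder_complex.
    by apply: (l2 (fun x => (x 1 1 + x i2 i2) / 2) 1 1 i2 i2 2^-1 2^-1) => x; field.
  by apply: (l2 (fun x => (x i2 1 - x 1 i2) / 2) i2 1 1 i2 2^-1 (- 2^-1)) => x; field.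
have hbb : cder (fun t => phi_bb (g t)) (phi_bb X).
  apply: cder_complex.
    by apply: (l2 (fun x => (x 1 1 - x i2 i2) / 2) 1 1 i2 i2 2^-1 (- 2^-1)) => x; field.
  by apply: (l2 (fun x => (x i2 1 + x 1 i2) / 2) i2 1 1 i2 2^-1 2^-1) => x; field.
have hab : cder (fun t => phi_ab (g t)) (phi_ab X).
  apply: cder_complex.
    by apply: (l2 (fun x => - x i2 0 / 2) i2 0 0 0 (- 2^-1) 0) => x; field.
  by apply: (l2 (fun x => x 1 0 / 2) 1 0 0 0 2^-1 0) => x; field.
have hcb : cder (fun t => phi_cb (g t)) (phi_cb X).
  apply: cder_complex.
    by apply: (l2 (fun x => x 0 i2 / 2) 0 i2 0 0 2^-1 0) => x; field.
  by apply: (l2 (fun x => - x 0 1 / 2) 0 1 0 0 (- 2^-1) 0) => x; field.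
have h00 : cder (fun t => (g t 0 0)%:C) (X 0 0)%:C.
  by apply: cder_complex.
split; apply: cq.
- exact: (cj _ _ haa).
- exact: (cm _ _ _ hcb).
- exact: hbb.
- exact: (cj _ _ hab).
- exact: h00.
- rewrite -mulN1r (_ : (fun t => _) = fun t => -1 * phi_ab (g t)); first exact: (cm _ _ _ hab).
  by apply/funext => t; rewrite mulN1r.
- exact: (cj _ _ hbb).
- exact: (cm _ _ _ (cj _ _ hcb)).
- exact: haa.
Qed.

(** The Leibniz rule at the identity, where the three factors are ['X^2], ['X] and 1. *)
Lemma pder_TK l (q : 'I_(2 * l).+1) (rot : R -> M3) hi' mid' lo' :
  rot 0 = 1%:M ->
  pder (fun t => tk_hi (rot t)) hi' -> pder (fun t => tk_mid (rot t)) mid' ->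
  pder (fun t => tk_lo (rot t)) lo' ->
  forall j, cder (fun t => TK l (rot t) j q)
   ((('X^2) ^+ q./2 * 'X ^+ odd q * (lo' *+ (2 * l - q)./2) +
     (('X^2) ^+ q./2 * ((odd q)%:R * mid') + ('X^2) ^+ q./2.-1 * hi' *+ q./2 * 'X ^+ odd q)) : {poly C})`_j.
Proof.
move=> r0 h1 h2 h3 j; under eq_fun do rewrite mxE.
have := pder_mul (pder_mul (pder_exp q./2 h1) (pder_exp (odd q) h2)) (pder_exp (2 * l - q)./2 h3).
rewrite /= r0; have [-> -> ->] := tk_1.
move=> /(_ j); congr (cder _ (_`_ _)).
congr polyseq; rewrite !expr1n; move: (_ ^+ q./2) (_ ^+ q./2.-1) => A B.
by case: (odd q); rewrite ?mulr1n ?mulr0n ?expr0 ?expr1; ring.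
Qed.

Lemma half_parts l (q : 'I_(2 * l).+1) :
  (q = q./2.*2 + odd q :> nat)%N /\ (2 * l - q = (2 * l - q)./2.*2 + odd q)%N.
Proof.
have kk : (q <= 2 * l)%N by rewrite -ltnS.
have := odd_double_half q; have := odd_double_half (2 * l - q).
by rewrite oddB // oddM /= => h1 h2; split; lia.
Qed.

Lemma rot_poly (u v : C) (a c Q M : nat) (b : bool) :
  (Q = a.*2 + b)%N -> (M = c.*2 + b)%N ->
  ('X^2) ^+ a * 'X ^+ b * (((2 * v) *: 'X) *+ c) +
     (('X^2) ^+ a * (b%:R * (v *: 'X^2 + u%:P)) + ('X^2) ^+ a.-1 * ((2 * u) *: 'X) *+ a * 'X ^+ b)
  = (u * Q%:R) *: 'X^(Q.-1) + (v * M%:R) *: 'X^(Q.+1) :> {poly C}.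
Proof.
move=> -> ->.
have X2 n : ('X^2 : {poly C}) ^+ n = 'X^(n.*2) by rewrite -exprM mul2n.
rewrite -[(_ *: 'X) *+ c]mulr_natl -[_ * _ *+ a]mulr_natl.
rewrite !X2 -!mul_polyC !polyCM !polyC_natr.
have cD (n : nat) : (n.*2)%:R = 2 * n%:R :> {poly C} by rewrite -mul2n natrM.
case: b; case: a => [|a]; rewrite ?doubleS /= ?addn0 ?addn1 /= ?expr0 ?expr1;
  rewrite ?(natrD, cD, exprS) ?expr0 -?natr1 ?cD; ring.
Qed.

(* [h X], [k/2 X^2 + h/2], [k X] are the shapes of the derivatives of the three
   quadratic factors along rotations in the planes (1,2) and (1,3). *)
Lemma TK_rot_coef l (q : 'I_(2 * l).+1) (h k : C) j :
  ((('X^2) ^+ q./2 * 'X ^+ odd q * ((k *: 'X) *+ (2 * l - q)./2) +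
     (('X^2) ^+ q./2 * ((odd q)%:R * ((k / 2) *: 'X^2 + (h / 2)%:P))
      + ('X^2) ^+ q./2.-1 * (h *: 'X) *+ q./2 * 'X ^+ odd q)) : {poly C})`_j =
  (h / 2) * q%:R * (j.+1 == q :> nat)%N%:R
  + (k / 2) * (2 * l - q)%N%:R * (j == q.+1)%N%:R.
Proof.
have [e1 e2] := half_parts q.
have [u hu] : exists u, h = 2 * u by exists (h / 2); field.
have [v hv] : exists v, k = 2 * v by exists (k / 2); field.
have u2 : h / 2 = u by rewrite hu; field.
have v2 : k / 2 = v by rewrite hv; field.
rewrite u2 v2.
have X2 n : ('X^2 : {poly C}) ^+ n = 'X^(n.*2) by rewrite -exprM mul2n.
rewrite (_ : _ + _ = ((u * q%:R) *: 'X^(q.-1) + (v * (2 * l - q)%N%:R) *: 'X^(q.+1) : {poly C})).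
  rewrite coefD !coefZ !coefXn; congr (_ + _).
  case: (nat_of_ord q) => [|n]; first by rewrite !mulr0 !mul0r.
  by rewrite eqSS.
by rewrite hu hv; exact: rot_poly.
Qed.

Lemma pder_poly (P : R -> {poly C}) P' Q : pder P P' -> P' = Q -> pder P Q.
Proof. by move=> h <-. Qed.

Lemma cder_eq (f : R -> C) a b : cder f a -> a = b -> cder f b.
Proof. by move=> h <-. Qed.

Lemma cder_TK_rot l (q : 'I_(2 * l).+1) (rot : R -> M3) X (h k : C) j :
  tangent rot X ->
  tk_hi X = h *: 'X -> tk_mid X = (k / 2) *: 'X^2 + (h / 2)%:P -> tk_lo X = k *: 'X ->
  cder (fun t => TK l (rot t) j q)
    ((h / 2) * q%:R * (j.+1 == q :> nat)%N%:R
     + (k / 2) * (2 * l - q)%N%:R * (j == q.+1 :> nat)%N%:R).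
Proof.
move=> tg hE mE lE; have [h1 h2 h3] := pder_tk tg.
by have := pder_TK q tg.1 h1 h2 h3 j; rewrite hE mE lE TK_rot_coef.
Qed.

Lemma tk_kap12 : [/\ tk_hi kap12 = 'i%C *: 'X,
  tk_mid kap12 = ('i%C / 2) *: 'X^2 + ('i%C / 2)%:P & tk_lo kap12 = 'i%C *: 'X :> {poly C}].
Proof.
have aa : phi_aa kap12 = 0 by rewrite /phi_aa !mx_of_seqE /= subrr addr0 !mul0r.
have bb : phi_bb kap12 = 0 by rewrite /phi_bb !mx_of_seqE /= subr0 addr0 !mul0r.
have ab : phi_ab kap12 = - ('i%C / 2).
  by rewrite /phi_ab !mx_of_seqE /=; apply/eqP; rewrite eq_complex; apply/andP; split; apply/eqP => /=; field.
have cb : phi_cb kap12 = - ('i%C / 2).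
  by rewrite /phi_cb !mx_of_seqE /=; apply/eqP; rewrite eq_complex; apply/andP; split; apply/eqP => /=; field.
have x00 : kap12 0 0 = 0 by rewrite mx_of_seqE.
have cji : conjc (- ('i%C / 2)) = 'i%C / 2 :> C.
  by apply/eqP; rewrite eq_complex; apply/andP; split; apply/eqP => /=; field.
rewrite /tk_hi /tk_mid /tk_lo aa bb ab cb x00 cji conjc0 opprK !scale0r !polyC0 !addr0 !add0r.
by split=> //; congr (_ *: _); field.
Qed.

End LieDerivatives.

(** * Derivatives of the sections along so(3), A0 and N0 *)

Section LieTable.
Context (R : realType).
Local Notation C := (R[i]).
Local Notation M3 := 'M[R]_3.

Lemma tk_kap13 : [/\ tk_hi (kap13 R) = (-1) *: 'X,
  tk_mid (kap13 R) = (1 / 2) *: 'X^2 + (-1 / 2)%:P & tk_lo (kap13 R) = 1 *: 'X].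
Proof.
have aa : phi_aa (kap13 R) = 0 by rewrite /phi_aa !mx_of_seqE /= subrr addr0 !mul0r.
have bb : phi_bb (kap13 R) = 0 by rewrite /phi_bb !mx_of_seqE /= subr0 addr0 !mul0r.
have ab : phi_ab (kap13 R) = (2^-1 : R)%:C.
  by rewrite /phi_ab !mx_of_seqE /=; apply/eqP; rewrite eq_complex; apply/andP; split; apply/eqP => /=; field.
have cb : phi_cb (kap13 R) = (2^-1 : R)%:C.
  by rewrite /phi_cb !mx_of_seqE /=; apply/eqP; rewrite eq_complex; apply/andP; split; apply/eqP => /=; field.
have x00 : kap13 R 0 0 = 0 by rewrite mx_of_seqE.
have cji : conjc (2^-1 : R)%:C = 2^-1 :> C.
  by rewrite conjc_real fmorphV rmorph_nat.
have rr : (2^-1 : R)%:C = 2^-1 :> C by rewrite fmorphV rmorph_nat.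
rewrite /tk_hi /tk_mid /tk_lo aa bb ab cb x00 cji rr conjc0 !scale0r !polyC0 !addr0 !add0r.
by split; [congr (_ *: _); field | congr (_ *: _ + _%:P); field | congr (_ *: _); field].
Qed.

Lemma tk_kap23 : [/\ tk_hi (kap23 R) = 'i%C *: 'X^2, tk_mid (kap23 R) = 0 &
  tk_lo (kap23 R) = (- 'i%C)%:P].
Proof.
have aa : phi_aa (kap23 R) = - 'i%C.
  by rewrite /phi_aa !mx_of_seqE /=; apply/eqP; rewrite eq_complex; apply/andP; split; apply/eqP => /=; field.
have bb : phi_bb (kap23 R) = 0.
  by rewrite /phi_bb !mx_of_seqE /=; apply/eqP; rewrite eq_complex; apply/andP; split; apply/eqP => /=; field.
have ab : phi_ab (kap23 R) = 0 by rewrite /phi_ab !mx_of_seqE /= oppr0 !mul0r.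
have cb : phi_cb (kap23 R) = 0 by rewrite /phi_cb !mx_of_seqE /= oppr0 !mul0r.
have x00 : kap23 R 0 0 = 0 by rewrite mx_of_seqE.
have cji : conjc (- 'i%C) = 'i%C :> C.
  by apply/eqP; rewrite eq_complex; apply/andP; split; apply/eqP => /=; ring.
rewrite /tk_hi /tk_mid /tk_lo aa bb ab cb x00 cji conjc0 !mulr0 oppr0 !scale0r !polyC0 !addr0 ?add0r.
by split.
Qed.

(** Rotations in the plane (2,3) form the torus whose weight vectors are the v_q. *)
Lemma cder_TK_rot23 l (q : 'I_(2 * l).+1) j :
  cder (fun t : R => TK l (rot23 t) j q)
    ('i%C * (q%:R - l%:R) * (j == q :> nat)%N%:R : C).
Proof.
have [_ _ tg] := rot_tangent R.
have [h1 h2 h3] := pder_tk tg; have [hE mE lE] := tk_kap23.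
apply: cder_eq (pder_TK q tg.1 h1 h2 h3 j) _; rewrite hE mE lE.
have [e1 e2] := half_parts q.
have qe : (q%:R - l%:R : C) = (q./2)%:R - ((2 * l - q)./2)%:R.
  have : q%:R + ((2 * l - q)./2)%:R = (q./2)%:R + l%:R :> C.
    have : (q <= 2 * l)%N by rewrite -ltnS.
    by move=> h; rewrite -!natrD; congr (_%:R); lia.
  by move/(congr1 (fun x => x - l%:R - ((2 * l - q)./2)%:R)); rewrite addrK => <-; ring.
rewrite qe mulr0 mulr0 add0r.
rewrite (_ : _ + _ = ('i%C * ((q./2)%:R - ((2 * l - q)./2)%:R)) *: 'X^q).
  by rewrite coefZ coefXn.
move: ((2 * l - q)./2) qe e2 => c _ _.
have -> : 'X^q = 'X^(q./2.*2 + odd q) :> {poly C} by rewrite -e1.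
move: (q./2) (odd q) => a b {e1}.
have X2 n : ('X^2 : {poly C}) ^+ n = 'X^(n.*2) by rewrite -exprM mul2n.
rewrite -[_%:P *+ c]mulr_natl -[_ * _ *+ a]mulr_natl !X2 -!mul_polyC !polyCM polyCD !polyCN !polyC_natr.
rewrite exprD; case: a => [|a]; rewrite ?doubleS /= ?exprS ?expr0; ring.
Qed.

(** [lam] extended by 0 to all integers, so that shifts by one need no boundary cases. *)
Definition lamZ n (lam : 'rV[C]_n) (z : int) : C :=
  \sum_j lam 0 j * ((j : nat)%:Z == z)%:R.

Lemma lamZ_ord n (lam : 'rV[C]_n) (j : 'I_n) : lamZ lam (j : nat)%:Z = lam 0 j.
Proof.
rewrite /lamZ (bigD1 j) //= eqxx mulr1 big1 ?addr0 // => i /negPf ij.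
by rewrite eqz_nat (_ : (i == j :> nat) = false) ?mulr0.
Qed.

Context (nu : C * C) (sigma : 'I_2 * 'I_2) (l : nat) (lam : 'rV[C]_((2 * l).+1)).
Context (lam_M0 : forall m : M3, M0 m -> lam *m TK l m = chiM sigma m *: lam).

Let mu : C * C := (nu.1 + (rho0 R).1, nu.2 + (rho0 R).2).

Lemma LF_Phi_rot (q : 'I_(2 * l).+1) (rot : R -> M3) X (d : 'I_(2 * l).+1 -> C) :
  tangent rot X -> (forall t, SO3 (rot t)) ->
  (forall j, cder (fun t => TK l (rot t) j q) (d j)) ->
  LF (Phi nu lam q) X = \sum_j lam 0 j * d j.
Proof.
move=> tg rS hd; apply: LF_curve tg _; first exact: Phi_celem.
under eq_fun => t do rewrite /Phi Ext_SO3 // mxE.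
apply: cder_sum => j.
by apply: cder_eq (cder_mul (cder_cst _) (hd j)) _; rewrite mul0r addr0.
Qed.

Lemma lamZ_shift (q : 'I_(2 * l).+1) (x y : C) :
  \sum_j lam 0 j * (x * (j.+1 == q :> nat)%N%:R + y * (j == q.+1 :> nat)%N%:R) =
  x * lamZ lam ((q : nat)%:Z - 1) + y * lamZ lam ((q : nat)%:Z + 1).
Proof.
rewrite /lamZ !big_distrr -big_split /=; apply: eq_bigr => j _.
have -> : (j.+1 == q :> nat) = ((j : nat)%:Z == (q : nat)%:Z - 1) by lia.
have -> : (j == q.+1 :> nat) = ((j : nat)%:Z == (q : nat)%:Z + 1) by lia.
ring.
Qed.

Lemma LF_Phi_kap12 (q : 'I_(2 * l).+1) : LF (Phi nu lam q) (kap12 R) =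
  'i%C / 2 * q%:R * lamZ lam ((q : nat)%:Z - 1)
  + 'i%C / 2 * (2 * l - q)%N%:R * lamZ lam ((q : nat)%:Z + 1).
Proof.
have [tg _ _] := rot_tangent R; have [h m lo] := tk_kap12 R.
rewrite (LF_Phi_rot tg _ (fun j => cder_TK_rot q j tg h m lo)) ?lamZ_shift // => t.
by have [] := rot_SO3 t.
Qed.

Lemma LF_Phi_kap13 (q : 'I_(2 * l).+1) : LF (Phi nu lam q) (kap13 R) =
  -1 / 2 * q%:R * lamZ lam ((q : nat)%:Z - 1)
  + 1 / 2 * (2 * l - q)%N%:R * lamZ lam ((q : nat)%:Z + 1).
Proof.
have [_ tg _] := rot_tangent R; have [h m lo] := tk_kap13.
rewrite (LF_Phi_rot tg _ (fun j => cder_TK_rot q j tg h m lo)) ?lamZ_shift // => t.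
by have [] := rot_SO3 t.
Qed.

Lemma LF_Phi_kap23 (q : 'I_(2 * l).+1) : LF (Phi nu lam q) (kap23 R) =
  'i%C * (q%:R - l%:R) * lam 0 q.
Proof.
have [_ _ tg] := rot_tangent R.
rewrite (LF_Phi_rot tg _ (fun j => cder_TK_rot23 q j)); last by move=> t; have [] := rot_SO3 t.
rewrite (bigD1 q) //= eqxx mulr1 mulrC big1 ?addr0 // => i /negPf iq.
by rewrite (_ : (i == q :> nat) = false) ?mulr0.
Qed.

Lemma Phi_1 (q : 'I_(2 * l).+1) : Phi nu lam q 1%:M = lam 0 q.
Proof. by rewrite /Phi Ext_SO3 ?TK1 ?mulmx1 //; exact: SO3_1. Qed.

Lemma M0_1 : M0 (1%:M : M3).
Proof.
exists 1, 1; rewrite !inE !eqxx; split=> //.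
by apply: mx3P; split; rewrite !mxE /= ?mulr1.
Qed.

Lemma LF_Phi_diag (d0 d1 d2 : R) (q : 'I_(2 * l).+1) : d0 + d1 + d2 = 0 ->
  LF (Phi nu lam q) (diag3 d0 d1 d2) = (mu.1 * d0%:C + mu.2 * d1%:C) * lam 0 q.
Proof.
move=> d; have dX : diagonalized (diag3 d0 d1 d2) 1%:M d0 d1 d2.
  by split=> //; rewrite trmx1 ?mulmx1 ?mul1mx.
apply: LF_curve (diag_curve_tangent dX) _; first exact: Phi_celem.
have PhiE t : Phi nu lam q (diag_curve 1%:M d0 d1 d2 t) =
    cexp (t%:C * (mu.1 * d0%:C + mu.2 * d1%:C)) * lam 0 q.
  rewrite /diag_curve trmx1 mulmx1 mul1mx.
  have N1 : N0 (1%:M : M3).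
    by split=> [i j ij|i]; rewrite mxE ?eqxx // -val_eqE /= gtn_eqF.
  have A1 : A0 (diag3 (expR (t * d0)) (expR (t * d1)) (expR (t * d2))).
    exists (expR (t * d0)), (expR (t * d1)), (expR (t * d2)); split=> //; rewrite ?expR_gt0 //.
    by rewrite -!expRD -!mulrDr d mulr0 expR0.
  have S1 : SL3 (1%:M : M3) by rewrite /SL3 /= det1.
  have := (elem_section_smooth (elem_section_Phi nu lam_M0 q)).2 _ _ _ _ N1 A1 M0_1 S1.
  rewrite mul1mx !mulmx1 => ->; rewrite Phi_1 /eA !mxE /= !cpowE !expRK -cexpD.
  congr (_ * _).
  rewrite /chiM !mxE /= !expr1n !mulr1; congr cexp.
  by rewrite !rmorphM /=; ring.
under eq_fun do rewrite PhiE.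
apply: cder_eq (cder_mul (cder_cexp _) (cder_cst _)) _.
by rewrite mulr0 add0r.
Qed.

Lemma LF_Phi_upper (V : M3) (q : 'I_(2 * l).+1) :
  (forall i j : 'I_3, (j <= i)%N -> V i j = 0) -> LF (Phi nu lam q) V = 0.
Proof.
move=> V0.
have tg : tangent (fun t : R => 1%:M + t *: V) V.
  split; first by rewrite scale0r addr0.
  move=> i j.
  under eq_fun do rewrite !mxE.
  apply: is_derive_eq0 (der_add (der_cst _) (der_mul (is_derive_id (0 : R) 1) (der_cst (V i j)))) _.
  by rewrite mulr0 add0r mulr1 add0r.
apply: LF_curve tg _; first exact: Phi_celem.
have PhiE t : Phi nu lam q (1%:M + t *: V) = lam 0 q.
  have N1 : N0 (1%:M + t *: V).
    split=> [i j ij|i]; rewrite !mxE V0 ?mulr0 ?addr0 ?eqxx ?(ltnW ij) //.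
    by rewrite -val_eqE /= gtn_eqF.
  have A1 : A0 (1%:M : M3).
    exists 1, 1, 1; rewrite !mulr1 !ltr01; split=> //.
    by apply: mx3P; split; rewrite !mxE.
  have S1 : SL3 (1%:M : M3) by rewrite /SL3 /= det1.
  have := (elem_section_smooth (elem_section_Phi nu lam_M0 q)).2 _ _ _ _ N1 A1 M0_1 S1.
  rewrite !mulmx1 => ->; rewrite Phi_1 /eA !mxE /= !cpowE ln1 !mulr0 cexp0.
  by rewrite /chiM !mxE /= !expr1n !mul1r.
by under eq_fun do rewrite PhiE; exact: cder_cst.
Qed.

End LieTable.

(** * Real and imaginary parts of the X_i *)

Section SymmetricMatrices.
Context (R : realType).
Local Notation C := (R[i]).
Local Notation M3 := 'M[R]_3.
Local Notation cx := (map_mx (real_complex R)).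

Definition sym12 : M3 := mx_of_seq 3 [:: [:: 0; 1; 0]; [:: 1; 0; 0]; [:: 0; 0; 0]].
Definition sym13 : M3 := mx_of_seq 3 [:: [:: 0; 0; 1]; [:: 0; 0; 0]; [:: 1; 0; 0]].
Definition sym23 : M3 := mx_of_seq 3 [:: [:: 0; 0; 0]; [:: 0; 0; 1]; [:: 0; 1; 0]].

Definition diagonalizable_so (X : M3) : Prop :=
  exists Q d0 d1 d2, diagonalized X Q d0 d1 d2.

Lemma diagonalizable_scale c X : diagonalizable_so X -> diagonalizable_so (c *: X).
Proof.
move=> [Q [d0 [d1 [d2 [QQ d ->]]]]]; exists Q, (c * d0), (c * d1), (c * d2); split=> //.
  by rewrite -!mulrDr d mulr0.
rewrite scalemxAl scalemxAr; congr (_ *m _ *m _).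
by apply: mx3P; split; rewrite !mxE /= ?mulr1n ?mulr0n ?mulr0.
Qed.

Lemma diagonalizable_diag3 (d0 d1 d2 : R) : d0 + d1 + d2 = 0 ->
  diagonalizable_so (diag3 d0 d1 d2).
Proof.
by move=> d; exists 1%:M, d0, d1, d2; split=> //; rewrite trmx1 ?mulmx1 ?mul1mx.
Qed.

Lemma diagonalizable_sym :
  [/\ diagonalizable_so sym12, diagonalizable_so sym13 & diagonalizable_so sym23].
Proof.
(* [h] normalizes the eigenvectors (1, 1) and (1, -1). *)
have [h hh] : exists h : R, h * h = 2^-1.
  by exists (Num.sqrt 2^-1); rewrite -expr2 sqr_sqrtr // invr_ge0.
have hh2 : h * h + h * h = 1 by rewrite hh; lra.
split; [exists (mx_of_seq 3 [:: [:: h; h; 0]; [:: h; - h; 0]; [:: 0; 0; 1]]), 1, (-1), 0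
       |exists (mx_of_seq 3 [:: [:: h; 0; h]; [:: 0; 1; 0]; [:: h; 0; - h]]), 1, 0, (-1)
       |exists (mx_of_seq 3 [:: [:: 1; 0; 0]; [:: 0; h; h]; [:: 0; h; - h]]), 0, 1, (-1)];
(split; [|by lra|]); apply: mx3P; split;
by rewrite ?conj_diag_entry ?mxE ?sum3E ?mxE /= ?mxE /=; lra.
Qed.

(** The parts are written as multiples of matrices with an explicit eigenbasis, as [dpi_Phi]
    requires; [0 *: sym12] gives the zero imaginary part of X_2 the same shape. *)
Definition XpRe (i : 'I_5) : M3 :=
  nth 0 [:: diag3 0 1 (-1); (- 2^-1) *: sym13; (- 3^-1) *: diag3 2 (-1) (-1);
            2^-1 *: sym13; diag3 0 1 (-1)] i.
Definition XpIm (i : 'I_5) : M3 :=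
  nth 0 [:: (-1) *: sym23; (- 2^-1) *: sym12; 0 *: sym12; (- 2^-1) *: sym12; 1 *: sym23] i.

Lemma cx_mx_of_seq (n : nat) (s : seq (seq R)) :
  map_mx (real_complex R) (mx_of_seq n s) = mx_of_seq n (map (map (real_complex R)) s).
Proof.
apply/matrixP => i j; rewrite mxE !mx_of_seqE.
have [h|h] := ltnP i (size s); last first.
  by rewrite !(nth_default [::]) ?size_map // !nth_nil.
rewrite (nth_map [::]) //; have [h'|h'] := ltnP j (size (nth [::] s i)).
  by rewrite (nth_map 0).
have -> : (nth [::] s i)`_j = 0 by rewrite nth_default.
by rewrite nth_default ?size_map.
Qed.

Lemma Xp_ReIm i : Xp R i = cx (XpRe i) + 'i%C *: cx (XpIm i).
Proof.
have [e0 e1 e2 e3 e4] := XpE R.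
have r2 : (2^-1 : R)%:C = 2^-1 by rewrite fmorphV rmorph_nat.
have r3 : (3^-1 : R)%:C = 3^-1 by rewrite fmorphV rmorph_nat.
have n1 : (-1 : R)%:C = -1 by rewrite rmorphN rmorph1.
have diagE (a b c : R) : cx (diag3 a b c) = mx_of_seq 3 [:: [:: a%:C; 0; 0]; [:: 0; b%:C; 0]; [:: 0; 0; c%:C]].
  have -> : diag3 a b c = mx_of_seq 3 [:: [:: a; 0; 0]; [:: 0; b; 0]; [:: 0; 0; c]].
    by apply: mx3P; split; rewrite /diag3 !mxE.
  by rewrite cx_mx_of_seq.
have i5 : [\/ i = @Ordinal 5 0 isT, i = @Ordinal 5 1 isT | i = @Ordinal 5 2 isT] \/
   (i = @Ordinal 5 3 isT \/ i = @Ordinal 5 4 isT).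
  case: i => -[|[|[|[|[|//]]]]] h; [left; apply: Or31|left; apply: Or32|left; apply: Or33|right; left|right; right];
  exact/val_inj.
case: i5 => [[->|->|->]|[->|->]]; rewrite ?e0 ?e1 ?e2 ?e3 ?e4 /XpRe /XpIm [nth _ _ _]/= [nth _ _ (Ordinal _)]/=;
 rewrite ?map_mxZ ?diagE ?rmorphN /= ?r2 ?r3 ?cx_mx_of_seq ?scale_mx_of_seq /=.
all: apply: mx3P; split; rewrite [RHS]mxE !mx_of_seqE.
all: rewrite /= ?rmorph0 ?rmorph1 ?rmorph_nat; ring.
Qed.
End SymmetricMatrices.

(** * The action of the X_i on the sections *)

Section ComplexLieAction.
Context (R : realType).
Local Notation C := (R[i]).
Local Notation M3 := 'M[R]_3.
Local Notation TM := (g_sigma_algebraType (@open M3)).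
Local Notation cx := (map_mx (real_complex R)).

Lemma map_Re_cx (A B : M3) : map_mx (@complex.Re R) (cx A + 'i%C *: cx B) = A.
Proof. by apply/matrixP => i j; rewrite !mxE /=; ring. Qed.

Lemma map_Im_cx (A B : M3) : map_mx (@complex.Im R) (cx A + 'i%C *: cx B) = B.
Proof. by apply/matrixP => i j; rewrite !mxE /=; ring. Qed.

Lemma diagonalizable_Xp i : diagonalizable_so (XpRe R i) /\ diagonalizable_so (XpIm R i).
Proof.
have [s12 s13 s23] := diagonalizable_sym R.
have d1 : diagonalizable_so (diag3 (0 : R) 1 (-1)) by apply: diagonalizable_diag3; lra.
have d2 : diagonalizable_so (diag3 (2 : R) (-1) (-1)) by apply: diagonalizable_diag3; lra.
by case: i => -[|[|[|[|[|//]]]]] h; split; rewrite /XpRe /XpIm /=;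
  first [exact: d1|exact: diagonalizable_scale].
Qed.

(* The complex-linear extension of [LF F]. *)
Definition LC (F : M3 -> C) (Z : 'M[C]_3) : C :=
  \sum_a \sum_b Z a b * LF F (delta_mx a b).

Lemma LC_linear F : linear (LC F : 'M[C]_3 -> C^o).
Proof.
move=> c Z W; rewrite /LC scaler_sumr -big_split; apply: eq_bigr => a _ /=.
rewrite scaler_sumr -big_split; apply: eq_bigr => b _ /=; rewrite !mxE.
by rewrite mulrDl -mulrA.
Qed.

Lemma LC_lin F c Z W : LC F (c *: Z + W) = c * LC F Z + LC F W.
Proof. exact: LC_linear. Qed.

Lemma LCZ F c Z : LC F (c *: Z) = c * LC F Z.
Proof.
have L0 : LC F 0 = 0.
  by rewrite /LC big1 // => a _; rewrite big1 // => b _; rewrite mxE mul0r.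
by have := LC_lin F c Z 0; rewrite addr0 L0 addr0.
Qed.

Lemma LC_sum F (I : Type) (r : seq I) (c : I -> C) (Z : I -> 'M[C]_3) :
  LC F (\sum_(i <- r) c i *: Z i) = \sum_(i <- r) c i * LC F (Z i).
Proof.
elim: r => [|i r IH].
  by rewrite !big_nil -(scale0r 0) LCZ mul0r.
by rewrite !big_cons LC_lin IH.
Qed.

Lemma LC_cx F V : LC F (cx V) = LF F V.
Proof.
by rewrite LF_entries; apply: eq_bigr => a _; apply: eq_bigr => b _; rewrite mxE.
Qed.

Lemma LC_ReIm F A B : LC F (cx A + 'i%C *: cx B) = LF F A + 'i%C * LF F B.
Proof. by rewrite addrC LC_lin !LC_cx addrC. Qed.

Context (nu : C * C) (sigma : 'I_2 * 'I_2) (l : nat) (lam : 'rV[C]_((2 * l).+1)).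
Context (lam_M0 : forall m : M3, M0 m -> lam *m TK l m = chiM sigma m *: lam).

Let mu : C * C := (nu.1 + (rho0 R).1, nu.2 + (rho0 R).2).

(* The derivative at 1 of the [q]-th section along [X_i]. *)
Definition Ltab (q : int) (i : nat) : C :=
  nth 0 [:: (mu.2 + l%:R - q%:~R) * lamZ lam q; - 2^-1 * q%:~R * lamZ lam (q - 1);
            - 3^-1 * (2 * mu.1 - mu.2) * lamZ lam q;
            - 2^-1 * (2 * l%:R - q%:~R) * lamZ lam (q + 1);
            (mu.2 - l%:R + q%:~R) * lamZ lam q] i.

(* Sections are left invariant under [N0]. *)
Lemma LF_Phi_mod_upper (V W : M3) (q : 'I_(2 * l).+1) :
  (forall i j : 'I_3, (j <= i)%N -> V i j + W i j = 0) ->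
  LF (Phi nu lam q) V = - LF (Phi nu lam q) W.
Proof.
move=> VW; apply/eqP; rewrite -addr_eq0 -LFD; apply/eqP.
by apply: (@LF_Phi_upper R nu sigma l lam lam_M0) => i j ij; rewrite mxE VW.
Qed.

(** Each sum sym + kap is twice a strictly upper triangular elementary matrix. *)
Lemma LF_Phi_sym (q : 'I_(2 * l).+1) :
  [/\ LF (Phi nu lam q) (sym12 R) = - LF (Phi nu lam q) (kap12 R),
      LF (Phi nu lam q) (sym13 R) = - LF (Phi nu lam q) (kap13 R) &
      LF (Phi nu lam q) (sym23 R) = - LF (Phi nu lam q) (kap23 R)].
Proof.
by split; apply: LF_Phi_mod_upper => i j; rewrite !mx_of_seqE;
  case: (ord3E i) => ->; case: (ord3E j) => -> //= _; lra.
Qed.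

(** Modulo strictly upper triangular matrices each X_i is diagonal plus skew. The diagonal part acts
    through [mu]; [kap23] acts by the weight; in X_1 and X_3 the combination of [kap12] and [kap13]
    keeps only one of the two neighbouring weights. *)
Lemma LC_Phi_Xp (q : 'I_(2 * l).+1) i : LC (Phi nu lam q) (Xp R i) = Ltab q i.
Proof.
have d1 : LF (Phi nu lam q) (diag3 0 1 (-1)) = mu.2 * lam 0 q.
  by rewrite (@LF_Phi_diag R nu sigma l lam lam_M0) ?rmorph0 ?rmorph1 ?mulr0 ?add0r ?mulr1 //; lra.
have d2 : LF (Phi nu lam q) (diag3 2 (-1) (-1)) = (2 * mu.1 - mu.2) * lam 0 q.
  rewrite (@LF_Phi_diag R nu sigma l lam lam_M0) ?rmorphN ?rmorph1 ?rmorph_nat; last by lra.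
  by rewrite -/mu; ring.
have qz : (q : nat)%:Z%:~R = q%:R :> C by rewrite pmulrn.
have ql : (2 * l - q)%N%:R = 2 * l%:R - q%:R :> C.
  by rewrite natrB ?natrM // -ltnS.
have ii : 'i%C * 'i%C = -1 :> C by rewrite -expr2 sqr_i.
have r1 : (-1 : R)%:C = -1 by rewrite rmorphN rmorph1.
have r2 : (2^-1 : R)%:C = 2^-1 by rewrite fmorphV rmorph_nat.
have r2' : (- 2^-1 : R)%:C = - 2^-1 by rewrite rmorphN -r2.
have r3 : (- 3^-1 : R)%:C = - 3^-1 by rewrite rmorphN fmorphV rmorph_nat.
rewrite Xp_ReIm LC_ReIm.
have [h12 h13 h23] := LF_Phi_sym q.
rewrite LF_Phi_kap12 ql in h12; rewrite LF_Phi_kap13 ql in h13; rewrite LF_Phi_kap23 in h23.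
rewrite -(lamZ_ord lam) in d1 d2 h23.
case: i => -[|[|[|[|[|//]]]]] h; rewrite /Ltab /XpRe /XpIm !LFZ ?r1 ?r2 ?r2' ?r3 ?rmorph1 ?rmorph0 /= ?d1 ?d2 ?h12 ?h13 ?h23 ?qz.
all: move: ('i%C) ii => I ii.
all: rewrite /mu /=; by field: ii.
Qed.

Context (dk : probability TM R) (Hdk : is_haar_SO3 dk) (H : completeNormedModType C).
Context (emb : (M3 -> C) -> H) (act : M3 -> H -> H).
Context (Hact : is_principal_series nu sigma dk emb act).

(** [Psi] combined with [Ad_Xp]: the derivatives at the identity are carried to [k] by tau_2l on the
    sections and tau_4 on the X_i. *)
Lemma dpiC_Phi i q : exists f, [/\ elem_section nu sigma f,
  dpiC act (Xp R i) (emb (Phi nu lam q)) = emb f &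
  forall k, SO3 k -> f k =
    \sum_j \sum_i' TK l k j q * (tauK 2 k i' i * LC (Phi nu lam j) (Xp R i'))].
Proof.
have [[Q [d0 [d1 [d2 dA]]]] [Q' [e0 [e1 [e2 dB]]]]] := diagonalizable_Xp i.
have [s1 h1] := dpi_Phi lam_M0 Hdk Hact q dA.
have [s2 h2] := dpi_Phi lam_M0 Hdk Hact q dB.
eexists; split; first exact: (elem_section_lin 'i%C s2 s1).
  rewrite (emb_linear Hact _ (elem_section_smooth s2) (elem_section_smooth s1)).
  by rewrite /dpiC Xp_ReIm map_Re_cx map_Im_cx h1 h2 addrC.
move=> k kS; cbv beta; rewrite !Ext_SO3 // /Psi big_distrr -big_split; apply: eq_bigr => j _ /=.
rewrite -big_distrr /= -LC_sum -Ad_Xp // Xp_ReIm.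
rewrite mulmxDr mulmxDl -scalemxAr -scalemxAl map_trmx -!map_mxM LC_ReIm.
ring.
Qed.

End ComplexLieAction.

(** * Gamma^0 as a map on functionals *)

Section GammaOnSections.
Context (R : realType).
Local Notation C := (R[i]).
Local Notation M3 := 'M[R]_3.
Local Notation TM := (g_sigma_algebraType (@open M3)).

Lemma Acoef_out (l l' : nat) (m : int) (k i : nat) :
  -2 <= m <= 2 -> l'%:Z = l%:Z + m -> (k <= 2 * l')%N -> (i < 5)%N ->
  ~~ (0 <= k%:Z + 2 - m - i%:Z <= 2 * l%:Z) -> Acoef R (2 * l) m k%:Z i = 0.
Proof.
move=> m2 ll' kl i5 out; have [r rm] : exists r : nat, r%:Z = m + 2 by exists (absz (m + 2)); lia.
rewrite (Acoef_bin _ rm _ ll') //; last by lia.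
by rewrite (@Abin_out R _ _ _ _ (k%:Z + 2 - m - i%:Z)) ?mulr0 //; lia.
Qed.

(** The functional on V_2l' belonging to the image under Gamma^0 of the homomorphism given by [lam]
    ([Gamma0_Phi]). *)
Definition Gam (nu : C * C) (l : nat) (lam : 'rV[C]_((2 * l).+1)) (l' : nat) (m : int) :
    'rV[C]_((2 * l').+1) :=
  \row_k \sum_(i < 5) Acoef R (2 * l) m (k : nat)%:Z i *
     Ltab nu lam ((k : nat)%:Z + 2 - m - (i : nat)%:Z) i.

Lemma Imap_Ltab nu l (lam : 'rV[C]_((2 * l).+1)) l' m (w : 'cV[C]_((2 * l').+1)) :
  -2 <= m <= 2 -> l'%:Z = l%:Z + m ->
  \sum_(j < (2 * l).+1) \sum_(i < 5) Imap l m w j i * Ltab nu lam (j : nat)%:Z i =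
  (Gam nu lam l' m *m w) 0 0.
Proof.
move=> m2 ll'; rewrite mxE.
under eq_bigr => j _ do (under eq_bigr => i _ do rewrite Imap_entry big_distrl /=).
under eq_bigr => j _ do rewrite exchange_big /=.
rewrite exchange_big /=; apply: eq_bigr => k _.
rewrite mxE big_distrl /= exchange_big /=; apply: eq_bigr => i _.
set z := _ - (i : nat)%:Z.
have [inz|outz] := boolP (0 <= z <= 2 * l%:Z); last first.
  have A0 : Acoef R (2 * l) m (k : nat)%:Z i = 0.
    by apply: (@Acoef_out l l') => //; rewrite -ltnS.
  by rewrite A0 !mul0r big1 // => j _; rewrite mul0r mulr0 mul0r.
have zl : (absz z < (2 * l).+1)%N by lia.
have zE : (Ordinal zl : nat)%:Z = z by rewrite /=; lia.
rewrite (bigD1 (Ordinal zl)) //= big1 ?addr0 => [|j /eqP jz].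
  by rewrite zE eqxx mulr1; ring.
have -> : ((j : nat)%:Z == z) = false.
  by apply/eqP => jzz; apply: jz; apply/val_inj => /=; lia.
by rewrite mulr0 mulr0 mul0r.
Qed.

Lemma Zset_nth (sigma : 'I_2 * 'I_2) n (i : 'I_(dZ sigma n)) : let p := nth 0%N (Zset sigma n) i in
  (p <= n)%N /\ (p = n + sigma.2 %[mod 2])%N.
Proof.
move=> p; have : p \in Zset sigma n by apply: mem_nth.
by rewrite mem_filter mem_iota add0n => /andP[/eqP pm]; case: ifP => _ /=; split=> //; lia.
Qed.

Definition lamZs (sigma : 'I_2 * 'I_2) n (i : 'I_(dZ sigma n)) : 'rV[C]_((2 * n).+1) :=
  lamS R sigma n (nth 0%N (Zset sigma n) i).

Context (nu : C * C) (sigma : 'I_2 * 'I_2).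
Context (dk : probability TM R) (Hdk : is_haar_SO3 dk) (H : completeNormedModType C).
Context (emb : (M3 -> C) -> H) (act : M3 -> H -> H).
Context (Hact : is_principal_series nu sigma dk emb act).
(** [s_fun] chooses some smooth section with a given restriction to K; [Phi] shows that one exists,
    and [emb_eq] that the choice does not matter in H. *)
Lemma emb_s_fun n p (q : 'I_(2 * n).+1) : (p <= n)%N -> (p = n + sigma.2 %[mod 2])%N ->
  emb (s_fun nu sigma p q) = emb (Phi nu (lamS R sigma n p) q).
Proof.
move=> pn pm.
have es := elem_section_Phi nu (fun x => lamS_M0 pn pm (m := x)) q.
rewrite /s_fun; case: xgetP => [f _ [fs fE]|/(_ (Phi nu (lamS R sigma n p) q))]; last first.
  case; split; first exact: elem_section_smooth.
  by move=> x xS; rewrite /Phi Ext_SO3 // coefS_lamS // tauK_TK.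
apply: (emb_eq Hact) => //; first exact: elem_section_smooth.
by move=> k kS; rewrite fE // /Phi Ext_SO3 // coefS_lamS // tauK_TK.
Qed.

Lemma Smx_Phi n (i : 'I_(dZ sigma n)) :
  col i (Smx nu sigma emb n) = \col_q emb (Phi nu (lamZs i) q).
Proof.
by apply/colP => q; rewrite !mxE emb_s_fun //; have [] := Zset_nth i.
Qed.

Lemma lamZs_M0 n (i : 'I_(dZ sigma n)) x : M0 x ->
  lamZs i *m TK n x = chiM sigma x *: lamZs i.
Proof. by have [pn pm] := Zset_nth i; exact: lamS_M0. Qed.

Context (l l' : nat) (m : int) (Hm : -2 <= m <= 2) (Hl' : l'%:Z = l%:Z + m).

Lemma hom_of_vbas n (v : 'cV[H]_n.+1) (j : 'I_n.+1) :
  hom_of v (vbas R n (j : nat)%:Z) = v j 0.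
Proof.
rewrite /hom_of (bigD1 j) //= mxE eqxx scale1r big1 ?addr0 // => i /negPf ij.
by rewrite mxE eqz_nat (_ : (i == j :> nat) = false) ?scale0r.
Qed.

(** Translation by [k] applies tau_2l tensor tau_4 to [Imap l m w], which by equivariance is [Imap]
    of tau_2l'(k) w. The value at [k] is thus the functional at 1 applied to tau_2l'(k) w. *)
Lemma Gamma0_Phi (lam : 'rV[C]_((2 * l).+1)) (w : 'cV[C]_((2 * l').+1)) :
  (forall x : M3, M0 x -> lam *m TK l x = chiM sigma x *: lam) ->
  exists f, [/\ elem_section nu sigma f,
    Gamma0 act m (hom_of (\col_q emb (Phi nu lam q))) w = emb f &
    forall k, SO3 k -> f k = (Gam nu lam l' m *m tauK l' k *m w) 0 0].
Proof.
move=> lam_M0.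
pose T := Imap l m w.
have /choice[F hF] : forall ji : 'I_(2 * l).+1 * 'I_5, exists f, [/\ elem_section nu sigma f,
  dpiC act (Xp R ji.2) (emb (Phi nu lam ji.1)) = emb f &
  forall k, SO3 k -> f k =
    \sum_j \sum_i' TK l k j ji.1 * (tauK 2 k i' ji.2 * LC (Phi nu lam j) (Xp R i'))].
  by move=> [q i]; exact: (dpiC_Phi lam_M0 Hdk Hact).
exists (fun x => \sum_ji T ji.1 ji.2 * F ji x); split.
- by apply: elem_section_sum => ji; have [] := hF ji.
- rewrite (emb_sum Hact); last by move=> ji; have [] := hF ji.
  rewrite /Gamma0 /eta_tilde pair_big /=; apply: eq_bigr => ji _.
  by rewrite hom_of_vbas mxE; have [_ -> _] := hF ji.
move=> k kS; rewrite -mulmxA -Imap_Ltab // Imap_equivariant // /tensK -/T.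
rewrite pair_big /=.
transitivity (\sum_ji \sum_jj T ji.1 ji.2 * (TK l k jj.1 ji.1 * (tauK 2 k jj.2 ji.2 * Ltab nu lam (jj.1 : nat)%:Z jj.2))).
  apply: eq_bigr => ji _; have [_ _ ->] := hF ji => //.
  rewrite pair_big /= -big_distrr /=; congr (_ * _); apply: eq_bigr => jj _.
  by rewrite (LC_Phi_Xp nu lam_M0).
rewrite exchange_big /=; apply: eq_bigr => jj _.
rewrite mxE big_distrl /= -(pair_big xpredT xpredT (fun j i => T j i * (TK l k jj.1 j * (tauK 2 k jj.2 i * Ltab nu lam (jj.1 : nat)%:Z jj.2)))) /=.
rewrite exchange_big /=; apply: eq_bigr => i _.
rewrite [(tauK l k *m T) _ _]mxE [tauK l k]tauK_TK // !big_distrl /=; apply: eq_bigr => j _.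
by rewrite [(tauK 2 k)^T _ _]mxE; ring.
Qed.

Lemma represents_Gam (A : 'M[C]_(dZ sigma l', dZ sigma l)) :
  (forall j, Gam nu (lamZs j) l' m = \sum_i A i j *: lamZs i) ->
  represents_Gamma0 nu emb act m A.
Proof.
move=> hA j w; rewrite Smx_Phi.
have [f [fs -> fE]] := Gamma0_Phi w (@lamZs_M0 l j).
have gs i q := elem_section_Phi nu (@lamZs_M0 l' i) q.
have -> : \sum_i A i j *: hom_of (col i (Smx nu sigma emb l')) w =
    emb (fun x => \sum_i A i j * \sum_q w q 0 * Phi nu (lamZs i) q x).
  rewrite (emb_sum Hact); last by move=> i; apply: elem_section_sum.
  apply: eq_bigr => i _; rewrite (emb_sum Hact) // Smx_Phi /hom_of.
  by congr (_ *: _); apply: eq_bigr => q _; rewrite mxE.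
apply: (emb_eq Hact); first exact: elem_section_smooth.
  by apply: elem_section_smooth; apply: elem_section_sum => i; apply: elem_section_sum.
move=> k kS; rewrite fE // hA !mulmx_suml summxE; apply: eq_bigr => i _.
rewrite -!scalemxAl mxE; congr (_ * _); rewrite mxE; apply: eq_bigr => q _.
by rewrite /Phi Ext_SO3 // mulrC tauK_TK.
Qed.

(** A column of B - A gives a combination of the functionals [lamZs] whose sections vanish in H, so
    it is 0 by [emb_lam_inj]; and the [lamZs] are independent. *)
Lemma represents_unique (A B : 'M[C]_(dZ sigma l', dZ sigma l)) :
  represents_Gamma0 nu emb act m A -> represents_Gamma0 nu emb act m B -> B = A.
Proof.
clear Hm Hl'; move=> hA hB; apply/matrixP => i0 j.
have gs i q := elem_section_Phi nu (@lamZs_M0 l' i) q.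
have lam0 : \sum_i (B i j - A i j) *: lamZs i = 0.
  apply: (emb_lam_inj Hdk Hact
    (f := fun q x => \sum_i (B i j - A i j) * Phi nu (lamZs i) q x)).
  - by move=> q; apply: elem_section_sum.
  - move=> q k kS; rewrite mulmx_suml summxE; apply: eq_bigr => i _.
    by rewrite -scalemxAl mxE /Phi Ext_SO3 // tauK_TK.
  move=> q; rewrite (emb_sum Hact) //.
  have := hB j (delta_mx q 0); rewrite hA => /esym/eqP.
  rewrite -subr_eq0 -sumrB => /eqP E; rewrite -[RHS]E; apply: eq_bigr => i _.
  rewrite scalerBl /hom_of (bigD1 q) //= big1 ?addr0 => [|q' /negPf q'q].
    by rewrite Smx_Phi !mxE !eqxx scale1r.
  by rewrite mxE q'q scale0r.
have [p0n _] := Zset_nth i0; set p0 := nth 0%N _ i0 in p0n.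
have p0l : (2 * l' - p0 < (2 * l').+1)%N by lia.
(* At coordinate 2l' - p0 only the functional of [i0] is nonzero: its value is 1, or 2 when p0 = l',
   which forces eps = 0. *)
move/rowP/(_ (Ordinal p0l)): lam0; rewrite summxE mxE (bigD1 i0) //= big1 ?addr0.
  rewrite !mxE -/p0 eqxx.
  have [e|_] := eqVneq (2 * l' - p0)%N p0; last first.
    by rewrite mulr0 addr0 mulr1 => /eqP; rewrite subr_eq0 => /eqP.
  have -> : eps sigma l' = 0%N.
    have : p0 \in Zset sigma l' by apply: mem_nth.
    rewrite mem_filter mem_iota add0n; case: (eps sigma l' =P 0%N) => // _ /andP[_] /=; lia.
  rewrite expr0 mul1r => /eqP; rewrite mulf_eq0 -[1 + 1]/(2%:R) pnatr_eq0 orbF subr_eq0.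
  by move/eqP.
move=> i /negPf ii0; rewrite !mxE /=; have [pn _] := Zset_nth i.
set p := nth 0%N _ i in pn *.
have pp : p != p0.
  rewrite nth_uniq //; last by rewrite /Zset filter_uniq // iota_uniq.
  exact: negbT.
rewrite (_ : (_ == _ - p)%N = false); last by apply/eqP; lia.
rewrite (_ : (_ == p)%N = false) ?mulr0 ?addr0 ?mulr0 //.
by apply/eqP; lia.
Qed.

End GammaOnSections.

(** * The three coefficients gamma *)

Section GammaCoefficients.
Context (R : realType).
Local Notation C := (R[i]).

(** X_1 and X_3 shift the weight by one in opposite directions, so the terms i = 1, 2, 3 of [Gam]
    share the weight z - m. This relation collects them into the coefficient i = 2 alone and
    produces the constant in gamma_{p,0}. *)
Lemma Acoef_middle (l l' : nat) (m k : int) :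
  -2 <= m <= 2 -> l'%:Z = l%:Z + m ->
  3 * (k + 1 - m)%:~R * Acoef R (2 * l) m k 1
  + 3 * (2 * l%:Z - k + 1 + m)%:~R * Acoef R (2 * l) m k 3 =
  (2 * l%:Z * m - 6 + m * (m + 1))%:~R * Acoef R (2 * l) m k 2.
Proof.
move=> m2 ll'; rewrite /Acoef; case: ifP => // _; last by rewrite !mulr0 addr0.
rewrite !mulrA -mulrDl; congr (_ / _).
have h : m \in [:: -2; -1; 0; 1; 2] by rewrite !inE; lia.
have E3 : 3 = 3%:~R :> C by [].
rewrite E3 -!intrM -intrD; congr (_%:~R).
rewrite PoszM; move: h; rewrite !inE; do 4 (case/orP; [move/eqP ->; rewrite /a_list /=; ring|]).
by move/eqP ->; rewrite /a_list /=; ring.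
Qed.

Lemma Acoef_sym (l l' : nat) (m k : int) (i : nat) :
  -2 <= m <= 2 -> l'%:Z = l%:Z + m -> (i <= 4)%N ->
  Acoef R (2 * l) m (2 * l'%:Z - k) (4 - i) = (-1) ^ m * Acoef R (2 * l) m k i.
Proof.
move=> m2 ll' i4; have [r rm] : exists r : nat, r%:Z = m + 2 by exists (absz (m + 2)); lia.
have r4 : (r <= 4)%N by lia.
have [kin|kout] := boolP (0 <= k <= 2 * l'%:Z); last first.
  by rewrite /Acoef !ifF ?mulr0 //; lia.
have [n nk] : exists n : nat, n%:Z = k by exists (absz k); lia.
have nl : (n <= 2 * l')%N by lia.
have -> : 2 * l'%:Z - k = (2 * l' - n)%N%:Z by lia.
rewrite -nk !(Acoef_bin _ rm r4 ll') ?leq_subr //; last by lia.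
rewrite subKn // Abin_sym // mulrCA; congr (_ * _).
have -> : m = r%:Z - 2 by lia.
by case: r r4 {rm} => [|[|[|[|[|//]]]]] _; rewrite /exprz /= ?invr1 ?expr1 ?expr0 //; field.
Qed.

Context (nu : C * C) (sigma : 'I_2 * 'I_2) (l l' : nat) (m : int).
Context (Hm : -2 <= m <= 2) (Hl' : l'%:Z = l%:Z + m).

(* [lamS], with [p] an arbitrary integer. *)
Definition lamSz n (t : int) : 'rV[C]_((2 * n).+1) :=
  \row_(q < (2 * n).+1) (((q : nat)%:Z == 2 * n%:Z - t)%:R
     + (-1) ^+ eps sigma n * ((q : nat)%:Z == t)%:R).

Lemma lamZ_row n (f : int -> C) (z : int) :
  0 <= z <= n%:Z -> lamZ (\row_(q < n.+1) f (q : nat)%:Z) z = f z.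
Proof.
move=> zn; have zl : (absz z < n.+1)%N by lia.
have zE : z = (Ordinal zl : nat)%:Z by rewrite /=; lia.
by rewrite zE lamZ_ord mxE.
Qed.

Lemma Gam_coef (lam : 'rV[C]_((2 * l).+1)) (k : 'I_(2 * l').+1) :
  let z := (k : nat)%:Z in
  let A := Acoef R (2 * l) m z in
  Gam nu lam l' m 0 k =
    (nu.2 + (rho0 R).2 + l%:R - (z + 2 - m)%:~R) * A 0%N * lamZ lam (z + 2 - m)
    - 3^-1 * (2 * nu.1 - nu.2 + 2 * (rho0 R).1 - (rho0 R).2 + (l%:Z * m)%:~R - 3
              + (m * (m + 1))%:~R / 2) * A 2%N * lamZ lam (z - m)
    + (nu.2 + (rho0 R).2 - l%:R + (z - 2 - m)%:~R) * A 4%N * lamZ lam (z - 2 - m).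
Proof.
move=> z A; rewrite mxE sum5E -/z -/A /Ltab /=.
have := Acoef_middle z Hm Hl'; rewrite -/A.
have -> : z + 2 - m - 0%:Z = z + 2 - m by lia.
have -> : z + 2 - m - 1%:Z = z + 1 - m by lia.
have -> : z + 2 - m - 2%:Z = z - m by lia.
have -> : z + 2 - m - 3%:Z = z - 1 - m by lia.
have -> : z + 2 - m - 4%:Z = z - 2 - m by lia.
have -> : z + 1 - m - 1 = z - m by lia.
have -> : z - 1 - m + 1 = z - m by lia.
rewrite !(intrD, intrM, intrN, rmorphN, rmorphB) /= -!pmulrn => mid.
move: (lamZ _ _) (lamZ _ _) (lamZ _ _) => x y w.
move/eqP: mid; rewrite -subr_eq0 => /eqP/(congr1 (fun u => - y / 6 * u)).
rewrite mulr0 => mid; apply/eqP; rewrite -subr_eq0 -mid; apply/eqP; by field.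
Qed.

Local Notation gm := (gamma nu l m).

(** A is 0 outside its range, so a shifted index outside 0, ..., 2l' never contributes. *)
Lemma gamma_out (p s : int) : s \in [:: -1; 0; 1] ->
  ~~ (0 <= p + m + 2 * s <= 2 * l'%:Z) -> gm p s = 0.
Proof.
move=> hs out; have A0 k i : k = 2 * l%:Z - p + m - 2 * s -> Acoef R (2 * l) m k i = 0.
  by move=> kE; rewrite /Acoef ifF //; lia.
move: hs; rewrite !inE /gamma => /orP[|/orP[]] /eqP E; rewrite E /= A0 ?mulr0 //; lia.
Qed.

Lemma lamZ_lamSz (p z : int) : 0 <= p <= 2 * l%:Z ->
  lamZ (lamSz l p) z = (z == 2 * l%:Z - p)%:R + (-1) ^+ eps sigma l * (z == p)%:R.
Proof.
move=> pl; have [zl|zl] := boolP (0 <= z <= (2 * l)%N%:Z).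
  exact: (@lamZ_row _ (fun q => (q == 2 * l%:Z - p)%:R + (-1) ^+ eps sigma l * (q == p)%:R)).
rewrite (_ : (z == _ - p) = false); last by lia.
rewrite (_ : (z == p) = false); last by lia.
rewrite mulr0 addr0 /lamZ big1 // => j _; rewrite (_ : (_ == z) = false) ?mulr0 //.
by have := ltn_ord j; lia.
Qed.

Lemma sign_absz (z : int) : (-1) ^ z = (-1) ^+ absz z :> C.
Proof. by case: z => n //=; rewrite NegzE -exprnN invr_sign. Qed.

Lemma sign_eps : (-1) ^+ eps sigma l' = (-1) ^+ eps sigma l * (-1) ^ m :> C.
Proof.
rewrite sign_absz.
have e n : (-1) ^+ eps sigma n = (-1) ^+ (n + sigma.1 + sigma.2) :> C.
  by rewrite /eps modn2 signr_odd.
rewrite !e -exprD; rewrite -signr_odd -[RHS]signr_odd; congr (_ ^+ _).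
by congr nat_of_bool; lia.
Qed.

(** The term of [lamSz] at 2l - p gives gamma by definition. The term at p is brought to the same
    values of A by [Acoef_sym]; the resulting (-1)^m is the ratio of the signs for l' and l
    ([sign_eps]). *)
Lemma Gam_lamSz (p : int) : 0 <= p <= 2 * l%:Z ->
  Gam nu (lamSz l p) l' m =
  \sum_(s <- [:: -1; 0; 1 : int]) gm p s *: lamSz l' (p + m + 2 * s).
Proof.
move=> p2l; apply/rowP => k; have kl : (k <= 2 * l')%N by rewrite -ltnS.
rewrite Gam_coef !lamZ_lamSz // !big_cons big_nil addr0 !mxE.
set z := (k : nat)%:Z; rewrite sign_eps.
set e := (-1) ^+ eps sigma l.
have mm : (-1) ^ m * (-1) ^ m = 1 :> C.
  by rewrite sign_absz -expr2 sqrr_sign.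
have sym i : (i <= 4)%N -> Acoef R (2 * l) m z i = (-1) ^ m * Acoef R (2 * l) m (2 * l'%:Z - z) (4 - i).
  move=> i4; have := Acoef_sym (2 * l'%:Z - z) Hm Hl' (leq_subr i 4).
  by rewrite subKn // opprB addrCA subrr addr0.
have ind (b b' : bool) (x y : C) : b = b' -> (b -> x = y) -> x * b%:R = y * b'%:R.
  by move=> <-; case: b => [->//|_]; rewrite !mulr0.
have g1 : gm p 1 = (nu.2 + (rho0 R).2 - l%:R + p%:~R) * Acoef R (2 * l) m (2 * l%:Z - p + m - 2) 0 by [].
have g0 : gm p 0 = - 3^-1 * (2 * nu.1 - nu.2 + 2 * (rho0 R).1 - (rho0 R).2 + (l%:Z * m)%:~R - 3
              + (m * (m + 1))%:~R / 2) * Acoef R (2 * l) m (2 * l%:Z - p + m) 2 by [].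
have g_1 : gm p (-1) = (nu.2 + (rho0 R).2 + l%:R - p%:~R) * Acoef R (2 * l) m (2 * l%:Z - p + m + 2) 4 by [].
have lR : l%:R = l%:Z%:~R :> C by [].
(* [d1], [d0], [d_1] come from the term at 2l - p; [r1], [r0], [r_1] from the one at p, where s = 1
   and s = -1 are exchanged. *)
have d1 : (nu.2 + (rho0 R).2 + l%:R - (z + 2 - m)%:~R) * Acoef R (2 * l) m z 0 *
    (z + 2 - m == 2 * l%:Z - p)%:R = gm p 1 * (z == 2 * l'%:Z - (p + m + 2 * 1))%:R.
  apply: ind => [|/eqP zE]; first lia.
  have -> : z = 2 * l%:Z - p + m - 2 by lia.
  rewrite g1 lR -addrA -[in RHS]addrA -!intrN -!intrD; congr ((_ + _%:~R) * _); lia.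
have d0 : 3^-1 * (2 * nu.1 - nu.2 + 2 * (rho0 R).1 - (rho0 R).2 + (l%:Z * m)%:~R - 3 +
      (m * (m + 1))%:~R / 2) * Acoef R (2 * l) m z 2 * (z - m == 2 * l%:Z - p)%:R =
    - gm p 0 * (z == 2 * l'%:Z - (p + m))%:R.
  apply: ind => [|/eqP zE]; first lia.
  have -> : z = 2 * l%:Z - p + m by lia.
  by rewrite g0 !mulNr opprK.
have d_1 : (nu.2 + (rho0 R).2 - l%:R + (z - 2 - m)%:~R) * Acoef R (2 * l) m z 4 *
    (z - 2 - m == 2 * l%:Z - p)%:R = gm p (-1) * (z == 2 * l'%:Z - (p + m + 2 * -1))%:R.
  apply: ind => [|/eqP zE]; first lia.
  have -> : z = 2 * l%:Z - p + m + 2 by lia.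
  rewrite g_1 lR -addrA -[in RHS]addrA -!intrN -!intrD; congr ((_ + _%:~R) * _); lia.
have r1 : (nu.2 + (rho0 R).2 + l%:R - (z + 2 - m)%:~R) * Acoef R (2 * l) m z 0 *
    (z + 2 - m == p)%:R = (-1) ^ m * gm p (-1) * (z == p + m + 2 * -1)%:R.
  apply: ind => [|/eqP zE]; first lia.
  rewrite sym // zE g_1 mulrCA; congr (_ * (_ * Acoef R _ _ _ _)); lia.
have r0 : 3^-1 * (2 * nu.1 - nu.2 + 2 * (rho0 R).1 - (rho0 R).2 + (l%:Z * m)%:~R - 3 +
      (m * (m + 1))%:~R / 2) * Acoef R (2 * l) m z 2 * (z - m == p)%:R =
    - ((-1) ^ m * gm p 0) * (z == p + m)%:R.
  apply: ind => [|/eqP zE]; first lia.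
  rewrite sym // g0 !mulNr mulrN opprK mulrCA; congr (_ * (_ * Acoef R _ _ _ _)); lia.
have r_1 : (nu.2 + (rho0 R).2 - l%:R + (z - 2 - m)%:~R) * Acoef R (2 * l) m z 4 *
    (z - 2 - m == p)%:R = (-1) ^ m * gm p 1 * (z == p + m + 2 * 1)%:R.
  apply: ind => [|/eqP zE]; first lia.
  rewrite sym // zE g1 mulrCA; congr (_ * (_ * Acoef R _ _ _ _)); lia.
have D (x b b' : C) : x * (b + e * b') = x * b + e * (x * b') by ring.
rewrite !D d1 d0 d_1 r1 r0 r_1; ring.
Qed.

End GammaCoefficients.

(** * The index sets Z and the shift n *)

Section IndexSets.
Implicit Types (sigma : 'I_2 * 'I_2) (l : nat).

Lemma filter_parity_iota (a N : nat) :
  [seq p <- iota 0 N | p == a %[mod 2]] =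
  mkseq (fun i => 2 * i + a %% 2)%N ((N + 1 - a %% 2) %/ 2).
Proof.
elim: N => [|N IH]; first by rewrite (_ : (_ %/ 2 = 0)%N) //; lia.
rewrite -{1}[N.+1]addn1 iotaD filter_cat IH /= add0n.
have [h|h] := boolP (N == a %[mod 2]).
  have -> : ((N.+1 + 1 - a %% 2) %/ 2 = ((N + 1 - a %% 2) %/ 2).+1)%N by lia.
  by rewrite mkseqS -cats1; congr (_ ++ [:: _]); lia.
by rewrite cats0; congr mkseq; lia.
Qed.

Lemma Zset_mkseq sigma l : Zset sigma l =
  mkseq (fun i => 2 * i + delta_l sigma l)%N
        (((if eps sigma l == 0 then l.+1 else l) + 1 - delta_l sigma l) %/ 2)%N.
Proof. exact: filter_parity_iota. Qed.

Lemma Zset_nthE sigma l (i : 'I_(dZ sigma l)) :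
  nth 0%N (Zset sigma l) i = (2 * i + delta_l sigma l)%N.
Proof.
have := ltn_ord i; rewrite {2}/dZ !Zset_mkseq size_mkseq => h.
by rewrite nth_mkseq.
Qed.

Lemma dZE sigma l : dZ sigma l =
  (((if eps sigma l == 0 then l.+1 else l) + 1 - delta_l sigma l) %/ 2)%N.
Proof. by rewrite /dZ Zset_mkseq size_mkseq. Qed.

Lemma sigma_cases (s : 'I_2) : (s = 0%N :> nat) \/ (s = 1%N :> nat).
Proof. by case: s => -[|[|//]] ?; [left|right]. Qed.

Lemma delta_lE sigma l : delta_l sigma l = ((l + sigma.2) %% 2)%N.
Proof. by []. Qed.

Lemma dZ_even sigma l : sigma.2 = 0%N :> nat -> ~~ odd (sigma.1 + l) ->
  (2 * dZ sigma l + delta_l sigma l = l + 2)%N.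
Proof. by rewrite dZE /eps /delta_l => -> ls; case: ifP => /eqP; lia. Qed.

Lemma dZ_odd sigma l : sigma.2 = 0%N :> nat -> odd (sigma.1 + l) ->
  (2 * dZ sigma l + delta_l sigma l = l)%N.
Proof. by rewrite dZE /eps /delta_l => -> ls; case: ifP => /eqP; lia. Qed.

Lemma dZ_1 sigma l : sigma.2 = 1%N :> nat ->
  (2 * dZ sigma l + delta_l sigma l = l + 1)%N.
Proof. by rewrite dZE /eps /delta_l => ->; case: ifP => /eqP; lia. Qed.

(** With [n] extra rows on top, row r of the matrix belongs to the index 2r + delta + m - 2. *)
Lemma n_shiftE sigma l l' (m : int) : -2 <= m <= 2 -> l'%:Z = l%:Z + m ->
  2 * (n_shift sigma l m)%:Z + (delta_l sigma l)%:Z + m = 2 + (delta_l sigma l')%:Z.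
Proof.
move=> m2 ll'; rewrite /n_shift /delta_l.
have h : m \in [:: -2; -1; 0; 1; 2] by rewrite !inE; lia.
move: h ll'; rewrite !inE => /orP[/eqP ->|/orP[/eqP ->|/orP[/eqP ->|/orP[/eqP ->|/eqP ->]]]] ll' /=;
  try (case: ifP => /= ?); try lia.
Qed.

End IndexSets.

(** * Folding an index back into Z *)

Section Decomposition.
Context (R : realType) (sigma : 'I_2 * 'I_2).
Local Notation C := (R[i]).

(** Coefficient of the basis functional of index [p] in [lamSz n t]; an index beyond [n] is folded
    to 2n - t by [lamSz_rev]. The clause [p != n] avoids counting t = n twice. *)
Definition cS n (p : nat) (t : int) : C :=
  (p%:Z == t)%:R + (-1) ^+ eps sigma n * ((p != n) && (p%:Z == 2 * n%:Z - t))%:R.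

Lemma lamS_lamSz n p : (p <= n)%N -> lamS R sigma n p = lamSz R sigma n p%:Z.
Proof.
move=> pn; apply/rowP => q; rewrite !mxE.
have -> : (q == 2 * n - p :> nat)%N = ((q : nat)%:Z == 2 * n%:Z - p%:Z) by lia.
by rewrite eqz_nat.
Qed.

Lemma lamSz_rev n (t : int) :
  lamSz R sigma n (2 * n%:Z - t) = (-1) ^+ eps sigma n *: lamSz R sigma n t.
Proof.
apply/rowP => q; rewrite !mxE opprB addrCA subrr addr0 mulrDr mulrA -expr2 sqrr_sign mul1r.
exact: addrC.
Qed.

Lemma lamSz_Zset n (i : 'I_(dZ sigma n)) :
  lamZs R i = lamSz R sigma n (2 * i + delta_l sigma n)%N%:Z.
Proof.
by have [pn _] := Zset_nth i; rewrite /lamZs lamS_lamSz // Zset_nthE.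
Qed.

Lemma lamSz_decomposition n (t : int) : 0 <= t <= 2 * n%:Z ->
  (absz t = n + sigma.2 %[mod 2])%N ->
  lamSz R sigma n t =
  \sum_(i < dZ sigma n) cS n (2 * i + delta_l sigma n)%N t *: lamZs R i.
Proof.
move=> tn tm.
have lt_i (i : 'I_(dZ sigma n)) : (2 * i + delta_l sigma n <= n)%N.
  by rewrite -Zset_nthE; have [] := Zset_nth i.
have small (u : int) : 0 <= u <= n%:Z -> (absz u = n + sigma.2 %[mod 2])%N ->
    u < n%:Z \/ eps sigma n = 0%N ->
    exists i : 'I_(dZ sigma n), u = (2 * i + delta_l sigma n)%N.
  move=> un um ue.
  have iP : (((absz u) - delta_l sigma n) %/ 2 < dZ sigma n)%N.
    rewrite dZE /delta_l; case: eqP => e0; first lia.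
    by case: ue => [|/e0//]; lia.
  by exists (Ordinal iP); rewrite /= /delta_l; lia.
have [tn'|nt] := ltP n%:Z t.
  have [i iE] : exists i : 'I_(dZ sigma n), 2 * n%:Z - t = (2 * i + delta_l sigma n)%N.
    by apply: small; [lia|lia|left; lia].
  rewrite -[t in LHS](_ : 2 * n%:Z - (2 * n%:Z - t) = t); last by lia.
  rewrite lamSz_rev iE -lamSz_Zset (bigD1 i) //= big1 => [|j /eqP ji].
    have := lt_i i; rewrite /cS => ii.
    rewrite (_ : (_ == t) = false); last by lia.
    rewrite (_ : (_ && _) = true); last by lia.
    by rewrite add0r mulr1 addr0.
  have jj := lt_i j; have : (j : nat) <> i by move=> h; apply: ji; exact/val_inj.
  rewrite /cS => jni; rewrite (_ : (_ == t) = false); last by lia.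
  rewrite (_ : (_ && _) = false); last by lia.
  by rewrite mulr0 addr0 scale0r.
have [ts|[tE e1]] : (t < n%:Z \/ eps sigma n = 0%N) \/ t = n%:Z /\ eps sigma n = 1%N.
    by rewrite /eps; lia.
  have [i iE] := small t (introT andP (conj (proj1 (andP tn)) nt)) tm ts.
  rewrite {1}iE -lamSz_Zset (bigD1 i) //= big1 => [|j /eqP ji].
    rewrite /cS (_ : (_ == t) = true); last by lia.
    rewrite (_ : (_ && _) = false); last by lia.
    by rewrite mulr0 !addr0 scale1r.
  have jj := lt_i j; have jni : (j : nat) <> i by move=> h; apply: ji; exact/val_inj.
  rewrite /cS (_ : (_ == t) = false); last by lia.
  rewrite (_ : (_ && _) = false); last by lia.
  by rewrite mulr0 addr0 scale0r.
(* Here t = n and eps = 1: the two terms of [lamSz] cancel, and n is absent from Z. *)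
rewrite big1 => [|j _].
  apply/rowP => q; rewrite !mxE e1 expr1 tE (_ : 2 * n%:Z - n%:Z = n%:Z); last by lia.
  by rewrite mulN1r subrr.
have jj : (2 * j + delta_l sigma n < n)%N.
  have := ltn_ord j; rewrite {2}dZE e1 /=; move: (lt_i j); rewrite /delta_l; lia.
rewrite /cS (_ : (_ == t) = false); last by lia.
rewrite (_ : (_ && _) = false); last by lia.
by rewrite mulr0 addr0 scale0r.
Qed.

End Decomposition.

(** * The matrix of Gamma^0 and its entries *)

Section GammaMatrix.
Context (R : realType).
Local Notation C := (R[i]).
Local Notation M3 := 'M[R]_3.
Local Notation TM := (g_sigma_algebraType (@open M3)).
Context (nu : C * C) (sigma : 'I_2 * 'I_2) (l l' : nat) (m : int).
Context (Hm : -2 <= m <= 2) (Hl' : l'%:Z = l%:Z + m).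

Local Notation gm := (gamma nu l m).
Local Notation pj j := (2 * (j : nat)%:Z + (delta_l sigma l)%:Z).

Definition Rmx : 'M[C]_(dZ sigma l', dZ sigma l) :=
  \matrix_(i, j) \sum_(s <- [:: -1; 0; 1 : int])
     gm (pj j) s * cS R sigma l' (2 * i + delta_l sigma l')%N (pj j + m + 2 * s).

Lemma Gam_lamZs j : Gam nu (lamZs R j) l' m = \sum_(i < dZ sigma l') Rmx i j *: lamZs R i.
Proof.
have [jl jm] := Zset_nth j; rewrite Zset_nthE in jl jm.
rewrite lamSz_Zset (_ : (2 * j + delta_l sigma l)%N%:Z = pj j); last by lia.
rewrite (Gam_lamSz nu sigma Hm Hl'); last by lia.
under [RHS]eq_bigr do rewrite mxE scaler_suml.
rewrite exchange_big /=; apply: eq_big_seq => s hs.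
have [tin|tout] := boolP (0 <= pj j + m + 2 * s <= 2 * l'%:Z); last first.
  rewrite (gamma_out nu Hm Hl' hs tout) scale0r big1 // => i _.
  by rewrite mul0r scale0r.
rewrite lamSz_decomposition //; last by move: hs; rewrite !inE; lia.
by rewrite scaler_sumr; apply: eq_bigr => i _; rewrite scalerA.
Qed.

(** By [n_shiftE] the index p + m + 2s with p = 2j + delta lies in row j + 1 + s, whence three
    diagonals. It exceeds l' only for s = 1 and p = l - 1 or p = l, hence in the last column; the
    folded term then lies in row d or d - 1 respectively. *)
Lemma Rmx_entry n (r : 'I_(n + dZ sigma l')) (j : 'I_(dZ sigma l)) :
  2 * n%:Z + (delta_l sigma l)%:Z + m = 2 + (delta_l sigma l')%:Z ->
  col_mx (Omx R n (dZ sigma l)) Rmx r j =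
  gm (pj j) (-1) * ((r : nat) == j :> nat)%:R + gm (pj j) 0 * ((r : nat) == j + 1 :> nat)%N%:R
  + gm (pj j) 1 * ((r : nat) == j + 2 :> nat)%N%:R
  + (-1) ^+ eps sigma l' * gm (pj j) 1
    * ((l%:Z <= pj j + 1) && (r%:Z + pj j + 1 == (dZ sigma l)%:Z + l%:Z))%:R.
Proof.
move=> hn; have jd := ltn_ord j.
have d2 : (2 * dZ sigma l + delta_l sigma l <= l + 2)%N.
  by rewrite dZE /delta_l; case: ifP; lia.
have d1 : (delta_l sigma l' < 2)%N by rewrite /delta_l ltn_mod.
have out (b : bool) (p s : int) (x : C) : s \in [:: -1; 0; 1] ->
    (b -> ~~ (0 <= p + m + 2 * s <= 2 * l'%:Z)) -> x * gm p s * b%:R = 0.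
  move=> hs; case: b => [/(_ isT)/(gamma_out nu Hm Hl' hs) ->|_]; by rewrite ?mulr0 ?mul0r.
case: (split_ordP r) => i ri.
  (* In rows above [n] the index of a diagonal term is negative and that of a folded term exceeds
     2l'; [gamma] vanishes in both cases. *)
  rewrite ri col_mxEu mxE /=; have := ltn_ord i => ilt.
  have z (x : C) : x = 1 * x by rewrite mul1r.
  rewrite [gm _ (-1)]z [gm _ 0]z [X in _ + X * _ + _]z !out ?addr0 ?inE //; lia.
rewrite ri col_mxEd mxE !big_cons big_nil addr0 /cS /=.
have il : (2 * i + delta_l sigma l' <= l')%N.
  by rewrite -Zset_nthE; have [] := Zset_nth i.
have -> : ((2 * i + delta_l sigma l')%N == pj j + m + 2 * -1 :> int) = (n + i == j)%N by lia.
have -> : ((2 * i + delta_l sigma l')%N == pj j + m :> int) = (n + i == j + 1)%N by lia.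
have -> : ((2 * i + delta_l sigma l')%N == pj j + m + 2 * 1 :> int) = (n + i == j + 2)%N by lia.
set p' := (2 * i + delta_l sigma l')%N in il *.
have -> : (p' != l') && (p' == 2 * l'%:Z - (pj j + m + 2 * -1) :> int) = false by lia.
have -> : (p' != l') && (p' == 2 * l'%:Z - (pj j + m) :> int) = false by lia.
have -> : (p' != l') && (p' == 2 * l'%:Z - (pj j + m + 2 * 1) :> int) =
  ((l%:Z <= pj j + 1) && ((n + i)%N%:Z + pj j + 1 == (dZ sigma l)%:Z + l%:Z)) by lia.
by rewrite !mulr0n !mulr0 !addr0 !mulrDr !addrA mulrCA mulrA.
Qed.

Context (dk : probability TM R) (Hdk : is_haar_SO3 dk) (H : completeNormedModType C).
Context (emb : (M3 -> C) -> H) (act : M3 -> H -> H).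
Context (Hact : is_principal_series nu sigma dk emb act).

Lemma represents_Rmx : represents_Gamma0 nu emb act m Rmx.
Proof. by apply: (represents_Gam Hdk Hact Hm Hl') => j; exact: Gam_lamZs. Qed.

Lemma Gamma0_calC (v : 'cV[H]_(2 * l).+1) (k : 'I_(2 * l').+1) :
  calC_col act l' m v k 0 = Gamma0 act m (hom_of v) (delta_mx k 0).
Proof.
rewrite mxE /Gamma0 /eta_tilde exchange_big /=; apply: eq_bigr => i _.
have TE (j : 'I_(2 * l).+1) : Imap l m (delta_mx k 0 : 'cV[C]_(2 * l').+1) j i =
    Acoef R (2 * l) m (k : nat)%:Z i * ((j : nat)%:Z == (k : nat)%:Z + 2 - m - (i : nat)%:Z)%:R.
  rewrite Imap_entry (bigD1 k) //= big1 => [|k' /negPf kk]; last by rewrite mxE kk mul0r.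
  by rewrite mxE !eqxx mul1r addr0.
set z := (_ - _ - _) in TE *.
under [RHS]eq_bigr do rewrite hom_of_vbas TE.
have [zin|zout] := boolP (0 <= z <= 2 * l%:Z); last first.
  have A0 : Acoef R (2 * l) m (k : nat)%:Z i = 0.
    by apply: (@Acoef_out R l l') => //; rewrite -ltnS.
  by rewrite A0 scale0r big1 // => j _; rewrite mul0r scale0r.
have zl : (absz z < (2 * l).+1)%N by lia.
have zE (j : 'I_(2 * l).+1) : ((j : nat)%:Z == z) = (j == Ordinal zl).
  by rewrite -val_eqE /=; lia.
under eq_bigl do rewrite zE.
rewrite big_pred1_eq (bigD1 (Ordinal zl)) // zE eqxx mulr1 big1 => [|j /negPf jz]; first exact/esym/addr0.
by rewrite zE jz mulr0 scale0r.
Qed.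

Lemma calC_Rmx : calC act l' m (Smx nu sigma emb l) = mulHmx (Smx nu sigma emb l') Rmx.
Proof.
apply/matrixP => k j; rewrite [LHS]mxE [RHS]mxE Gamma0_calC represents_Rmx.
apply: eq_bigr => i _; congr (_ *: _).
rewrite /hom_of (bigD1 k) //= big1 => [|q /negPf qk]; last by rewrite [X in X *: _]mxE qk scale0r.
by rewrite [X in X *: _]mxE !eqxx scale1r addr0 mxE.
Qed.

End GammaMatrix.

(** * Block matrices entry by entry *)

Section BlockEntries.
Context (R : realType).
Local Notation C := (R[i]).

(** Entries as a function of natural numbers survive changes of dimension, so that block matrices
    are compared by arithmetic on indices. *)
Definition entries a b (M : 'M[C]_(a, b)) (f : nat -> nat -> C) : Prop :=
  forall i j, M i j = f i j.

Lemma entries_fit a b a' b' (M : 'M[C]_(a', b')) f : a' = a -> b' = b ->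
  entries M f -> entries (fit a b M) f.
Proof. by move=> ea eb; subst; rewrite /fit conform_mx_id. Qed.

Lemma entries_col a1 a2 b (M1 : 'M[C]_(a1, b)) (M2 : 'M[C]_(a2, b)) f1 f2 :
  entries M1 f1 -> entries M2 f2 ->
  entries (col_mx M1 M2) (fun i j => if (i < a1)%N then f1 i j else f2 (i - a1)%N j).
Proof.
move=> h1 h2 i j; case: (split_ordP i) => k ->; first by rewrite col_mxEu /= h1.
by rewrite col_mxEd /= addKn h2.
Qed.

Lemma entries_row a b1 b2 (M1 : 'M[C]_(a, b1)) (M2 : 'M[C]_(a, b2)) f1 f2 :
  entries M1 f1 -> entries M2 f2 ->
  entries (row_mx M1 M2) (fun i j => if (j < b1)%N then f1 i j else f2 i (j - b1)%N).
Proof.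
move=> h1 h2 i j; case: (split_ordP j) => k ->; first by rewrite row_mxEl /= h1.
by rewrite row_mxEr /= addKn h2.
Qed.

Lemma entries_block a1 a2 b1 b2 (M11 : 'M[C]_(a1, b1)) (M12 : 'M[C]_(a1, b2))
    (M21 : 'M[C]_(a2, b1)) (M22 : 'M[C]_(a2, b2)) f11 f12 f21 f22 :
  entries M11 f11 -> entries M12 f12 -> entries M21 f21 -> entries M22 f22 ->
  entries (block_mx M11 M12 M21 M22) (fun i j =>
    if (i < a1)%N then if (j < b1)%N then f11 i j else f12 i (j - b1)%N
    else if (j < b1)%N then f21 (i - a1)%N j else f22 (i - a1)%N (j - b1)%N).
Proof.
move=> h11 h12 h21 h22.
exact: (entries_col (entries_row h11 h12) (entries_row h21 h22)).
Qed.

Lemma entries_O a b : entries (Omx R a b) (fun _ _ => 0).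
Proof. by move=> i j; rewrite mxE. Qed.

Lemma entries_scale a b c (M : 'M[C]_(a, b)) f : entries M f ->
  entries (c *: M) (fun i j => c * f i j).
Proof. by move=> h i j; rewrite mxE h. Qed.

Lemma entries_evec k z : entries (evec R k z) (fun i _ => (i%:Z == z)%:R).
Proof. by move=> i j; rewrite mxE. Qed.

Lemma entries_if_single a b (c : bool) i0 j0 x :
  entries (if c then @single R a b i0 j0 x else 0)
    (fun i j => x * [&& c, i == i0 & j == j0]%:R).
Proof.
move=> i j; case: c; rewrite mxE /= ?mulr0 //.
by case: ifP; rewrite ?mulr1 ?mulr0.
Qed.

Lemma entries_D nu sigma l m s k : entries (Dmx nu sigma l m s k)
  (fun i j => gamma nu l m (2 * j%:Z + (delta_l sigma l)%:Z) s * (i == j)%N%:R).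
Proof.
move=> i j; rewrite !mxE -val_eqE /=.
by case: eqP => [->|_]; rewrite ?mulr1n ?mulr1 // mulr0n mulr0.
Qed.

End BlockEntries.

(** * The five cases *)

Theorem theorem5p5 (R : realType) (nu : R[i] * R[i]) (sigma : 'I_2 * 'I_2)
  (dk : probability (g_sigma_algebraType (@open 'M[R]_3)) R)
  (Hdk : is_haar_SO3 dk)
  (H : completeNormedModType R[i])
  (emb : ('M[R]_3 -> R[i]) -> H) (act : 'M[R]_3 -> H -> H)
  (Hact : is_principal_series nu sigma dk emb act)
  (l l' : nat) (m : int)
  (Hm : -2 <= m <= 2)
  (Hl' : l'%:Z = l%:Z + m)
  (Hd : (0 < dZ sigma l)%N)
  (Hd' : (0 < dZ sigma l')%N)
  (Hocc : occurs R l' l) :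
  (* In (1), (3) and (5) the coefficient gamma_{l,1}, resp. gamma_{l-1,1},
     belongs to row d - 1, resp. d, of Rt (rows counted from 0).  The blocks
     D_1(c) and e^{(c)}_i start in row 2; when the row of the coefficient is 0
     or 1, it is supplied by the last summand, which vanishes otherwise. *)
  let d := dZ sigma l in
  let d' := dZ sigma l' in
  let n := n_shift sigma l m in
  let delta := (delta_l sigma l)%:Z in
  let g := gamma nu l m in
  let D := Dmx nu sigma l m in
  exists A : 'M[R[i]]_(d', d),
    (represents_Gamma0 nu emb act m A /\
     forall B : 'M[R[i]]_(d', d), represents_Gamma0 nu emb act m B -> B = A) /\
    calC act l' m (Smx nu sigma emb l) = mulHmx (Smx nu sigma emb l') A /\
    let Rt : 'M[R[i]]_(n + d', d) := col_mx (Omx R n d) A in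
    (* (1) *)
    (sigma.2 = 0%N :> nat -> m \in [:: 0; 2; -2] -> ~~ odd (sigma.1 + l) ->
       (n + d' = d + 1)%N /\
       Rt = fit (n + d') d (col_mx (D (-1) d) (Omx R 1 d))
          + fit (n + d') d (col_mx (Omx R 1 d) (D 0 d))
          + fit (n + d') d
              (block_mx (Omx R 2 (d - 1)) (Omx R 2 1)
                 (D 1 (d - 1)%N) (g l%:Z 1 *: evec R (d - 1) (d%:Z - 3)))
          + (if (d <= 2)%N
             then single (n + d') d (d - 1) (d - 1) (g l%:Z 1) else 0)) /\
    (* (2) *)
    (sigma.2 = 0%N :> nat -> m \in [:: 0; 2; -2] -> odd (sigma.1 + l) ->
       (n + d' = d + 1)%N /\
       Rt = fit (n + d') d (col_mx (D (-1) d) (Omx R 1 d))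
          + fit (n + d') d (col_mx (Omx R 1 d) (D 0 d))
          + fit (n + d') d
              (block_mx (Omx R 2 (d - 1)) (Omx R 2 1)
                 (D 1 (d - 1)%N) (Omx R (d - 1) 1))) /\
    (* (3) *)
    (sigma.2 = 0%N :> nat -> m \in [:: 1; -1] -> ~~ odd (sigma.1 + l) ->
       (d = 1%N -> d' = 1%N /\ A = const_mx (g delta (-1) - g l%:Z 1)) /\
       ((1 < d)%N ->
          (n + d' = d)%N /\
          Rt = fit (n + d') d (D (-1) d)
             + fit (n + d') d
                 (block_mx (Omx R 1 (d - 1)) (Omx R 1 1)
                    (D 0 (d - 1)%N) (Omx R (d - 1) 1))
             + fit (n + d') d
                 (block_mx (Omx R 2 (d - 2))
                    (row_mx (Omx R 2 1) (Omx R 2 1))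
                    (D 1 (d - 2)%N)
                    (row_mx (Omx R (d - 2) 1)
                       (- g l%:Z 1 *: evec R (d - 2) (d%:Z - 3))))
             + (if (d <= 2)%N
                then single (n + d') d (d - 1) (d - 1) (- g l%:Z 1) else 0))) /\
    (* (4) *)
    (sigma.2 = 0%N :> nat -> m \in [:: 1; -1] -> odd (sigma.1 + l) ->
       (n + d' = d + 2)%N /\
       Rt = fit (n + d') d (col_mx (D (-1) d) (Omx R 2 d))
          + fit (n + d') d
              (col_mx (Omx R 1 d) (col_mx (D 0 d) (Omx R 1 d)))
          + fit (n + d') d (col_mx (Omx R 2 d) (D 1 d))) /\
    (* (5) *)
    (sigma.2 = 1%N :> nat ->
       (n + d' = d + 1)%N /\
       Rt = fit (n + d') d (col_mx (D (-1) d) (Omx R 1 d))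
          + fit (n + d') d (col_mx (Omx R 1 d) (D 0 d))
          + fit (n + d') d
              (block_mx (Omx R 2 (d - 1)) (Omx R 2 1)
                 (D 1 (d - 1)%N)
                 ((-1) ^+ eps sigma l' * g (l%:Z - 1) 1
                    *: evec R (d - 1) (d%:Z - 2)))
          + (if (d <= 1)%N
             then single (n + d') d d (d - 1)
                    ((-1) ^+ eps sigma l' * g (l%:Z - 1) 1) else 0)).
Proof.
cbv zeta; exists (Rmx nu sigma l l' m).
split.
  split; first exact: (represents_Rmx Hm Hl' Hdk Hact).
  by move=> B; apply: (represents_unique Hdk Hact (represents_Rmx Hm Hl' Hdk Hact)).
split; first exact: (calC_Rmx Hm Hl' Hdk Hact).
have hn := n_shiftE sigma Hm Hl'.
have Rt r j := Rmx_entry nu Hm Hl' r j hn.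
have dg := entries_D nu sigma l m.
have O := entries_O R.
(* All entries are sums of a coefficient times the indicator of an index condition; only the
   conditions remain to be compared. *)
have kron (b b' : bool) (x : R[i]) : b = b' -> x * b%:R = x * b'%:R by move=> ->.
have kron0 (b : bool) (x : R[i]) : b = false -> x * b%:R = 0 by move=> ->; rewrite mulr0.
split; [|split; [|split; [|split]]].
- move=> s2 m2 s1; have d2 := dZ_even s2 s1.
  have nd : (n_shift sigma l m + dZ sigma l' = dZ sigma l + 1)%N.
    by have := @dZ_even sigma l' s2; move: m2; rewrite !inE; lia.
  have e0 : eps sigma l' = 0%N by rewrite /eps; move: m2; rewrite !inE; lia.
  split=> //; apply/matrixP => r j; rewrite Rt e0 mul1r 3!mxE.
  have rN := ltn_ord r; have jd := ltn_ord j.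
  rewrite (entries_fit _ _ (entries_col (dg (-1) _) (O 1%N _))) //.
  rewrite (entries_fit _ _ (entries_col (O 1%N _) (dg 0 _))) //; last by lia.
  rewrite (entries_fit _ _ (entries_block (O 2%N _) (O 2%N 1%N) (dg 1 _)
     (entries_scale (gamma nu l m l%:Z 1) (@entries_evec R _ _)))); [|lia|lia].
  rewrite -[LHS]addrA -[RHS]addrA; congr (_ + _ + _).
  + by case: ifP => h //; apply: kron0; lia.
  + by case: ifP => h; [apply: kron0|apply: kron]; lia.
  rewrite entries_if_single; have [jl|jl] := ltnP j (dZ sigma l - 1).
    rewrite [X in _ + X = _]kron0 ?[X in _ = _ + X]kron0 ?addr0; try lia.
    by case: ifP => h; [apply: kron0|apply: kron]; lia.
  (* In the last column p = l. The direct gamma_1 term would lie in row d + 1, outside the matrix;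
     the folded one lies in row d - 1. *)
  rewrite (_ : 2 * _ + _ = l%:Z); last by lia.
  rewrite [X in X + _ = _]kron0 ?add0r; last by lia.
  case: ifP => h; first by rewrite add0r; apply: kron; lia.
  by rewrite [X in _ = _ + X]kron0 ?addr0; [apply: kron|]; lia.
- move=> s2 m2 s1; have d2 := dZ_odd s2 s1.
  have nd : (n_shift sigma l m + dZ sigma l' = dZ sigma l + 1)%N.
    by have := @dZ_odd sigma l' s2; move: m2; rewrite !inE; lia.
  split=> //; apply/matrixP => r j; rewrite Rt 2!mxE.
  have rN := ltn_ord r; have jd := ltn_ord j.
  rewrite (entries_fit _ _ (entries_col (dg (-1) _) (O 1%N _))) //.
  rewrite (entries_fit _ _ (entries_col (O 1%N _) (dg 0 _))) //; last by lia.
  rewrite (entries_fit _ _ (entries_block (O 2%N _) (O 2%N 1%N) (dg 1 _) (O _ _))); [|lia|lia].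
  (* Here p <= l - 2, so nothing is folded. *)
  rewrite [X in _ + X = _]kron0 ?addr0; last by lia.
  congr (_ + _ + _).
  + by case: ifP => h //; apply: kron0; lia.
  + by case: ifP => h; [apply: kron0|apply: kron]; lia.
  by do 2?case: ifP => ?; first [apply: kron0; lia|apply: kron; lia].
- move=> s2 m2 s1; have d2 := dZ_even s2 s1.
  have nd : (n_shift sigma l m + dZ sigma l' = dZ sigma l)%N.
    by have := @dZ_odd sigma l' s2; move: m2; rewrite !inE; lia.
  have e1 : eps sigma l' = 1%N by rewrite /eps; move: m2; rewrite !inE; lia.
  split=> [d1|d1].
    (* For d = 1 the only index p is l = delta, and the term gamma_{delta,-1} and the folded term
       gamma_{l,1}, with sign (-1)^eps = -1, fall on the single entry. *)
    have d1' : dZ sigma l' = 1%N by lia.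
    split=> //; apply/matrixP => i j.
    rewrite -(col_mxEd (Omx R (n_shift sigma l m) _)) Rt mxE e1 expr1 mulN1r /=.
    have i1 := ltn_ord i; have j1 := ltn_ord j.
    rewrite (_ : (_ == j :> nat) = true); last by lia.
    rewrite (_ : (_ == (j + 1)%N) = false); last by lia.
    rewrite (_ : (_ == (j + 2)%N) = false); last by lia.
    rewrite (_ : (_ && _) = true); last by lia.
    rewrite (_ : 2 * (j : nat)%:Z + _ = l%:Z); last by lia.
    rewrite (_ : (delta_l sigma l)%:Z = l%:Z); last by lia.
    by rewrite !mulr1 !mulr0 !addr0.
  split=> //; apply/matrixP => r j; rewrite Rt e1 expr1 mulN1r 3!mxE.
  have rN := ltn_ord r; have jd := ltn_ord j.
  rewrite (entries_fit _ _ (dg (-1) _)) //.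
  rewrite (entries_fit _ _ (entries_block (O 1%N _) (O 1%N 1%N) (dg 0 _) (O _ _))); [|lia|lia].
  rewrite (entries_fit _ _ (entries_block (O 2%N _) (entries_row (O 2%N 1%N) (O 2%N 1%N)) (dg 1 _)
     (entries_row (O _ 1%N)
        (entries_scale (- gamma nu l m l%:Z 1) (@entries_evec R _ _))))); [|lia|lia].
  rewrite -[LHS]addrA -[RHS]addrA; congr (_ + _ + _).
  + by do 2?case: ifP => ?; first [apply: kron0; lia|apply: kron; lia].
  rewrite entries_if_single; have [jl|jl] := ltnP j (dZ sigma l - 1).
    rewrite [X in _ + X = _]kron0 ?[X in _ = _ + X]kron0 ?addr0; try lia.
    by do 3?case: ifP => ?; first [apply: kron0; lia|apply: kron; lia|exfalso; lia].
  rewrite (_ : 2 * _ + _ = l%:Z); last by lia.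
  rewrite [X in X + _ = _]kron0 ?add0r; last by lia.
  rewrite [(j < _ - 2)%N](_ : _ = false); last by lia.
  rewrite [(j - _ < 1)%N](_ : _ = false); last by lia.
  case: ifP => h; first by rewrite add0r; apply: kron; lia.
  by rewrite [X in _ = _ + X]kron0 ?addr0; [apply: kron|]; lia.
- move=> s2 m2 s1; have d2 := dZ_odd s2 s1.
  have nd : (n_shift sigma l m + dZ sigma l' = dZ sigma l + 2)%N.
    by have := @dZ_even sigma l' s2; move: m2; rewrite !inE; lia.
  split=> //; apply/matrixP => r j; rewrite Rt 2!mxE.
  have rN := ltn_ord r; have jd := ltn_ord j.
  rewrite (entries_fit _ _ (entries_col (dg (-1) _) (O 2%N _))) //.
  rewrite (entries_fit _ _ (entries_col (O 1%N _) (entries_col (dg 0 _) (O 1%N _)))) //; last by lia.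
  rewrite (entries_fit _ _ (entries_col (O 2%N _) (dg 1 _))) //; last by lia.
  rewrite [X in _ + X = _]kron0 ?addr0; last by lia.
  congr (_ + _ + _).
  + by case: ifP => h //; apply: kron0; lia.
  + by do 2?case: ifP => ?; first [apply: kron0; lia|apply: kron; lia].
  by case: ifP => h; [apply: kron0|apply: kron]; lia.
move=> s2; have d2 := dZ_1 l s2.
have nd : (n_shift sigma l m + dZ sigma l' = dZ sigma l + 1)%N.
  by have := @dZ_1 sigma l' s2; lia.
split=> //; apply/matrixP => r j; rewrite Rt 3!mxE.
have rN := ltn_ord r; have jd := ltn_ord j.
rewrite (entries_fit _ _ (entries_col (dg (-1) _) (O 1%N _))) //.
rewrite (entries_fit _ _ (entries_col (O 1%N _) (dg 0 _))) //; last by lia.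
rewrite (entries_fit _ _ (entries_block (O 2%N _) (O 2%N 1%N) (dg 1 _)
   (entries_scale ((-1) ^+ eps sigma l' * gamma nu l m (l%:Z - 1) 1) (@entries_evec R _ _)))); [|lia|lia].
rewrite -[LHS]addrA -[RHS]addrA; congr (_ + _ + _).
- by case: ifP => h //; apply: kron0; lia.
- by case: ifP => h; [apply: kron0|apply: kron]; lia.
rewrite entries_if_single; have [jl|jl] := ltnP j (dZ sigma l - 1).
  rewrite [X in _ + X = _]kron0 ?[X in _ = _ + X]kron0 ?addr0; try lia.
  by case: ifP => h; [apply: kron0|apply: kron]; lia.
(* In the last column p = l - 1, and the folded term lies in row d, together with the gamma_0
   term. *)
rewrite (_ : 2 * _ + _ = l%:Z - 1); last by lia.
rewrite [X in X + _ = _]kron0 ?add0r; last by lia.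
case: ifP => h; first by rewrite add0r; apply: kron; lia.
by rewrite [X in _ = _ + X]kron0 ?addr0; [apply: kron|]; lia.
Qed.
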